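(* Assume that $(L^i,H^i,F,G)$ satisfy the assumptions (A) stated in the context, and that $(\mathbf X,\mathbf Y,\mathbf Z)$ is a solution of the McKean–Vlasov FBSDE $$\begin{cases}dX^i_t=-D_pH^i(X^i_t,nY^i_t)dt+dW^i_t,\\ dY^i_t=-\Big(\frac1nD_xL^i\big(X^i_t,-D_pH^i(X^i_t,nY^i_t)\big)+\mathcal F^i(X^i_t,\bm m_t)\Big)dt+Z^i_tdW^i_t,\\ X^i_0=\xi^i,\quad Y^i_T=\mathcal G^i(X^i_T,\bm m_T),\qquad\bm m_t=(\mathcal L(X^1_t),\dots,\mathcal L(X^n_t)),\end{cases}\quad i=1,\dots,n.$$ Then $\alpha^i_t=-D_pH^i(X^i_t,nY^i_t)$, $i=1,\dots,n$, defines an optimizer for the open-loop distributed control problem $\inf_{\bm\alpha}J_{\rm OL}(\bm\alpha)$ defined in the context.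
   Context: **Notation.** Fix $n,d\in\mathbb N$, $T>0$, and a probability space carrying independent $d$-dimensional Brownian motions $W^1,\dots,W^n$ and an independent complete atomless $\sigma$-algebra $\mathcal F_0$; $\mathbb F$ is the augmented filtration they generate. $\xi^1,\dots,\xi^n$ are independent square-integrable $\mathcal F_0$-measurable $\mathbb R^d$-valued random variables. $D_i$ is the gradient in $x^i\in\mathbb R^d$ for functions of $\mathbf x=(x^1,\dots,x^n)\in(\mathbb R^d)^n$. $\mathcal L(Z)$ is the law of $Z$. For $\bm m=(m^1,\dots,m^n)\in\mathcal P_2(\mathbb R^d)^n$, $\langle\bm m^{-i},f\rangle(x)$ is the integral of $f(x^1,\dots,x^{i-1},x,x^{i+1},\dots,x^n)$ against $\prod_{j\ne i}m^j(dx^j)$, and $\mathcal F^i(x,\bm m)=\langle\bm m^{-i},D_iF\rangle(x)$, $\mathcal G^i(x,\bm m)=\langle\bm m^{-i},D_iG\rangle(x)$. **Assumptions (A).** $L^i:\mathbb R^d\times\mathbb R^d\to\mathbb R$ ($i=1,\dots,n$), $F,G:(\mathbb R^d)^n\to\mathbb R$, and $H^i(x,p)=\sup_a(-a\cdot p-L^i(x,a))$. $F$ and $G$ are bounded from below and convex, $F$ is $C^2$, $G$ is $C^2$ with locally $\alpha$-Hölder second derivatives for some $\alpha\in(0,1)$, and both have bounded second derivatives. $L^i,H^i$ are $C^2$ with bounded second derivatives, $L^i$ is bounded from below, and for some $C_L>0$, $D^2L^i(x,a)\ge C_L\begin{pmatrix}0&0\\0&I_{d\times d}\end{pmatrix}$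 for all $x,a$. **Solutions.** A solution is a triple of progressively measurable processes with values in $(\mathbb R^d)^n\times(\mathbb R^d)^n\times(\mathbb R^{d\times d})^n$ satisfying the equations and $\mathbb E[\sup_t(|\mathbf X_t|^2+|\mathbf Y_t|^2)+\int_0^T|\mathbf Z_t|^2dt]<\infty$. **Open-loop distributed problem.** Minimize $$J_{\rm OL}(\bm\alpha)=\mathbb E\Big[\int_0^T\Big(\tfrac1n\sum_{i=1}^nL^i(X^i_t,\alpha^i_t)+F(\mathbf X_t)\Big)dt+G(\mathbf X_T)\Big],\quad X^i_t=\xi^i+\int_0^t\alpha^i_sds+W^i_t,$$ over square-integrable processes $\bm\alpha$ such that $\alpha^i$ is adapted to the augmented filtration generated by $W^i$ and $\xi^i$, for each $i$. *)

(* Defs.v *)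
From HB Require Import structures.
From mathcomp Require Import all_boot all_order all_algebra.
From mathcomp Require Import all_classical all_reals all_analysis.

Set Implicit Arguments.
Unset Strict Implicit.
Unset Printing Implicit Defensive.

Import Order.TTheory GRing.Theory Num.Theory.
Import numFieldNormedType.Exports.

Local Open Scope classical_set_scope.
Local Open Scope ring_scope.

(** Conventions.  [R^d] is ['rV[R]_d]; [(R^d)^n] is ['M[R]_(n, d)], the point
    [x^i] being [row i x].  A process is a function [R -> Omega -> V] of which
    only the times in [[0, T]] matter. *)

Section euclidean.
Context {R : realType}.

Definition dotp {d} (x y : 'rV[R]_d) : R := \sum_k x 0 k * y 0 k.

(* squared Euclidean (Frobenius) norm; the library norm on matrices is the
   maximum norm *)
Definition sqnorm {m n} (A : 'M[R]_(m, n)) : R := \sum_i \sum_j A i j ^+ 2.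

End euclidean.

Section derivatives.
Context {R : realType}.

Section smoothness.
Context {V : normedModType R}.
Implicit Types f : V -> R.

Definition C1 f :=
  (forall x, differentiable f x) /\ (forall v, continuous ('D_v f)).

Definition C2 f := C1 f /\ (forall v, C1 ('D_v f)).

Definition bounded_second_derivatives f :=
  exists C : R, forall x u v, `|'D_u ('D_v f) x| <= C * (`|u| * `|v|).

Definition locally_holder_second_derivatives (a : R) f :=
  forall r : R, exists C : R, forall x y u v, `|x| <= r -> `|y| <= r ->
    `|'D_u ('D_v f) x - 'D_u ('D_v f) y| <= C * `|x - y| `^ a * (`|u| * `|v|).

Definition bounded_below f := exists c : R, forall x, c <= f x.

End smoothness.

(* [D_i F], the gradient in the variable [x^i] *)
Definition grad_i {n d} (F : 'M[R]_(n, d) -> R) (i : 'I_n) (x : 'M[R]_(n, d))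
    : 'rV[R]_d :=
  \row_k 'D_(delta_mx i k) F x.

(* gradients in the first and the second variable of a function on
   [R^d * R^d] *)
Definition grad_fst {d} (f : 'rV[R]_d * 'rV[R]_d -> R) (x p : 'rV[R]_d)
    : 'rV[R]_d :=
  \row_k 'D_(delta_mx 0 k, 0) f (x, p).

Definition grad_snd {d} (f : 'rV[R]_d * 'rV[R]_d -> R) (x p : 'rV[R]_d)
    : 'rV[R]_d :=
  \row_k 'D_(0, delta_mx 0 k) f (x, p).

End derivatives.

Record assumptions_A {R : realType} (n d : nat)
    (L H : 'I_n -> 'rV[R]_d * 'rV[R]_d -> R)
    (F G : 'M[R]_(n, d) -> R) : Prop := {
  A_H_def : forall i x p, (H i (x, p))%:E =
    ereal_sup (range (fun a => (- dotp a p - L i (x, a))%:E)) ;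
  A_F_below : bounded_below F ;
  A_G_below : bounded_below G ;
  A_F_convex : convex_function setT F ;
  A_G_convex : convex_function setT G ;
  A_F_C2 : C2 F ;
  A_G_C2 : C2 G ;
  A_G_holder : exists a : R, 0 < a < 1 /\
    locally_holder_second_derivatives a G ;
  A_F_bounded : bounded_second_derivatives F ;
  A_G_bounded : bounded_second_derivatives G ;
  A_L_C2 : forall i, C2 (L i) ;
  A_H_C2 : forall i, C2 (H i) ;
  A_L_bounded : forall i, bounded_second_derivatives (L i) ;
  A_H_bounded : forall i, bounded_second_derivatives (H i) ;
  A_L_below : forall i, bounded_below (L i) ;
  A_L_convex : exists C : R, 0 < C /\
    forall i z (v : 'rV[R]_d * 'rV[R]_d),
      C * sqnorm v.2 <= 'D_v ('D_v (L i)) z }.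

Section sigma_algebras.
Context {Omega : Type} {V : topologicalType}.

(* sigma-algebra generated by [f], for the Borel sets of [V] *)
Definition sigma_gen (f : Omega -> V) : set (set Omega) :=
  preimage_set_system setT f <<s open >>.

Definition measurable_wrt (G : set (set Omega)) (f : Omega -> V) :=
  sigma_gen f `<=` G.

End sigma_algebras.

Section independence.
Context {R : realType} {dd : measure_display} {Omega : measurableType dd}.
Variable P : probability Omega R.

Definition independent2 (A B : set (set Omega)) :=
  forall a b, A a -> B b -> P (a `&` b) = (P a * P b)%E.

Definition independent_family (I : finType) (A : I -> set (set Omega)) :=
  forall (J : {set I}) (E : I -> set Omega), (forall i, i \in J -> A i (E i)) ->
    P (\bigcap_(i in [set` J]) E i) = (\prod_(i in J) P (E i))%E.

Definition atomless (A : set (set Omega)) :=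
  forall a, A a -> (0 < P a)%E ->
    exists b, [/\ A b, b `<=` a, (0 < P b)%E & (P b < P a)%E].

End independence.

Definition borelRn (R : realType) (d : nat) : measurableType _ :=
  g_sigma_algebraType (@open 'rV[R]_d).

Section product_probability.
Context {R : realType} {dd : measure_display} {V : measurableType dd}.

Definition cons_pair n (p : V * n.-tuple V) : n.+1.-tuple V :=
  [tuple of p.1 :: p.2].

Lemma measurable_cons_pair n : measurable_fun setT (@cons_pair n).
Proof.
apply: (@measurable_cons _ _ _ _ fst n snd); first exact: measurable_fst.
exact: measurable_snd.
Qed.

HB.instance Definition _ n :=
  isMeasurableFun.Build _ _ _ _ (@cons_pair n) (@measurable_cons_pair n).

Fixpoint product_probability n :
    ('I_n -> probability V R) -> probability (n.-tuple V) R :=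
  if n is n'.+1 then fun m =>
    distribution (m ord0 \x product_probability (fun j => m (lift ord0 j)))%E
      (@cons_pair n')
  else fun=> \d_([tuple]).

Lemma product_probability_box n (m : 'I_n -> probability V R)
    (A : 'I_n -> set V) : (forall k, measurable (A k)) ->
  product_probability m [set y | forall k, A k (tnth y k)] =
  (\prod_k m k (A k))%E.
Proof.
elim: n m A => [|n IH] m A mA /=.
  by rewrite big_ord0 /dirac indicE mem_set//= => -[].
rewrite big_ord_recl -IH//.
rewrite /distribution/pushforward -product_measure1E//.
- congr (_ _); apply/seteqP; split=> [[x y]/= h|[x y]/= [h0 h] k].
    split; first by have := h ord0.
    by move=> k; have := h (lift ord0 k); rewrite /cons_pair tnthS.
  have [j ->|->] := unliftP ord0 k; last by [].
  by rewrite /cons_pair tnthS; exact: h.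
- rewrite (_ : mkset _ = \bigcap_(k in [set: 'I_n]) ((@tnth n V ^~ k) @^-1` A (lift ord0 k))).
    apply: fin_bigcap_measurable => // k _.
    by rewrite -[X in measurable X]setTI; exact: measurable_tnth.
  by apply/seteqP; split=> y /= h k => [_|]; exact: (h k).
Qed.

End product_probability.

Section mean_field.
Context {R : realType} {n d : nat}.

(* [(x^1, .., x^{i-1}, x, x^{i+1}, .., x^n)], where [y] lists the [x^j], j <> i *)
Definition insert_at (i : 'I_n) (x : 'rV[R]_d) (y : n.-1.-tuple (borelRn R d))
    : 'M[R]_(n, d) :=
  \matrix_(j < n) (if unlift i j is Some k then tnth y k else x : 'rV[R]_d).

(* [<m^{-i}, f>(x)] *)
Definition bracket (m : 'I_n -> probability (borelRn R d) R) (i : 'I_n)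
    (f : 'M[R]_(n, d) -> R) (x : 'rV[R]_d) : R :=
  \int[product_probability (fun k => m (lift i k))]_y f (insert_at i x y).

(* [<m^{-i}, D_i F>(x)] *)
Definition bracket_grad (F : 'M[R]_(n, d) -> R) (i : 'I_n) (x : 'rV[R]_d)
    (m : 'I_n -> probability (borelRn R d) R) : 'rV[R]_d :=
  \row_k bracket m i (fun z => grad_i F i z 0 k) x.

End mean_field.

Section processes.
Context {R : realType} {dd : measure_display} {Omega : measurableType dd}.
Variables (P : probability Omega R) (T : R).

Local Notation leb := (@lebesgue_measure R).

Definition adapted {V : topologicalType} (Fil : R -> set (set Omega))
    (X : R -> Omega -> V) :=
  forall t, t \in `[0, T] -> measurable_wrt (Fil t) (X t).

(* measurability on [[0, t] * Omega] for the product of the Borel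
   sigma-algebra and [G] *)
Definition jointly_measurable {V : topologicalType} (G : set (set Omega))
    (t : R) (X : R -> Omega -> V) :=
  forall B : set V, <<s open >> B ->
    <<s [set A `*` C | A in (measurable : set (set R)) & C in G] >>
      ((`[0, t]%classic `*` setT) `&` [set p | B (X p.1 p.2)]).

Definition progressive {V : topologicalType} (Fil : R -> set (set Omega))
    (X : R -> Omega -> V) :=
  forall t, t \in `[0, T] -> jointly_measurable (Fil t) t X.

Definition sigma_past {V : topologicalType} (X : R -> Omega -> V) (t : R)
    : set (set Omega) :=
  <<s \bigcup_(s in `[0, t]%classic) sigma_gen (X s) >>.

Definition gaussian_increments {d} (B : R -> Omega -> 'rV[R]_d) :=
  forall s t, 0 <= s -> s < t -> t <= T ->
    forall A : 'I_d -> set R, (forall k, measurable (A k)) ->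
      P [set w | forall k, A k (B t w 0 k - B s w 0 k)] =
      (\prod_k normal_prob 0 (Num.sqrt (t - s)) (A k))%E.

Record brownian_motion {d} (B : R -> Omega -> 'rV[R]_d) : Prop := {
  bm_measurable : adapted (fun=> measurable) B ;
  bm_start : {ae P, forall w, B 0 w = 0} ;
  bm_continuous : {ae P, forall w, {within `[0, T], continuous (B^~ w)}} ;
  bm_independent : forall s t, 0 <= s -> s < t -> t <= T ->
    independent2 P (sigma_past B s) (sigma_gen (fun w => B t w - B s w)) ;
  bm_gaussian : gaussian_increments B }.

(* simple integrand [\sum_(j < N) phi_j 1_(]tau_j, tau_{j+1}])] *)
Record simple_process := SimpleProcess {
  sp_size : nat ;
  sp_time : nat -> R ;
  sp_coef : nat -> Omega -> R }.

Definition simple_wf (Fil : R -> set (set Omega)) (S : simple_process) :=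
  [/\ forall j, (j <= sp_size S)%N -> sp_time S j \in `[0, T],
      forall j, (j < sp_size S)%N -> sp_time S j <= sp_time S j.+1,
      forall j, (j < sp_size S)%N ->
        measurable_wrt (Fil (sp_time S j)) (sp_coef S j) &
      forall j, (j < sp_size S)%N ->
        exists C : R, forall w, `|sp_coef S j w| <= C].

Definition simple_value (S : simple_process) (t : R) (w : Omega) : R :=
  \sum_(j < sp_size S)
    sp_coef S j w * \1_(`]sp_time S j, sp_time S j.+1]) t.

Definition simple_integral (S : simple_process) (B : R -> Omega -> R)
    (t : R) (w : Omega) : R :=
  \sum_(j < sp_size S) sp_coef S j w *
    (B (Num.min (sp_time S j.+1) t) w - B (Num.min (sp_time S j) t) w).

(* [M_t = \int_0^t K_s dB_s] on [[0, T]], for a real Brownian motion [B] and an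
   integrand [K] in [L^2(dt * P)] : [M] is the continuous L^2-limit of the
   integrals of simple processes converging to [K].  The adaptedness of [M] is
   not redundant, as the integral of a non-measurable nonnegative function is
   in the library a lower integral. *)
Definition ito_integral (Fil : R -> set (set Omega)) (K B M : R -> Omega -> R) :=
  [/\ progressive Fil K,
      adapted Fil M,
      {ae P, forall w, {within `[0, T], continuous (M^~ w)}} &
      exists S : nat -> simple_process,
      [/\ forall m, simple_wf Fil (S m),
          (\int[P]_w \int[leb]_(t in `[0%R, T])
            ((simple_value (S m) t w - K t w) ^+ 2)%:E)%E
            @[m --> \oo] --> 0%E &
          forall t, t \in `[0, T] ->
          (\int[P]_w ((simple_integral (S m) B t w - M t w) ^+ 2)%:E)%E
            @[m --> \oo] --> 0%E]].

(* [M_t = \int_0^t Z_s dB_s] for [Z] matrix valued and [B] vector valued *)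
Definition ito_integral_mx {d} (Fil : R -> set (set Omega))
    (Z : R -> Omega -> 'M[R]_d) (B M : R -> Omega -> 'rV[R]_d) :=
  exists N : 'I_d -> 'I_d -> R -> Omega -> R,
    (forall k l, ito_integral Fil (fun t w => Z t w k l)
                   (fun t w => B t w 0 l) (N k l)) /\
    (forall t w k, M t w 0 k = \sum_l N k l t w).

Definition integral_rV {d} (D : set R) (f : R -> 'rV[R]_d) : 'rV[R]_d :=
  \row_k \int[leb]_(s in D) f s 0 k.

End processes.

Section setting.
Context {R : realType} {dd : measure_display} {Omega : measurableType dd}.
Context {n d : nat}.
Variables (P : probability Omega R) (T : R) (F0 : set (set Omega)).
Variables (W : R -> Omega -> 'M[R]_(n, d)) (xi : Omega -> 'M[R]_(n, d)).

Local Notation leb := (@lebesgue_measure R).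

Definition component (i : 'I_n) (X : R -> Omega -> 'M[R]_(n, d))
    : R -> Omega -> 'rV[R]_d :=
  fun t w => row i (X t w).

Record setting : Prop := {
  set_T : 0 < T ;
  set_F0_sigma : sigma_algebra setT F0 ;
  set_F0_measurable : F0 `<=` measurable ;
  set_F0_complete : P.-negligible `<=` F0 ;
  set_F0_atomless : atomless P F0 ;
  set_W_bm : forall i, brownian_motion P T (component i W) ;
  (* [W^1, .., W^n, F0] are mutually independent; [None] stands for [F0] *)
  set_W_independent : independent_family P
    (fun o : option 'I_n =>
       if o is Some i then sigma_past (component i W) T else F0) ;
  set_xi_measurable : measurable_wrt F0 xi ;
  set_xi_independent : independent_family P
    (fun i => sigma_gen (fun w => row i (xi w))) ;
  set_xi_square : (\int[P]_w (sqnorm (xi w))%:E < +oo)%E }.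

Definition full_filtration (t : R) : set (set Omega) :=
  <<s F0 `|` sigma_past W t `|` P.-negligible >>.

(* augmented filtration generated by [W^i] and [xi^i] *)
Definition own_filtration (i : 'I_n) (t : R) : set (set Omega) :=
  <<s sigma_gen (fun w => row i (xi w)) `|` sigma_past (component i W) t
        `|` P.-negligible >>.

Section fbsde.
Variables (L H : 'I_n -> 'rV[R]_d * 'rV[R]_d -> R) (F G : 'M[R]_(n, d) -> R).

(* [- D_p H^i(X^i_t, n Y^i_t)], i = 1, .., n *)
Definition feedback (X Y : R -> Omega -> 'M[R]_(n, d))
    : R -> Omega -> 'M[R]_(n, d) :=
  fun t w => \matrix_(i < n)
    (- grad_snd (H i) (row i (X t w)) (n%:R *: row i (Y t w))).

Definition is_law_flow (m : R -> 'I_n -> probability (borelRn R d) R)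
    (X : R -> Omega -> 'M[R]_(n, d)) :=
  forall t i (A : set (borelRn R d)), t \in `[0, T] -> measurable A ->
    m t i A = pushforward P (component i X t : Omega -> borelRn R d) A.

Record fbsde_solution (X Y : R -> Omega -> 'M[R]_(n, d))
    (Z : 'I_n -> R -> Omega -> 'M[R]_d)
    (m : R -> 'I_n -> probability (borelRn R d) R) : Prop := {
  sol_X_progressive : progressive T full_filtration X ;
  sol_Y_progressive : progressive T full_filtration Y ;
  sol_Z_progressive : forall i, progressive T full_filtration (Z i) ;
  sol_integrable :
    (\int[P]_w (ereal_sup [set (sqnorm (X t w) + sqnorm (Y t w))%:E
                             | t in `[0%R, T]] +
                \int[leb]_(t in `[0%R, T]) (\sum_i sqnorm (Z i t w))%:E)
     < +oo)%E ;
  sol_law : is_law_flow m X ;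
  sol_forward : {ae P, forall w, forall t, t \in `[0, T] -> forall i,
    row i (X t w) = row i (xi w)
      + integral_rV `[0, t] (fun s => row i (feedback X Y s w))
      + row i (W t w)} ;
  sol_backward : forall i, exists M : R -> Omega -> 'rV[R]_d,
    ito_integral_mx P T full_filtration (Z i) (component i W) M /\
    {ae P, forall w, forall t, t \in `[0, T] ->
      row i (Y t w) = bracket_grad G i (row i (X T w)) (m T)
        + integral_rV `[t, T] (fun s =>
            n%:R^-1 *: grad_fst (L i) (row i (X s w)) (row i (feedback X Y s w))
            + bracket_grad F i (row i (X s w)) (m s))
        - (M T w - M t w)} }.

End fbsde.

Section control.
Variables (L : 'I_n -> 'rV[R]_d * 'rV[R]_d -> R) (F G : 'M[R]_(n, d) -> R).

Record distributed_control (alpha : R -> Omega -> 'M[R]_(n, d)) : Prop := {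
  ctrl_measurable : jointly_measurable measurable T alpha ;
  ctrl_adapted : forall i, adapted T (own_filtration i) (component i alpha) ;
  ctrl_square :
    (\int[P]_w \int[leb]_(t in `[0%R, T]) (sqnorm (alpha t w))%:E < +oo)%E }.

Definition controlled_state (alpha : R -> Omega -> 'M[R]_(n, d))
    : R -> Omega -> 'M[R]_(n, d) :=
  fun t w => \matrix_(i < n)
    (row i (xi w) + integral_rV `[0, t] (fun s => row i (alpha s w))
     + row i (W t w)).

(* The integrands are bounded from below, so that the values are in
   ]-oo, +oo]. *)
Definition J_OL (alpha : R -> Omega -> 'M[R]_(n, d)) : \bar R :=
  (\int[P]_w
    (\int[leb]_(t in `[0%R, T])
       (n%:R^-1 * (\sum_i L i (row i (controlled_state alpha t w),
                               row i (alpha t w)))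
        + F (controlled_state alpha t w))%R%:E
     + (G (controlled_state alpha T w))%:E))%E.

Definition OL_optimizer (alpha : R -> Omega -> 'M[R]_(n, d)) :=
  distributed_control alpha /\
  forall beta, distributed_control beta -> (J_OL alpha <= J_OL beta)%E.

End control.

End setting.

(* Main.v *)
Require Import Defs.
From HB Require Import structures.
From mathcomp Require Import all_boot all_order all_algebra.
From mathcomp Require Import all_classical all_reals all_analysis.
From mathcomp Require Import measurable_realfun ring lra.

Set Implicit Arguments.
Unset Strict Implicit.
Unset Printing Implicit Defensive.
Import Order.TTheory GRing.Theory Num.Theory.
Import numFieldNormedType.Exports.
Local Open Scope classical_set_scope.
Local Open Scope ring_scope.

(** The solution of the mean-field system is shown to be distributed although it
    is only assumed adapted to the full filtration. Let [at_] be the conditional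
    expectation of [alpha^i] given the whole history of [(xi^i, W^i)], and let
    [xt] be the state that it drives. Since the drift of [Y^i] depends on [(t,
    X^i_t, alpha^i_t)] only, [at_ - alpha^i] is orthogonal to the adjoint
    expressions built from [(xt, at_)] and from [(X^i, alpha^i)]: to the former
    by projection, to the latter because both [alpha^i_t] and its conditional
    expectation are orthogonal to the stochastic integral [M_T - M_t]. Strong
    convexity of [L^i] and convexity of [F] and [G] then force [at_ = alpha^i].
    As the increments of [W] after [t] are independent of the past, being
    measurable for the whole history of [(xi^i, W^i)] and for the full past at
    [t] implies being measurable for its past at [t]. Hence the [X^i] are
    independent. For optimality, convexity bounds [J(beta) - J(alpha)] below by
    the first variation of the cost, in which the conditional means of [D_i F]
    and [D_i G] can be replaced by the brackets against [m^{-i}] since the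
    deviation [beta^i - alpha^i] depends on [(xi^i, W^i)] only; the backward
    equation makes the result vanish. *)

(** * Integrals of real functions *)

(** With the laws [m] frozen the equations decouple into one convex control problem per index; the
    obstacle is that a solution might still draw on the other Brownian motions or on further
    randomness in [F0]. Projecting on the history up to [T], rather than up to the current time,
    makes [at_] jointly measurable through a single conditional expectation on time times
    probability. The price is that [at_] may anticipate, so that its orthogonality to stochastic
    integrals is not a plain martingale property and needs [simple_proj]. Convexity is strong in the
    control only; this suffices because two states with the same noise differ by the time integral
    of the control difference. For the same reason no Ito formula is needed: products of a state
    difference and a costate are handled by transposing the kernel of time integration, in
    [Kint_transpose]. The first-order condition for the Hamiltonian reads [Y^i] as minus
    [n^-1 D_a L^i] along the solution, so that both uses of the backward equation become
    orthogonality relations for [rsol]. *)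

Section lower_integral.
Context {d} {T : measurableType d} {R : realType} (mu : {measure set T -> \bar R}).
Local Open Scope ereal_scope.
Import HBNNSimple.

(* No measurability of [f] and [g]: the costs of an arbitrary control are lower
   integrals. *)
Lemma le_nnintegral_ae (N : set T) (f g : T -> \bar R) :
  measurable N -> mu N = 0 -> (forall x, 0 <= f x) -> (forall x, 0 <= g x) ->
  (forall x, ~ N x -> f x <= g x) ->
  \int[mu]_x f x <= \int[mu]_x g x.
Proof.
move=> mN N0 f0 g0 fg; rewrite !ge0_integralTE//.
apply: ge_ereal_sup => _ /= [h hf <-].
(* Cutting [h] to 0 on [N] keeps its integral and puts it below [g] everywhere, which makes it a
   competitor in the supremum defining the integral of [g]. *)
pose h' := proj_nnsfun h (measurableC mN).
have -> : sintegral mu h = sintegral mu h'.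
  rewrite -!integralT_nnsfun.
  apply: ge0_ae_eq_integral => //.
  - exact/measurable_EFinP.
  - exact/measurable_EFinP.
  - by move=> x _; rewrite lee_fin.
  - by move=> x _; rewrite lee_fin.
  exists N; split=> // x /=; apply: contra_notP => Nx _.
  by rewrite /h' /= mindicE mem_set// mulr1.
apply: ereal_sup_ubound; exists h' => //= x.
rewrite mindicE /h' /=; have [Nx|nNx] := pselect (N x).
  by rewrite memNset ?mulr0//; exact.
by rewrite mem_set// mulr1; apply: le_trans (fg x nNx); exact: hf.
Qed.

Lemma le_integral_ae (N : set T) (f g : T -> \bar R) :
  measurable N -> mu N = 0 -> (forall x, ~ N x -> f x <= g x) ->
  \int[mu]_x f x <= \int[mu]_x g x.
Proof.
move=> mN N0 fg; rewrite [leLHS]integralE [leRHS]integralE.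
apply: leeB; apply: (le_nnintegral_ae mN N0) => // x /fg h.
  by rewrite !funeposE; apply: le_max2.
by rewrite !funenegE; apply: le_max2 => //; rewrite leeN2.
Qed.

End lower_integral.

Notation intg mu f := (mu.-integrable setT (EFin \o f)).

Section integrable_reals.
Context {d} {T : measurableType d} {R : realType} (mu : {measure set T -> \bar R}).
Implicit Types f g h : T -> R.

Lemma intg_measurable f : intg mu f -> measurable_fun setT f.
Proof. by move=> /integrableP[/measurable_EFinP]. Qed.

Lemma intgD f g : intg mu f -> intg mu g -> intg mu (fun x => f x + g x).
Proof. by move=> fi gi; exact: integrableD fi gi. Qed.

Lemma intgB f g : intg mu f -> intg mu g -> intg mu (fun x => f x - g x).
Proof. by move=> fi gi; exact: integrableB fi gi. Qed.

Lemma intgZ k f : intg mu f -> intg mu (fun x => k * f x).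
Proof. by move=> fi; exact: integrableZl fi. Qed.

Lemma intg_cst0 : intg mu (fun=> 0).
Proof. exact: integrable0. Qed.

Lemma intg_sum I (s : seq I) (F : I -> T -> R) :
  (forall i, intg mu (F i)) -> intg mu (fun x => \sum_(i <- s) F i x).
Proof.
move=> Fi; elim: s => [|i s IH].
  by under [X in EFin \o X]eq_fun do rewrite big_nil; exact: intg_cst0.
by under [X in EFin \o X]eq_fun do rewrite big_cons; exact: intgD.
Qed.

Lemma Rintegral_sum I (s : seq I) (F : I -> T -> R) :
  (forall i, intg mu (F i)) ->
  \int[mu]_x (\sum_(i <- s) F i x) = \sum_(i <- s) \int[mu]_x F i x.
Proof.
move=> Fi; elim: s => [|i s IH].
  rewrite big_nil; under eq_Rintegral do rewrite big_nil.
  by rewrite /Rintegral integral0.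
rewrite big_cons -IH -RintegralD//; last exact: intg_sum.
by apply: eq_Rintegral => x _; rewrite big_cons.
Qed.

Lemma intg_le f g : measurable_fun setT f -> intg mu g ->
  (forall x, `|f x| <= g x) -> intg mu f.
Proof.
move=> mf gi fg; apply: (le_integrable measurableT _ _ gi).
  exact/measurable_EFinP.
move=> x _ /=; rewrite lee_fin (le_trans (fg x))// ler_norm//.
Qed.

Lemma intg_abs f : intg mu f -> intg mu (fun x => `|f x|).
Proof. exact: integrable_norm. Qed.

Lemma EFin_Rintegral f : intg mu f ->
  (\int[mu]_x f x)%:E = (\int[mu]_x (f x)%:E)%E.
Proof. by move=> fi; rewrite /Rintegral fineK//; exact: integrable_fin_num fi. Qed.

Lemma intg_ge0 f : measurable_fun setT f -> (forall x, 0 <= f x) ->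
  (\int[mu]_x (f x)%:E < +oo)%E -> intg mu f.
Proof.
move=> mf f0 fi; apply/integrableP; split; first exact/measurable_EFinP.
by under eq_integral => x _ do rewrite /= ger0_norm//.
Qed.

Lemma ae_eq_Rintegral f g : measurable_fun setT f -> measurable_fun setT g ->
  {ae mu, forall x, f x = g x} -> \int[mu]_x f x = \int[mu]_x g x.
Proof.
move=> mf mg fg; congr fine; apply: ae_eq_integral => //; try exact/measurable_EFinP.
by apply: filterS fg => x h _ /=; rewrite h.
Qed.

Lemma Rintegral_cvg0_ge0 f : intg mu f -> (forall x, 0 <= f x) ->
  \int[mu]_x f x = 0 -> {ae mu, forall x, f x = 0}.
Proof.
move=> fi f0 I0.
have : (\int[mu]_x `|(f x)%:E| = 0)%E.
  by under eq_integral => x _ do rewrite /= ger0_norm//; rewrite -EFin_Rintegral// I0.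
move/(ae_eq_integral_abs mu measurableT (measurable_int _ fi)).
by apply: filterS => x /(_ I) [].
Qed.

End integrable_reals.

(** * Square-integrable functions *)

Definition sqi {d} {T : measurableType d} {R : realType}
    (mu : {measure set T -> \bar R}) (f : T -> R) :=
  measurable_fun setT f /\ (\int[mu]_x ((f x) ^+ 2)%:E < +oo)%E.

Section square_integrable.
Context {d} {T : measurableType d} {R : realType} (mu : {measure set T -> \bar R}).
Implicit Types f g h : T -> R.

Lemma sqi_sq f : sqi mu f -> intg mu (fun x => f x ^+ 2).
Proof.
by move=> [mf fi]; apply: intg_ge0 => // [|x]; [exact: measurable_funX|exact: sqr_ge0].
Qed.

Lemma intg_sqi f : measurable_fun setT f -> intg mu (fun x => f x ^+ 2) -> sqi mu f.
Proof.
move=> mf /integrableP[_ fi]; split=> //.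
by under eq_integral => x _ do rewrite -[(_ ^+ 2)%:E]gee0_abs ?lee_fin ?sqr_ge0//.
Qed.

Lemma sqi_le f g : measurable_fun setT f -> sqi mu g ->
  (forall x, `|f x| <= `|g x|) -> sqi mu f.
Proof.
move=> mf /sqi_sq gi fg; apply: intg_sqi => //.
apply: intg_le gi _; first exact: measurable_funX.
by move=> x; rewrite normrX -[g x ^+ 2]real_normK ?num_real// lerXn2r ?nnegrE.
Qed.

Lemma sqiM f g : sqi mu f -> sqi mu g -> intg mu (fun x => f x * g x).
Proof.
move=> fi gi; have [mf _] := fi; have [mg _] := gi.
apply: (intg_le _ (intgD (sqi_sq fi) (sqi_sq gi))); first exact: measurable_funM.
move=> x; have := sqr_ge0 (f x + g x); have := sqr_ge0 (f x - g x).
have := sqr_ge0 (f x); have := sqr_ge0 (g x).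
by rewrite ler_norml sqrrB sqrrD => ? ? ? ?; apply/andP; split; lra.
Qed.

Lemma sqiZ k f : sqi mu f -> sqi mu (fun x => k * f x).
Proof.
move=> fi; have [mf _] := fi; apply: intg_sqi; first exact: measurable_funM.
have := intgZ (k ^+ 2) (sqi_sq fi).
by apply: eq_integrable => // x _ /=; rewrite exprMn.
Qed.

Lemma sqiD f g : sqi mu f -> sqi mu g -> sqi mu (fun x => f x + g x).
Proof.
move=> fi gi; have [mf _] := fi; have [mg _] := gi.
apply: intg_sqi; first exact: measurable_funD.
apply: (intg_le _ (intgZ 2 (intgD (sqi_sq fi) (sqi_sq gi)))).
  by apply: measurable_funX; exact: measurable_funD.
move=> x; rewrite ger0_norm ?sqr_ge0//.
by have := sqr_ge0 (f x - g x); rewrite sqrrB sqrrD; lra.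
Qed.

Lemma sqiN f : sqi mu f -> sqi mu (fun x => - f x).
Proof. by move=> /(sqiZ (-1)); under eq_fun do rewrite mulN1r. Qed.

Lemma sqiB f g : sqi mu f -> sqi mu g -> sqi mu (fun x => f x - g x).
Proof. by move=> fi /sqiN gi; exact: sqiD fi gi. Qed.

Lemma sqi0 : sqi mu (fun=> 0).
Proof.
by apply: intg_sqi => //; under eq_fun do rewrite expr0n; exact: intg_cst0.
Qed.

Lemma sqi_sum I (s : seq I) (F : I -> T -> R) :
  (forall i, sqi mu (F i)) -> sqi mu (fun x => \sum_(i <- s) F i x).
Proof.
move=> Fi; elim: s => [|i s IH].
  by under eq_fun do rewrite big_nil; exact: sqi0.
by under eq_fun do rewrite big_cons; exact: sqiD.
Qed.

Lemma sqi_bnd k f g : sqi mu g -> measurable_fun setT f -> (forall x, `|f x| <= k) ->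
  sqi mu (fun x => f x * g x).
Proof.
move=> gi mf fk; have [mg _] := gi; apply: (sqi_le _ (sqiZ k gi)).
  exact: measurable_funM.
move=> x; rewrite !normrM ler_wpM2r// (le_trans (fk x))// ler_norm//.
Qed.

Lemma sqi_abs f : sqi mu f -> sqi mu (fun x => `|f x|).
Proof.
move=> fi; have [mf _] := fi; apply: (sqi_le _ fi); first exact: measurableT_comp.
by move=> x; rewrite normr_id.
Qed.

Lemma Rintegral_sq_ge0 f : 0 <= \int[mu]_x (f x ^+ 2).
Proof. by apply: Rintegral_ge0 => x _; exact: sqr_ge0. Qed.

Lemma cauchy_schwarz_sqi f g : sqi mu f -> sqi mu g ->
  (\int[mu]_x (f x * g x)) ^+ 2 <=
  (\int[mu]_x (f x ^+ 2)) * (\int[mu]_x (g x ^+ 2)).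
Proof.
move=> fi gi; set a := \int[mu]_x (f x ^+ 2); set c := \int[mu]_x (g x ^+ 2).
set b := \int[mu]_x (f x * g x).
have ff := sqi_sq fi; have gg := sqi_sq gi; have fg := sqiM fi gi.
have q l : 0 <= a - 2 * l * b + l ^+ 2 * c.
  rewrite /a /b /c -!RintegralZl// -RintegralB//; last exact: intgZ.
  rewrite -RintegralD//; [|by apply: intgB => //; exact: intgZ|exact: intgZ].
  apply: Rintegral_ge0 => x _.
  rewrite (_ : _ + _ = (f x - l * g x) ^+ 2) ?sqr_ge0//; ring.
have a0 : 0 <= a by exact: Rintegral_sq_ge0.
have : 0 <= c by exact: Rintegral_sq_ge0.
rewrite le_eqVlt => /predU1P[c0|c0].
  have [->|b0] := eqVneq b 0; first by rewrite expr0n -c0 mulr0.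
  (* For [c = 0] the quadratic [q] is affine in [l], and this [l] would give it the value -1. *)
  have := q ((a + 1) / (2 * b)).
  rewrite -c0 mulr0 addr0 (_ : 2 * _ * b = a + 1); last by field.
  by lra.
have := q (b / c).
rewrite (_ : a - _ + _ = (a * c - b ^+ 2) / c); last by field; rewrite gt_eqF.
by rewrite pmulr_lge0 ?invr_gt0// subr_ge0.
Qed.

(** Cauchy-Schwarz. Orthogonality to a fixed [g] thus survives L^2 limits, which is how it passes
    from simple integrals to stochastic integrals. *)
Lemma sqiM_cvg (fn : nat -> T -> R) f g : (forall m, sqi mu (fn m)) -> sqi mu f ->
  sqi mu g -> (\int[mu]_x ((fn m x - f x) ^+ 2)%:E @[m --> \oo] --> 0)%E ->
  \int[mu]_x (fn m x * g x) @[m --> \oo] --> \int[mu]_x (f x * g x).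
Proof.
move=> fni fi gi fnf; set c := \int[mu]_x (g x ^+ 2).
have c0 : 0 <= c by exact: Rintegral_sq_ge0.
have {}fnf : \int[mu]_x ((fn m x - f x) ^+ 2) @[m --> \oo] --> 0.
  by apply: fine_cvg.
have {fnf} : Num.sqrt (\int[mu]_x ((fn m x - f x) ^+ 2) * c) @[m --> \oo] --> 0.
  rewrite -sqrtr0; apply: (@cvg_comp _ _ _ _ Num.sqrt _ (nbhs (0:R))).
    by rewrite -(mul0r c); apply: cvgM => //; exact: cvg_cst.
  exact: sqrt_continuous.
move=> h; apply/subr_cvg0; apply/norm_cvg0P.
apply: (@squeeze_cvgr _ _ _ _ (fun=> 0)) h; last exact: cvg_cst.
near=> m; rewrite normr_ge0/= -sqrtr_sqr ler_sqrt ?mulr_ge0 ?Rintegral_sq_ge0//.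
rewrite -RintegralB//; [|exact: sqiM..].
rewrite (le_trans _ (cauchy_schwarz_sqi (sqiB (fni m) fi) gi))//.
by under eq_Rintegral do rewrite -mulrBl.
Unshelve. all: by end_near. Qed.

End square_integrable.

Section finite_square_integrable.
Context {d} {T : measurableType d} {R : realType}
  (mu : {finite_measure set T -> \bar R}).

Lemma intg_cst (k : R) : intg mu (fun=> k).
Proof. exact: finite_measure_integrable_cst. Qed.

Lemma sqi_cst (k : R) : sqi mu (fun=> k).
Proof. by apply: intg_sqi => //; exact: intg_cst. Qed.

Lemma sqi_intg (f : T -> R) : sqi mu f -> intg mu f.
Proof.
move=> fi; have := sqiM fi (sqi_cst 1).
by under [X in EFin \o X]eq_fun do rewrite mulr1.
Qed.

Lemma sqi_bounded (f : T -> R) k : measurable_fun setT f ->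
  (forall x, `|f x| <= k) -> sqi mu f.
Proof.
move=> mf fk; apply: (sqi_le mf (sqi_cst k)) => x.
by rewrite (le_trans (fk x))// ler_norm.
Qed.

End finite_square_integrable.

(** * Conditional expectation *)

Section orthogonality.
Context {d d'} {T : measurableType d} {S : measurableType d'} {R : realType}.
Context (mu : {measure set T -> \bar R}) (ph : T -> S).
Hypothesis mph : measurable_fun setT ph.
Import HBNNSimple HBSimple.

Lemma orth_sfun (h : T -> R) (g : {sfun S >-> R}) : intg mu h ->
  (forall B, measurable B -> \int[mu]_(x in ph @^-1` B) h x = 0) ->
  intg mu (fun x => g (ph x) * h x) /\ \int[mu]_x (g (ph x) * h x) = 0.
Proof.
move=> hi h0.
pose F (r : R) x := r * (\1_(ph @^-1` (g @^-1` [set r])) x * h x).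
have mA r : measurable (ph @^-1` (g @^-1` [set r])).
  by rewrite -[X in measurable X]setTI; exact: mph.
have E1 r : (fun x => \1_(ph @^-1` (g @^-1` [set r])) x * h x) =
    h \_ (ph @^-1` (g @^-1` [set r])).
  by apply/funext => x; rewrite patchE indicE; case: ifP; rewrite ?mul1r ?mul0r.
have i1 r : intg mu (fun x => \1_(ph @^-1` (g @^-1` [set r])) x * h x).
  rewrite E1 -restrict_EFin; apply/integrable_restrict => //.
  by rewrite setTI; exact: integrableS hi.
have E x : g (ph x) * h x = \sum_(r <- finmap.enum_fset (fset_set (range g))) F r x.
  rewrite fimfunE fsbig_finite//= mulr_suml; apply: eq_bigr => r _.
  by rewrite /F mulrA.
have Fi r : intg mu (F r) by exact: intgZ.
split.
  by under [X in EFin \o X]eq_fun do rewrite E; exact: intg_sum.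
under eq_Rintegral do rewrite E.
rewrite Rintegral_sum// big1// => r _.
by rewrite RintegralZl// E1 -Rintegral_mkcond h0 ?mulr0.
Qed.

(** Dominated convergence along simple approximations of each part of [psi]. The dominating function
    is the absolute value of [psi h], so [psi] may be unbounded as long as the product is
    integrable. *)
Lemma orth_ext (h : T -> R) (psi : S -> R) : intg mu h ->
  (forall B, measurable B -> \int[mu]_(x in ph @^-1` B) h x = 0) ->
  measurable_fun setT psi -> intg mu (fun x => psi (ph x) * h x) ->
  \int[mu]_x (psi (ph x) * h x) = 0.
Proof.
move=> hi h0; have mh := intg_measurable hi.
wlog psi0 : psi / forall y, 0 <= psi y => [wl|] mpsi psih.
  have mpos : measurable_fun setT (psi ^\+)%R by exact: measurable_funrpos.
  have mneg : measurable_fun setT (psi ^\-)%R by exact: measurable_funrneg.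
  have ip : intg mu (fun x => psi^\+ (ph x) * h x).
    apply: intg_le (intg_abs psih) _ => [|x].
      by apply: measurable_funM => //; exact: measurableT_comp.
    rewrite !normrM ler_wpM2r// ger0_norm ?funrpos_ge0// /funrpos.
    by rewrite ge_max normr_ge0 ler_norm.
  have im : intg mu (fun x => psi^\- (ph x) * h x).
    apply: intg_le (intg_abs psih) _ => [|x].
      by apply: measurable_funM => //; exact: measurableT_comp.
    rewrite !normrM ler_wpM2r// ger0_norm ?funrneg_ge0// /funrneg.
    by rewrite ge_max normr_ge0 -normrN ler_norm.
  have E x : psi (ph x) * h x = psi^\+ (ph x) * h x - psi^\- (ph x) * h x.
    rewrite -mulrBl /funrpos /funrneg; congr (_ * _).
    by case: (lerP (psi (ph x)) 0); case: (lerP (- psi (ph x)) 0); lra.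
  under eq_Rintegral do rewrite E.
  by rewrite RintegralB// !wl ?subrr// => y; rewrite ?funrpos_ge0 ?funrneg_ge0.
have mE : measurable_fun setT (EFin \o psi) by exact/measurable_EFinP.
pose g n := nnsfun_approx measurableT mE n.
have gle n y : g n y <= psi y.
  by rewrite -lee_fin nnsfun_approxE; apply: (le_approx n) => // z _; rewrite lee_fin.
have gcv y : g n y @[n --> \oo] --> psi y.
  have : (EFin \o g^~ y) n @[n --> \oo] --> (psi y)%:E.
    by apply: (cvg_nnsfun_approx measurableT mE) => // z _; rewrite lee_fin.
  by move/fine_cvg.
have i0 n : (\int[mu]_x (g n (ph x) * h x)%:E = 0)%E.
  have [i1 I1] := orth_sfun (g n) hi h0.
  by rewrite -EFin_Rintegral// I1.
have [] := @dominated_convergence _ _ _ mu setT measurableT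
  (fun n x => (g n (ph x) * h x)%:E) (fun x => (psi (ph x) * h x)%:E)
  (fun x => `|psi (ph x) * h x|%:E).
- move=> n; apply/measurable_EFinP; apply: measurable_funM => //.
  exact: measurableT_comp.
- exact: measurable_int psih.
- apply: nearW => x _; apply: cvg_EFin; first exact: nearW.
  by apply: cvgM; [exact: gcv|exact: cvg_cst].
- exact: intg_abs.
- apply: nearW => x n _ /=; rewrite lee_fin !normrM ler_wpM2r// !ger0_norm//.
move=> _ _; rewrite (_ : [sequence _]_n = fun=> 0%E); last by apply/funext.
by move=> /(cvg_lim (@ereal_hausdorff _)); rewrite lim_cst// /Rintegral => <-.
Qed.

End orthogonality.

Lemma measurable_preimageT {d d'} {T : measurableType d} {S : measurableType d'}
  (f : T -> S) B : measurable_fun setT f -> measurable B -> measurable (f @^-1` B).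
Proof. by move=> mf mB; rewrite -[X in measurable X]setTI; exact: mf. Qed.

Section image_measure.
Context {d d'} {T : measurableType d} {S : measurableType d'} {R : realType}.
Variables (mu : {finite_measure set T -> \bar R}) (ph : {mfun T >-> S}).

Let mph : measurable_fun setT ph. Proof. exact: measurable_funPT. Qed.

Definition image_measure : set S -> \bar R := pushforward mu ph.

Let im0 : image_measure set0 = 0%E. Proof. exact: measure0. Qed.

Let im_ge0 A : (0 <= image_measure A)%E. Proof. exact: measure_ge0. Qed.

Let im_sigma_additive : semi_sigma_additive image_measure.
Proof. exact: measure_semi_sigma_additive. Qed.

HB.instance Definition _ := isMeasure.Build _ _ _ image_measure
  im0 im_ge0 im_sigma_additive.

Let im_fin : fin_num_fun image_measure.
Proof.
by move=> A mA; apply: fin_num_measure; exact: measurable_preimageT.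
Qed.

HB.instance Definition _ := Measure_isFinite.Build _ _ _ image_measure im_fin.

Variables (f : T -> \bar R) (fi : mu.-integrable setT f).

Definition image_charge : set S -> \bar R := pushforward (induced_charge fi) ph.

Let ic0 : image_charge set0 = 0%E.
Proof. by rewrite /image_charge /pushforward preimage_set0 charge0. Qed.

Let ic_fin A : measurable A -> image_charge A \is a fin_num.
Proof.
move=> mA; rewrite /image_charge /pushforward; apply: fin_num_measure.
exact: measurable_preimageT.
Qed.

Let ic_sigma_additive : semi_sigma_additive image_charge.
Proof.
move=> F mF tF mUF; rewrite /image_charge /pushforward preimage_bigcup.
apply: charge_semi_sigma_additive.
- by move=> n; exact: measurable_preimageT.
- apply/trivIsetP => /= i j _ _ ij; rewrite -preimage_setI.
  by move/trivIsetP : tF => /(_ _ _ _ _ ij) ->//; rewrite preimage_set0.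
- by rewrite -preimage_bigcup; exact: measurable_preimageT.
Qed.

HB.instance Definition _ := isCharge.Build _ _ _ image_charge
  ic0 ic_fin ic_sigma_additive.

Lemma image_charge_dominates : image_charge `<< image_measure.
Proof.
apply/null_content_dominatesP => A mA A0.
apply: null_set_integral => //; first exact: measurable_preimageT.
exact/measurable_funTS/measurable_int/fi.
Qed.

End image_measure.

Lemma patch_preimageE {T S : Type} {R : realType} (ph : T -> S) (B : set S) (f : T -> R) :
  f \_ (ph @^-1` B) = fun x => \1_B (ph x) * f x.
Proof.
apply/funext => x; rewrite patchE indicE (_ : (x \in _) = (ph x \in B))//.
by case: (_ \in B); rewrite ?mul1r ?mul0r.
Qed.

Section conditional_expectation.
Context {d d'} {T : measurableType d} {S : measurableType d'} {R : realType}.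
Context (mu : {finite_measure set T -> \bar R}) (ph : T -> S).
Hypothesis mph : measurable_fun setT ph.

(** Radon-Nikodym on the target space: the image of the charge with density [f] has a derivative
    with respect to the image of [mu]. The conditional expectation is obtained directly as a
    function of [ph], with no factorisation step. *)
Lemma cond_exp_intg (f : T -> R) : intg mu f ->
  exists ft : S -> R, [/\ measurable_fun setT ft,
    intg mu (fun x => ft (ph x)) &
    forall B, measurable B ->
      \int[mu]_(x in ph @^-1` B) f x = \int[mu]_(x in ph @^-1` B) ft (ph x)].
Proof.
move=> fi.
pose phM := HB.pack_for {mfun T >-> S} ph (isMeasurableFun.Build _ _ _ _ ph mph).
pose nu : {charge set S -> \bar R} := image_charge phM fi.
pose m : {finite_measure set S -> \bar R} := image_measure mu phM.
have dom : nu `<< m := @image_charge_dominates _ _ _ _ _ mu phM _ fi.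
pose g := Radon_Nikodym nu m.
have gfin y : g y \is a fin_num by exact: Radon_Nikodym_fin_num.
have gi : m.-integrable setT g by exact: Radon_Nikodym_integrable.
have gE B : measurable B -> nu B = (\int[m]_(y in B) g y)%E.
  exact: Radon_Nikodym_integral.
have mg : measurable_fun setT (fine \o g).
  by apply: measurableT_comp => //; exact: measurable_int gi.
have gK y : ((fine \o g) y)%:E = g y by rewrite /= fineK.
exists (fine \o g).
have mgph : measurable_fun setT ((fine \o g) \o ph) by exact: measurableT_comp.
have igph : intg mu (fun x => (fine \o g) (ph x)).
  apply/integrableP; split; first exact/measurable_EFinP.
  move/integrableP : (gi) => [_]; rewrite ge0_integral_pushforward//.
    by under eq_integral => x _ do rewrite /= -gK.
  by apply: measurableT_comp => //; exact: measurable_int gi.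
split => // B mB.
rewrite /Rintegral.
rewrite [RHS](_ : _ = fine (\int[m]_(y in B) g y)%E).
  by rewrite -gE.
rewrite integral_pushforward//.
- by congr fine; apply: eq_integral => x _; rewrite /= fineK.
- exact: measurable_int gi.
- apply: (@integrableS _ _ _ _ setT) => //; first exact: measurable_preimageT.
  by apply: eq_integrable igph => // x _; exact: gK.
Qed.

Lemma orth_cond_exp (f : T -> R) (ft psi : S -> R) : intg mu f ->
  measurable_fun setT ft -> intg mu (fun x => ft (ph x)) ->
  (forall B, measurable B ->
      \int[mu]_(x in ph @^-1` B) f x = \int[mu]_(x in ph @^-1` B) ft (ph x)) ->
  measurable_fun setT psi -> intg mu (fun x => psi (ph x) * (f x - ft (ph x))) ->
  \int[mu]_x (psi (ph x) * (f x - ft (ph x))) = 0.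
Proof.
move=> fi mft fti ftE mpsi psii.
apply: (@orth_ext _ _ _ _ _ mu ph mph (fun x => f x - ft (ph x))) => //.
  exact: intgB.
move=> B mB; rewrite RintegralB ?ftE ?subrr//.
- exact: measurable_preimageT.
- by apply: integrableS fi => //; exact: measurable_preimageT.
- by apply: integrableS fti => //; exact: measurable_preimageT.
Qed.

(** Square integrability of [ft] comes from testing against its truncations: E(chi^2) = E(chi f),
    and expanding E((f - chi)^2) >= 0 then bounds E(chi^2) by E(f^2), uniformly in the truncation
    level. *)
Lemma cond_exp_sqi (f : T -> R) : sqi mu f ->
  exists ft : S -> R, [/\ measurable_fun setT ft, sqi mu (fun x => ft (ph x)) &
    forall psi : S -> R, measurable_fun setT psi ->
      intg mu (fun x => psi (ph x) * (f x - ft (ph x))) ->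
      \int[mu]_x (psi (ph x) * (f x - ft (ph x))) = 0].
Proof.
move=> f2; have fi := sqi_intg f2; have [mf _] := f2.
have [ft [mft fti ftE]] := cond_exp_intg fi.
exists ft; split => // [|psi mpsi psii]; last exact: orth_cond_exp ftE mpsi psii.
have mftph : measurable_fun setT (fun x => ft (ph x)) by exact: measurableT_comp.
pose A (n : nat) := [set y | `|ft y| <= n%:R].
have mA n : measurable (A n).
  rewrite -[X in measurable X]setTI; apply: measurable_fun_le => //.
  exact: measurableT_comp.
pose chi n y := ft y * \1_(A n) y.
have mchi n : measurable_fun setT (chi n).
  by apply: measurable_funM => //; exact: measurable_indic.
have mchiph n : measurable_fun setT (fun x => chi n (ph x)) by exact: measurableT_comp.
have chib n y : `|chi n y| <= n%:R.
  rewrite /chi indicE; case: (boolP (y \in A n)) => [/set_mem|_].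
    by rewrite mulr1.
  by rewrite mulr0 normr0.
have chi2 n : sqi mu (fun x => chi n (ph x)) by exact: (sqi_bounded mu (mchiph n) (fun x => chib n (ph x))).
have chiE n : \int[mu]_x (chi n (ph x) ^+ 2) <= \int[mu]_x (f x ^+ 2).
  have : \int[mu]_x (chi n (ph x) * (f x - ft (ph x))) = 0.
    apply: orth_cond_exp ftE (mchi n) _ => //.
    apply: intg_le (intgZ n%:R (intg_abs (intgB fi fti))) _.
      by apply: measurable_funM => //; exact: measurable_funB.
    by move=> x; rewrite normrM ler_wpM2r.
  under eq_Rintegral => x _.
    rewrite mulrBr (_ : chi n (ph x) * ft (ph x) = chi n (ph x) ^+ 2); last first.
      by rewrite /chi indicE; case: (_ \in _); rewrite /= ?mulr1 ?mulr0 ?mul0r// expr0n.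
    over.
  rewrite RintegralB//; [|exact: sqiM|exact: sqi_sq].
  have : 0 <= \int[mu]_x ((f x - chi n (ph x)) ^+ 2) by exact: Rintegral_sq_ge0.
  under eq_Rintegral do rewrite sqrrB -mulr_natl [f _ * _]mulrC.
  rewrite RintegralD//; [|apply: intgB; [exact: sqi_sq|apply: intgZ; exact: sqiM]|exact: sqi_sq].
  rewrite RintegralB//; [|exact: sqi_sq|apply: intgZ; exact: sqiM].
  by rewrite RintegralZl//; [lra|exact: sqiM].
split => //; apply: (@le_lt_trans _ _ (\int[mu]_x (f x ^+ 2))%:E); last by rewrite ltry.
have := @cvg_monotone_convergence _ _ _ mu setT measurableT
  (fun n x => (chi n (ph x) ^+ 2)%:E).
have lime x : (fun n => (chi n (ph x) ^+ 2)%:E) @ \oo --> (ft (ph x) ^+ 2)%:E.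
  apply: cvg_near_cst.
  have [N] : exists N : nat, `|ft (ph x)| <= N%:R.
    by exists (Num.bound `|ft (ph x)|); apply/ltW/archi_boundP.
  move=> hN; exists N => // k /= Nk; rewrite /chi indicE mem_set ?mulr1//.
  by rewrite /A /= (le_trans hN)// ler_nat.
move=> /(_ _ _ _)/wrap[].
- by move=> n; apply/measurable_EFinP; exact: measurable_funX.
- by move=> n x _; rewrite lee_fin sqr_ge0.
- move=> x _ a b ab; rewrite lee_fin /chi !indicE.
  case: (boolP (_ \in A a)) => [/set_mem ha|_]; last first.
    by rewrite mulr0 expr0n/= sqr_ge0.
  by rewrite mem_set// /A /= (le_trans ha)// ler_nat.
move=> h.
have -> : (\int[mu]_x (ft (ph x) ^+ 2)%:E =
    \int[mu]_x limn (fun n => (chi n (ph x) ^+ 2)%:E))%E.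
  by apply: eq_integral => x _; apply/esym/cvg_lim.
rewrite -(cvg_lim _ h)//; apply: lime_le; first by apply/cvg_ex; eexists; exact: h.
by apply: nearW => n; rewrite -EFin_Rintegral ?lee_fin//; exact: sqi_sq.
Qed.

(** The bound holds everywhere and not just almost everywhere, so that this version can multiply
    square-integrable functions through [sqi_bnd] with no exceptional set. It is the clamp to
    [-k, k] of the version from [cond_exp_sqi]. *)
Lemma cond_exp_bounded (f : T -> R) (k : R) : measurable_fun setT f ->
  (forall x, `|f x| <= k) ->
  exists ft : S -> R, [/\ measurable_fun setT ft, forall y, `|ft y| <= k &
    forall psi : S -> R, measurable_fun setT psi ->
      intg mu (fun x => psi (ph x) * (f x - ft (ph x))) ->
      \int[mu]_x (psi (ph x) * (f x - ft (ph x))) = 0].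
Proof.
move=> mf fk; have k0 : 0 <= k by apply: le_trans (fk point).
have f2 : sqi mu f := sqi_bounded mu mf fk.
have [ft [mft ft2 ftE]] := cond_exp_sqi f2.
pose c y := Num.max (- k) (Num.min k (ft y)).
have mc : measurable_fun setT c.
  by apply: measurable_maxr => //; exact: measurable_minr.
have ck y : `|c y| <= k.
  by rewrite ler_norml /c le_max lexx/= ge_max ge_min lexx andbT (le_trans _ k0)// oppr_le0.
have mcph : measurable_fun setT (fun x => c (ph x)) by exact: measurableT_comp.
have c2 : sqi mu (fun x => c (ph x)) by exact: (sqi_bounded mu mcph (fun x => ck (ph x))).
have d2 : sqi mu (fun x => ft (ph x) - c (ph x)) by exact: sqiB.
(* Pointwise (ft - c)^2 <= (ft - c)(ft - f), because [c] is the point of [-k, k] nearest to [ft] and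
   [f] lies in that interval; the right-hand side integrates to 0. *)
have E0 : \int[mu]_x ((ft (ph x) - c (ph x)) ^+ 2) = 0.
  apply/eqP; rewrite eq_le Rintegral_sq_ge0 andbT.
  have h := ftE (fun y => ft y - c y) (measurable_funB mft mc) (sqiM d2 (sqiB f2 ft2)).
  rewrite -oppr0 -h -mulN1r -RintegralZl//; last exact: sqiM d2 (sqiB f2 ft2).
  apply: le_Rintegral => //; first exact: sqi_sq.
    by apply: intgZ; exact: sqiM d2 (sqiB f2 ft2).
  move=> x _; have := fk x; rewrite ler_norml => /andP[f1 f3].
  rewrite /c; case: (leP k (ft (ph x))) => h1.
    by rewrite (max_idPr _) ?(le_trans _ k0) ?oppr_le0//; nra.
  case: (leP (- k) (ft (ph x))) => h2; first by nra.
  by nra.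
have ae : {ae mu, forall x, ft (ph x) = c (ph x)}.
  have := Rintegral_cvg0_ge0 (sqi_sq d2) (fun x => sqr_ge0 _) E0.
  by apply: filterS => x /eqP; rewrite sqrf_eq0 subr_eq0 => /eqP.
exists c; split => // psi mpsi psii.
apply: (@orth_cond_exp f c psi) => //; first exact: sqi_intg.
  exact: sqi_intg.
move=> B mB; apply/eqP; rewrite -subr_eq0 -RintegralB; last 3 first.
- exact: measurable_preimageT.
- by apply: integrableS (sqi_intg f2) => //; exact: measurable_preimageT.
- by apply: integrableS (sqi_intg c2) => //; exact: measurable_preimageT.
rewrite Rintegral_mkcond patch_preimageE.
have mB1 : measurable_fun setT (\1_B : S -> R) by exact: measurable_indic.
have mB1ph : measurable_fun setT (fun x => \1_B (ph x) : R) by exact: measurableT_comp.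
have b1 y : `|\1_B y : R| <= 1 by rewrite indicE normr_nat lern1 leq_b1.
have i1 : sqi mu (fun x => \1_B (ph x) : R) by exact: (sqi_bounded mu mB1ph (fun x => b1 (ph x))).
apply/eqP; rewrite -(ftE (\1_B) mB1 (sqiM i1 (sqiB f2 ft2))).
apply: ae_eq_Rintegral.
- by apply: measurable_funM => //; exact: measurable_funB.
- by apply: measurable_funM => //; apply: measurable_funB => //; exact: measurableT_comp.
- by apply: filterS ae => x ->.
Qed.

End conditional_expectation.

Section dynkin_integral.
Context {d} {T : measurableType d} {R : realType}.
Context (mu : {measure set T -> \bar R}) (G : set (set T)).

(** Sets over which [h] integrates to 0 form a Dynkin system, complements being covered by the
    vanishing total integral. *)
Lemma dynkin_Rintegral0 (h : T -> R) : intg mu h -> G `<=` measurable ->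
  setI_closed G -> \int[mu]_x h x = 0 ->
  (forall A, G A -> \int[mu]_(x in A) h x = 0) ->
  forall A, <<s G >> A -> \int[mu]_(x in A) h x = 0.
Proof.
move=> hi Gm GI h0 GE A sA.
pose D := [set B | measurable B /\ \int[mu]_(x in B) h x = 0].
suff : <<s G >> `<=` D by move=> /(_ _ sA)[].
apply: lambda_system_subset => //; last first.
  by move=> B GB; split; [exact: Gm|exact: GE].
apply/dynkin_lambda_system; split.
- by split.
- move=> B [mB B0]; split; first exact: measurableC.
  have := h0; rewrite -(setUv B) Rintegral_setU//; last 3 first.
  + exact: measurableC.
  + by rewrite setUv.
  + by apply/disj_set2P; rewrite setICr.
  by rewrite B0 add0r.
- move=> F tF FD; have mF n : measurable (F n) by have [] := FD n.
  have mU : measurable (\bigcup_k F k) by exact: bigcup_measurable.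
  split => //; rewrite /Rintegral integral_bigcup//; last first.
    by apply: integrableS hi.
  rewrite eseries0// => k _ _; have [_ Fk] := FD k.
  have := Fk; rewrite /Rintegral => /eqP; rewrite fine_eq0; first by move/eqP.
  by apply: integrable_fin_num => //; exact: integrableS hi.
Qed.

End dynkin_integral.

(** * Measurability of matrix-valued maps *)

Lemma measurable_set_lt {R : realType} {d} {T : measurableType d} (f g : T -> R) :
  measurable_fun setT f -> measurable_fun setT g -> measurable [set x | f x < g x].
Proof.
move=> mf mg; rewrite (_ : [set x | _] = ~` [set x | g x <= f x]).
  by apply: measurableC; rewrite -[X in measurable X]setTI; exact: measurable_fun_le.
by apply/seteqP; split=> x /=; rewrite ltNge => /negP.
Qed.

Section borel_matrices.
Context {R : realType} {m n : nat}.
Implicit Types (M : 'M[R]_(m, n)) (U : set 'M[R]_(m, n)).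

Let box (p : 'M[rat]_(m, n) * nat) : set 'M[R]_(m, n) :=
  [set M | forall i j, `|M i j - ratr (p.1 i j)| < p.2.+1%:R^-1].

(** Rational centres and radii 1/(k+1) make the union countable. The Borel sets of matrices are
    generated by the open sets, and this decomposition reduces measurability to the entries. *)
Lemma open_mx_boxes U : open U ->
  U = \bigcup_(p : 'M[rat]_(m, n) * nat) (if pselect (box p `<=` U) then box p else set0).
Proof.
move=> oU; apply/seteqP; split=> M; last first.
  by move=> [p _]; case: pselect => // h; exact: h.
move=> UM; have /nbhs_ballP[e /= e0 eU] : nbhs M U by exact: open_nbhs_nbhs.
have [k hk] : exists k : nat, k.+1%:R^-1 < e / 2.
  have e20 : 0 < e / 2 by rewrite divr_gt0.
  exists (Num.bound (e / 2)^-1); rewrite invf_plt ?posrE//.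
  by rewrite (lt_trans (archi_boundP _)) ?invr_ge0 ?(ltW e20)// ltr_nat.
have /choice[q hq] : forall ij : 'I_m * 'I_n, exists r : rat,
    `|M ij.1 ij.2 - ratr r| < k.+1%:R^-1.
  move=> [i j] /=; have : M i j - k.+1%:R^-1 < M i j + k.+1%:R^-1.
    by rewrite ltrBlDr -addrA ltrDl addr_gt0.
  by move=> /rat_in_itvoo[r]; rewrite in_itv/= => ?; exists r; rewrite distrC ltr_distl.
exists (\matrix_(i, j) q (i, j), k) => //.
have bM : box (\matrix_(i, j) q (i, j), k) M.
  by move=> i j /=; rewrite mxE; exact: (hq (i, j)).
case: pselect => // -[] N bN; apply: eU; split=> // i j.
rewrite -ball_normE /ball_ /=.
rewrite (le_lt_trans (ler_distD (ratr (q (i, j))) _ _))// (splitr e).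
rewrite ltrD// (lt_trans _ hk) ?(hq (i, j))// distrC.
by have := bN i j; rewrite /= mxE.
Qed.

Context {d} {T : measurableType d}.

Lemma measurable_preimage_mx (f : T -> 'M[R]_(m, n)) (B : set 'M[R]_(m, n)) :
  (forall i j, measurable_fun setT (fun t => f t i j)) -> <<s open >> B ->
  measurable (f @^-1` B).
Proof.
move=> mf; move: B.
apply: smallest_sub => [|U oU].
  split=> /= [|A mA|A mA].
  - by rewrite preimage_set0; exact: measurable0.
  - by rewrite setTD preimage_setC; exact: measurableC.
  - by rewrite preimage_bigcup; exact: bigcup_measurable.
rewrite /= (open_mx_boxes oU) preimage_bigcup.
apply: countable_bigcupT_measurable; first exact: countableP.
move=> p; case: (pselect (box p `<=` U)) => _ /=; last first.
  by rewrite preimage_set0; exact: measurable0.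
rewrite (_ : _ @^-1` _ = \bigcap_(i in [set: 'I_m]) \bigcap_(j in [set: 'I_n])
   [set t | `|f t i j - ratr (p.1 i j)| < p.2.+1%:R^-1]).
  apply: fin_bigcap_measurable => // i _; apply: fin_bigcap_measurable => // j _.
  apply: measurable_set_lt => //.
  by apply: measurableT_comp => //; apply: measurable_funB.
apply/seteqP; split=> [t h i _ j _|t h i j]; first exact: h.
exact: (h i I j I).
Qed.

Lemma measurable_cont_mx (h : 'M[R]_(m, n) -> R) (f : T -> 'M[R]_(m, n)) :
  continuous h -> (forall i j, measurable_fun setT (fun t => f t i j)) ->
  measurable_fun setT (fun t => h (f t)).
Proof.
move=> ch mf; apply: (measurability _ (@RGenOInfty.measurableE R)).
move=> _ [_ [x ->] <-]; rewrite setTI.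
rewrite (_ : _ @^-1` _ = f @^-1` (h @^-1` `]x, +oo[%classic))//.
apply: measurable_preimage_mx => //; apply: sub_gen_smallest.
by apply: open_comp => [w _|]; [exact: ch|exact: rray_open].
Qed.

End borel_matrices.

Lemma continuous_row {R : realType} {m n : nat} i :
  continuous (@row R m n i).
Proof.
move=> /= M s /= /(nbhs_ballP (row i M)) [e e0 es].
apply/nbhs_ballP; exists e => //= N [_ MN]; apply: es; split=> // k j; rewrite !mxE; exact: MN.
Qed.

(** The pair is stored as the two rows of a matrix, which brings it back to [measurable_cont_mx]. *)
Lemma measurable_cont_pair {R : realType} {n : nat} {d} {T : measurableType d}
    (h : 'rV[R]_n * 'rV[R]_n -> R) (f g : T -> 'rV[R]_n) : continuous h ->
  (forall j, measurable_fun setT (fun t => f t 0 j)) ->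
  (forall j, measurable_fun setT (fun t => g t 0 j)) ->
  measurable_fun setT (fun t => h (f t, g t)).
Proof.
move=> ch mf mg.
pose M t : 'M[R]_(2, n) := \matrix_(i, j) (if i == 0 then f t 0 j else g t 0 j).
pose k (A : 'M[R]_(2, n)) := h (row 0 A, row 1 A).
rewrite (_ : (fun t => _) = fun t => k (M t)).
  apply: measurable_cont_mx => [|i j].
    move=> A; apply: (@continuous_comp _ _ _ (fun A => (row 0 A, row 1 A)) h); last exact: ch.
    exact: (cvg_pair (@continuous_row _ _ _ 0 A) (@continuous_row _ _ _ 1 A)).
  under eq_fun do rewrite mxE.
  by case: (i == 0); [exact: mf|exact: mg].
by apply/funext => t; rewrite /k; congr (h (_, _)); apply/rowP => j; rewrite !mxE.
Qed.

Section measurable_wrt_lemmas.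
Context {R : realType} {dd} {Omega : measurableType dd} (G : set (set Omega)).
Hypothesis sG : sigma_algebra setT G.
Local Notation gO := (g_sigma_algebraType G).

Lemma measurable_gE (A : set gO) : measurable A = G A.
Proof. by rewrite measurable_g_measurableTypeE. Qed.

Lemma measurable_wrtE {V : topologicalType} (f : Omega -> V) :
  measurable_wrt G f <-> forall B, <<s open >> B -> G (f @^-1` B).
Proof.
split=> [h B sB|h _ [B sB <-]]; last by rewrite setTI; exact: h.
by apply: h; exists B => //; rewrite setTI.
Qed.

Lemma measurable_wrt_cont {V : topologicalType} (f : Omega -> V) (h : V -> R) :
  continuous h -> measurable_wrt G f ->
  measurable_fun setT (fun w : gO => h (f w)).
Proof.
move=> ch /measurable_wrtE fG; apply: (measurability _ (@RGenOInfty.measurableE R)).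
move=> _ [_ [x ->] <-]; rewrite setTI measurable_gE.
apply: (fG (h @^-1` `]x, +oo[%classic)); apply: sub_gen_smallest.
by apply: open_comp => [w _|]; [exact: ch|exact: rray_open].
Qed.

Lemma measurable_wrt_mxP {m n} (f : Omega -> 'M[R]_(m, n)) :
  measurable_wrt G f <-> forall i j, measurable_fun setT (fun w : gO => f w i j).
Proof.
split=> [fG i j|h].
  by apply: (measurable_wrt_cont (h := fun M : 'M[R]_(m, n) => M i j)) => //; exact: coord_continuous.
apply/measurable_wrtE => B sB; rewrite -measurable_gE.
exact: (@measurable_preimage_mx R m n _ gO f B).
Qed.

Lemma measurable_wrt_sub (f : gO -> R) : G `<=` measurable ->
  measurable_fun setT f -> measurable_fun setT (f : Omega -> R).
Proof.
move=> Gm mf _ B mB; apply: Gm; rewrite -measurable_gE.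
exact: mf.
Qed.

End measurable_wrt_lemmas.

(** * Processes on a bounded time interval *)

Section clip.
Context {R : realType} (T : R).
(** Retraction of the line onto [0, T]. Composed with it, a process becomes measurable on all of R
    while keeping its values on [0, T]. *)
Definition clip (t : R) : R := Num.max 0 (Num.min t T).

Lemma measurable_clip : measurable_fun setT clip.
Proof. by apply: measurable_maxr => //; exact: measurable_minr. Qed.

Lemma continuous_clip : continuous clip.
Proof.
move=> t; apply: (@continuous_max _ _ (cst 0) (fun t => Num.min t T)).
  exact: cvg_cst.
by apply: (@continuous_min _ _ id (cst T)); [exact: cvg_id|exact: cvg_cst].
Qed.

Hypothesis T0 : 0 <= T.

Lemma clip_itv t : clip t \in `[0, T].
Proof. by rewrite in_itv/= le_max lexx/= ge_max T0/= ge_min lexx orbT. Qed.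

Lemma clipE t : t \in `[0, T] -> clip t = t.
Proof. by rewrite in_itv/= => /andP[t0 tT]; rewrite /clip (min_idPl tT) (max_idPr t0). Qed.
End clip.

Section joint_measurability.
Context {R : realType} {dd} {Omega : measurableType dd} (T : R).
Hypothesis T0 : 0 <= T.

Lemma jointly_measurable_clip {m n} (G : set (set Omega)) (X : R -> Omega -> 'M[R]_(m, n)) :
  sigma_algebra setT G -> jointly_measurable G T X ->
  forall i j, measurable_fun setT
    (fun p : R * g_sigma_algebraType G => X (clip T p.1) p.2 i j).
Proof.
move=> sG jm i j; apply: (measurability _ (@RGenOInfty.measurableE R)).
move=> _ [_ [x ->] <-]; rewrite setTI.
pose B : set 'M[R]_(m, n) := (fun M => M i j) @^-1` `]x, +oo[%classic.
have sB : <<s open >> B.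
  apply: sub_gen_smallest; apply: open_comp => [w _|]; last exact: rray_open.
  exact: coord_continuous.
have := jm B sB; set S := (X in <<s _ >> X) => mS.
pose c (p : R * g_sigma_algebraType G) := (clip T p.1, p.2).
have mc : measurable_fun setT c.
  apply/measurable_fun_pairP; split; last exact: measurable_snd.
  exact: (measurableT_comp (measurable_clip T) measurable_fst).
rewrite (_ : _ @^-1` _ = c @^-1` S); last first.
  apply/seteqP; split=> p /= h; last by case: h => _.
  by split=> //; split=> //; exact: clip_itv.
apply: measurable_preimageT => //.
rewrite measurable_prod_measurableType.
apply: sub_sigma_algebra2 mS => _ [A mA [C GC <-]].
by exists A => //; exists C => //; rewrite measurable_gE.
Qed.

Lemma clip_jointly_measurable {m n} (X : R -> Omega -> 'M[R]_(m, n)) :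
  (forall i j, measurable_fun setT (fun p : R * Omega => X (clip T p.1) p.2 i j)) ->
  jointly_measurable measurable T X.
Proof.
move=> mX B sB; rewrite -measurable_prod_measurableType.
rewrite (_ : _ `&` _ = (`[0, T]%classic `*` setT) `&`
    (fun p => X (clip T p.1) p.2) @^-1` B).
  apply: measurableI; first exact: measurableX.
  exact: measurable_preimage_mx.
apply/seteqP; split=> -[t w] /= [[tT _] h]; split=> //.
  by rewrite /preimage/= clipE.
by move: h; rewrite /preimage/= clipE.
Qed.

Lemma measurable_countable_select {d} {S : measurableType d} {I : countType}
    (g : S -> I) (F : I -> S -> R) :
  (forall i, measurable (g @^-1` [set i])) -> (forall i, measurable_fun setT (F i)) ->
  measurable_fun setT (fun x => F (g x) x).
Proof.
move=> mg mF _ B mB; rewrite setTI.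
rewrite (_ : _ @^-1` _ = \bigcup_(i : I) (g @^-1` [set i] `&` F i @^-1` B)).
  apply: countable_bigcupT_measurable; first exact: countableP.
  by move=> i; apply: measurableI => //; exact: measurable_preimageT.
by apply/seteqP; split=> x /= => [h|[i _ [<-]]//]; exists (g x).
Qed.

(** Limit of the processes frozen on a grid of mesh 1/(k+1): each of these uses countably many times
    only, hence is jointly measurable. *)
Lemma measurable_continuous_process {d} {S : measurableType d} (X : R -> S -> R) :
  (forall t, measurable_fun setT (X t)) -> (forall w, continuous (X^~ w)) ->
  measurable_fun setT (fun p : R * S => X p.1 p.2).
Proof.
move=> mX cX.
pose g (k : nat) (t : R) : R := (Num.floor (t * k.+1%:R))%:~R / k.+1%:R.
apply: (@measurable_fun_cvg _ _ _ setT (fun k p => X (g k p.1) p.2)) => //.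
  move=> k.
  apply: (@measurable_countable_select _ (R * S)%type int
    (fun p => Num.floor (p.1 * k.+1%:R)) (fun z p => X (z%:~R / k.+1%:R) p.2)).
    move=> z; rewrite (_ : _ @^-1` _ = [set p | z%:~R <= p.1 * k.+1%:R] `&`
        [set p | p.1 * k.+1%:R < (z + 1)%:~R]).
      apply: measurableI; last by apply: measurable_set_lt => //; exact: measurable_funM.
      rewrite -[X in measurable X]setTI.
      by apply: measurable_fun_le => //; exact: measurable_funM.
    apply/seteqP; split=> -[t w] /=.
      by move=> <-; split; [exact: floor_le_tmp|exact: floorD1_gt].
    by move=> [h1 h2]; apply/eqP; rewrite floor_eq h1 h2.
  by move=> z; apply: measurableT_comp => //; exact: mX.
move=> [t w] _ /=; apply: (@cvg_comp _ _ _ (fun k => g k t) (X^~ w) _ (nbhs t)); last exact: cX.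
apply/cvgrPdist_le => e e0; near=> k.
have k0 : 0 < k.+1%:R :> R by [].
have h1 := floor_le_tmp (t * k.+1%:R); have h2 := floorD1_gt (t * k.+1%:R).
have gt : g k t <= t by rewrite /g ler_pdivrMr.
rewrite ger0_norm ?subr_ge0//.
have : t <= g k t + k.+1%:R^-1.
  rewrite /g -[X in _ <= _ + X]mul1r -mulrDl ler_pdivlMr// (le_trans (ltW h2))//.
  by rewrite intrD.
have : k.+1%:R^-1 <= e by apply: ltW; near: k; exact: (near_infty_natSinv_lt (PosNum e0)).
by move=> ke tg; rewrite lerBlDl (le_trans tg)// lerD2l.
Unshelve. all: by end_near. Qed.

End joint_measurability.

(** * Independence *)

Section independence_lemmas.
Context {R : realType} {dd} {Omega : measurableType dd} (P : probability Omega R).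
Implicit Types (A B C G F : set (set Omega)).

Lemma fin_num_prob a : measurable a -> P a \is a fin_num.
Proof. exact: fin_num_measure. Qed.

Lemma intg_indic (a : set Omega) : measurable a -> intg P (\1_a : Omega -> R).
Proof. by move=> ma; apply: integrable_indic; rewrite // ltey_eq fin_num_prob. Qed.

Lemma Rintegral_indic_sub (a b : set Omega) : measurable a -> measurable b ->
  \int[P]_(x in b) (\1_a x - fine (P a)) = fine (P (a `&` b)) - fine (P a) * fine (P b).
Proof.
move=> ma mb; rewrite RintegralB//; last 2 first.
- by apply: integrableS (intg_indic ma).
- exact: finite_measure_integrable_cst.
congr (_ - _); first by rewrite /Rintegral integral_indic.
by rewrite Rintegral_cst.
Qed.

(** Written as a vanishing integral over [b], independence becomes a property to which
    [dynkin_Rintegral0] applies. *)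
Lemma indep_RintegralE (a b : set Omega) : measurable a -> measurable b ->
  P (a `&` b) = (P a * P b)%E <-> \int[P]_(x in b) (\1_a x - fine (P a)) = 0.
Proof.
move=> ma mb; rewrite Rintegral_indic_sub//; split=> [->|/eqP].
  by rewrite fineM ?fin_num_prob// subrr.
rewrite subr_eq0 => /eqP e; rewrite -[LHS]fineK ?fin_num_prob//; last exact: measurableI.
by rewrite e EFinM !fineK ?fin_num_prob.
Qed.

Lemma independent2_sym A B : independent2 P A B -> independent2 P B A.
Proof. by move=> h b a Bb Aa; rewrite setIC muleC h. Qed.

Lemma independent2_gen A B : A `<=` measurable -> B `<=` measurable ->
  setI_closed B -> independent2 P A B -> independent2 P A <<s B >>.
Proof.
move=> Am Bm BI AB a b Aa sb; have ma := Am _ Aa.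
have mb : measurable b.
  by apply: smallest_sub sb => //; exact: sigma_algebra_measurable.
apply/indep_RintegralE => //; apply: (dynkin_Rintegral0 _ Bm BI) sb.
- by apply: intgB; [exact: intg_indic|exact: intg_cst].
- by rewrite Rintegral_indic_sub// setIT probability_setT mulr1 subrr.
- by move=> c Bc; apply/indep_RintegralE => //; [exact: Bm|exact: AB].
Qed.

Lemma independent2_sub A A' B B' : A' `<=` A -> B' `<=` B ->
  independent2 P A B -> independent2 P A' B'.
Proof. by move=> sA sB h a b /sA Aa /sB Bb; exact: h. Qed.

Lemma measurable_id_sub G : G `<=` measurable -> sigma_algebra setT G ->
  measurable_fun setT (id : Omega -> g_sigma_algebraType G).
Proof. by move=> Gm sG _ B mB; rewrite setTI; apply: Gm; rewrite -measurable_gE. Qed.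

Lemma measurable_fun_sub G (f : Omega -> R) : G `<=` measurable -> sigma_algebra setT G ->
  measurable_fun setT (f : g_sigma_algebraType G -> R) -> measurable_fun setT f.
Proof. by move=> Gm sG mf; exact: measurable_wrt_sub mf. Qed.

Lemma measurable_fun_subG G F (f : Omega -> R) : sigma_algebra setT G ->
  sigma_algebra setT F -> G `<=` F ->
  measurable_fun setT (f : g_sigma_algebraType G -> R) ->
  measurable_fun setT (f : g_sigma_algebraType F -> R).
Proof.
move=> sG sF GF mf _ B mB; rewrite measurable_gE//; apply: GF; rewrite -measurable_gE//.
exact: mf.
Qed.

Lemma measurable_indicG G (a : set Omega) : sigma_algebra setT G -> G a ->
  measurable_fun setT (\1_a : g_sigma_algebraType G -> R).
Proof. by move=> sG Ga; apply: measurable_indic; rewrite measurable_gE. Qed.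

Section indep_mean.
Variables F G : set (set Omega).
Hypotheses (sF : sigma_algebra setT F) (sG : sigma_algebra setT G).
Hypotheses (Fm : F `<=` measurable) (Gm : G `<=` measurable).

Lemma orth_gen (h psi : Omega -> R) : intg P h ->
  (forall B : set Omega, F B -> \int[P]_(x in B) h x = 0) ->
  measurable_fun setT (psi : g_sigma_algebraType F -> R) ->
  intg P (fun x => psi x * h x) -> \int[P]_x (psi x * h x) = 0.
Proof.
move=> hi h0 mpsi psii.
apply: (@orth_ext _ _ _ (g_sigma_algebraType F) _ P id (measurable_id_sub Fm sF) h psi) => //.
by move=> B; rewrite measurable_gE//; exact: h0.
Qed.

Lemma Rintegral_in_indic (h : Omega -> R) (B : set Omega) :
  \int[P]_(x in B) h x = \int[P]_x (\1_B x * h x).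
Proof.
rewrite Rintegral_mkcond; apply: eq_Rintegral => x _; rewrite patchE indicE.
by case: (_ \in B); rewrite ?mul1r ?mul0r.
Qed.

Lemma intgM_bounded (h psi : Omega -> R) k : measurable_fun setT psi ->
  (forall x, `|psi x| <= k) -> intg P h -> intg P (fun x => psi x * h x).
Proof.
move=> mpsi bpsi hi; apply: (intg_le _ (intgZ k (intg_abs hi))).
  by apply: measurable_funM => //; exact: intg_measurable hi.
by move=> x; rewrite normrM ler_wpM2r.
Qed.

Lemma indic_le1 (B : set Omega) x : `|\1_B x : R| <= 1.
Proof. by rewrite indicE normr_nat lern1 leq_b1. Qed.

Lemma intg_indicM (h : Omega -> R) (B : set Omega) : measurable B -> intg P h ->
  intg P (fun x => \1_B x * h x).
Proof.
by move=> mB hi; apply: (intgM_bounded _ (indic_le1 B) hi); exact: measurable_indic.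
Qed.

Hypothesis FG : independent2 P F G.

(** Two extensions in turn: from sets of [G] to [D], against a centred indicator of a set of [F],
    and then from sets of [F] to [phi]. *)
Lemma indep_mean0 (phi D : Omega -> R) :
  measurable_fun setT (phi : g_sigma_algebraType F -> R) ->
  measurable_fun setT (D : g_sigma_algebraType G -> R) ->
  intg P D -> \int[P]_x D x = 0 -> intg P (fun x => phi x * D x) ->
  \int[P]_x (phi x * D x) = 0.
Proof.
move=> mphi mD Di D0 phiD; apply: orth_gen => // B FB; have mB := Fm FB.
rewrite Rintegral_in_indic.
have i1 : intg P (fun x => \1_B x - fine (P B)).
  by apply: intgB; [exact: intg_indic|exact: intg_cst].
have i2 : intg P (fun x => D x * (\1_B x - fine (P B))).
  have := intgB (intg_indicM mB Di) (intgZ (fine (P B)) Di).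
  by apply: eq_integrable => // x _ /=; rewrite mulrBr [D x * _]mulrC [D x * _]mulrC.
have : \int[P]_x (D x * (\1_B x - fine (P B))) = 0.
  apply: (@orth_ext _ _ _ (g_sigma_algebraType G) _ P id (measurable_id_sub Gm sG)
    (fun x => \1_B x - fine (P B)) D) => // E.
  rewrite measurable_gE// => GE; apply/indep_RintegralE => //; first exact: Gm.
  exact: FG.
under eq_Rintegral do rewrite mulrBr [D _ * _]mulrC [D _ * fine _]mulrC.
rewrite RintegralB//; [|exact: intg_indicM|exact: intgZ].
by rewrite RintegralZl// D0 mulr0 subr0.
Qed.

End indep_mean.

Definition setI_system A B : set (set Omega) := [set a `&` b | a in A & b in B].

Lemma setI_system_closed A B : setI_closed A -> setI_closed B ->
  setI_closed (setI_system A B).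
Proof.
move=> AI BI _ _ [a Aa [b Bb <-]] [a' Aa' [b' Bb' <-]].
by exists (a `&` a'); [exact: AI|exists (b `&` b'); [exact: BI|rewrite setIACA]].
Qed.

Lemma sub_setI_systeml A B : B setT -> A `<=` setI_system A B.
Proof. by move=> BT a Aa; exists a => //; exists setT => //; rewrite setIT. Qed.

Lemma sub_setI_systemr A B : A setT -> B `<=` setI_system A B.
Proof. by move=> AT b Bb; exists setT => //; exists b => //; rewrite setTI. Qed.

Lemma setI_system_measurable A B : A `<=` measurable -> B `<=` measurable ->
  setI_system A B `<=` measurable.
Proof. by move=> Am Bm _ [a /Am ma [b /Bm mb <-]]; exact: measurableI. Qed.

Lemma sigma_algebraT G : sigma_algebra setT G -> G setT.
Proof. by move=> [G0 GC _]; have := GC _ G0; rewrite setD0. Qed.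

Lemma sigma_algebra_setI G : sigma_algebra setT G -> setI_closed G.
Proof.
move=> sG a b Ga Gb; have := @measurableI _ (g_sigma_algebraType G) a b.
by rewrite !measurable_gE//; exact.
Qed.

Lemma gen_measurable A : A `<=` measurable -> <<s A >> `<=` measurable.
Proof. by move=> Am; apply: smallest_sub => //; exact: sigma_algebra_measurable. Qed.

Lemma sigma_gen_sigma_algebra {V : topologicalType} (f : Omega -> V) :
  sigma_algebra setT (sigma_gen f).
Proof. by apply: sigma_algebra_preimage; exact: smallest_sigma_algebra. Qed.

(** P(abe) = P(ab) P(e) = P(a) P(b) P(e) = P(a) P(be), since [a] and [b] both lie in [F]; the
    intersections [be] generate the join. In this way a family of increments is extended by one
    more. *)
Lemma independent2_join A B F E : A `<=` F -> B `<=` F -> F `<=` measurable ->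
  E `<=` measurable -> setI_closed F -> setI_closed B -> setI_closed E ->
  B setT -> E setT ->
  independent2 P A B -> independent2 P F E -> independent2 P A <<s B `|` E >>.
Proof.
move=> AF BF Fm Em FI BI EI BT ET AB FE.
apply: (@independent2_sub A A <<s setI_system B E >>) => //.
  apply: sub_sigma_algebra2; rewrite subUset; split.
    exact: sub_setI_systeml.
  exact: sub_setI_systemr.
apply: independent2_gen.
- exact: subset_trans AF Fm.
- by apply: setI_system_measurable => //; exact: subset_trans BF Fm.
- exact: setI_system_closed.
- move=> a _ Aa [b Bb [e Ee <-]]; rewrite setIA [LHS]FE//; last first.
    by apply: FI; [exact: AF|exact: BF].
  by rewrite AB// [in RHS]FE ?muleA//; exact: BF.
Qed.

Section family.
Context {I : finType}.
Implicit Types (S : I -> set (set Omega)) (E : I -> set Omega).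

Definition independent_all S := forall E, (forall i, S i (E i)) ->
  P (\bigcap_(i in [set: I]) E i) = (\prod_i P (E i))%E.

Lemma independent_familyT S : independent_family P S -> independent_all S.
Proof.
move=> h E SE; have := h [set: I]%SET E (fun i _ => SE i).
rewrite (_ : [set` _] = [set: I]); last by apply/seteqP; split=> i //= _; rewrite inE.
by move=> ->; apply: eq_bigl => i; rewrite inE.
Qed.

(** One index at a time: the list [s] collects the indices whose system has already been enlarged to
    the generated sigma-algebra, the events of the other indices being held fixed. *)
Lemma independent_all_gen S : (forall i, S i `<=` measurable) ->
  (forall i, setI_closed (S i)) -> (forall i, S i setT) ->
  independent_all S -> independent_all (fun i => <<s S i >>).
Proof.
move=> Sm SI ST indS.
suff h (s : seq I) E : (forall i, i \in s -> <<s S i >> (E i)) ->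
    (forall i, i \notin s -> S i (E i)) ->
    P (\bigcap_(i in [set: I]) E i) = (\prod_i P (E i))%E.
  by move=> E SE; apply: (h (enum I)) => // i; rewrite mem_enum.
elim: s E => [|i s IH] E h1 h2; first by apply: indS => i; exact: h2.
have [si|si] := boolP (i \in s).
  apply: IH => j js; first by apply: h1; rewrite inE js orbT.
  by apply: h2; rewrite inE negb_or js andbT; apply: contraNneq js => ->.
pose rest := \bigcap_(j in [set j | j != i]) E j.
have Em j : measurable (E j).
  have [/h1|/h2] := boolP (j \in i :: s); first exact: gen_measurable.
  exact: Sm.
have rm : measurable rest.
  by apply: fin_bigcap_measurable => //; exact: finite_finset.
pose E' (B : set Omega) j := if j == i then B else E j.
have capE (B : set Omega) : \bigcap_(j in [set: I]) E' B j = rest `&` B.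
  apply/seteqP; split=> x.
    move=> h; split; last by have := h i Logic.I; rewrite /E' eqxx.
    by move=> j /= ji; have := h j Logic.I; rewrite /E' (negbTE ji).
  move=> [h Bx] j _; rewrite /E'; case: eqVneq => // ji; exact: h.
have prodE (B : set Omega) : (\prod_j P (E' B j) = P B * \prod_(j | j != i) P (E j))%E.
  rewrite (bigD1 i)//= {1}/E' eqxx; congr (_ * _)%E.
  by apply: eq_bigr => j ji; rewrite /E' (negbTE ji).
have IH' (B : set Omega) : S i B -> P (rest `&` B) = (P B * \prod_(j | j != i) P (E j))%E.
  move=> SB; rewrite -capE -prodE; apply: IH => j js.
    rewrite /E'; case: eqVneq => [ji|_]; first by move: si; rewrite -ji js.
    by apply: h1; rewrite inE js orbT.
  rewrite /E'; case: eqVneq => [->//|ji].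
  by apply: h2; rewrite inE negb_or ji.
have restE : P rest = (\prod_(j | j != i) P (E j))%E.
  by have := IH' setT (ST i); rewrite setIT probability_setT mul1e.
have ind : independent2 P [set rest] <<s S i >>.
  apply: independent2_gen => //; first by move=> _ ->.
  by move=> _ b -> Sb; rewrite IH'// muleC restE.
have EE : E' (E i) = E by apply/funext => j; rewrite /E'; case: eqVneq => [->|].
rewrite -{1}EE capE ind//; last by apply: h1; rewrite inE eqxx.
by rewrite restE [in RHS](bigD1 i)//= muleC.
Qed.

End family.

(** By completeness, every subset of the exceptional set belongs to [G]. *)
Lemma ae_measurableG G (f ft : Omega -> R) : sigma_algebra setT G ->
  P.-negligible `<=` G -> measurable_fun setT (ft : g_sigma_algebraType G -> R) ->
  {ae P, forall w, f w = ft w} -> measurable_fun setT (f : g_sigma_algebraType G -> R).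
Proof.
move=> sG nG mft fft _ B mB; rewrite setTI.
pose N := ~` [set w | f w = ft w].
have mN : measurable (N : set (g_sigma_algebraType G)).
  by rewrite measurable_gE//; exact: nG.
rewrite (_ : _ @^-1` _ = (ft @^-1` B `\` N) `|` (f @^-1` B `&` N)).
  apply: (@measurableU _ (g_sigma_algebraType G)).
    by apply: (@measurableD _ (g_sigma_algebraType G)) => //; exact: measurable_preimageT.
  rewrite measurable_gE//; apply: nG; apply: negligibleS fft => w [] //.
apply/seteqP; split=> w /=.
  have [e|ne] := pselect (f w = ft w) => fB; last by right.
  by left; split; [rewrite /preimage/= -e|move=> /(_ e)].
by case=> [[ftB /contrapT ->//]|[]].
Qed.

End independence_lemmas.

Lemma sigma_gen_sub {Omega : Type} {V : topologicalType} (f : Omega -> V) (G : set (set Omega)) :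
  measurable_wrt G f -> sigma_gen f `<=` G.
Proof. by []. Qed.

Lemma big_option {R : Type} {idx : R} {op : Monoid.com_law idx} {I : finType}
    (F : option I -> R) :
  \big[op/idx]_(o : option I) F o = op (F None) (\big[op/idx]_(i : I) F (Some i)).
Proof.
rewrite (bigD1 None)//=; congr (op _ _).
rewrite (reindex_omap Some id)/=; last by case.
by apply: eq_bigl => i; rewrite eqxx.
Qed.

Section wrt_rows.
Context {R : realType} {dd} {Omega : measurableType dd} (G : set (set Omega)).
Hypothesis sG : sigma_algebra setT G.

Lemma measurable_wrt_rows {m n} (f : Omega -> 'M[R]_(m, n)) :
  measurable_wrt G f <-> forall i, measurable_wrt G (fun w => row i (f w)).
Proof.
split=> [/(measurable_wrt_mxP sG) h i|h].
  apply/(measurable_wrt_mxP sG) => k j; under eq_fun do rewrite mxE; exact: h.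
apply/(measurable_wrt_mxP sG) => i j; have /(measurable_wrt_mxP sG)/(_ 0 j) := h i.
by under eq_fun do rewrite mxE.
Qed.

Lemma measurable_wrtB {m n} (f g : Omega -> 'M[R]_(m, n)) :
  measurable_wrt G f -> measurable_wrt G g -> measurable_wrt G (fun w => f w - g w).
Proof.
move=> /(measurable_wrt_mxP sG) hf /(measurable_wrt_mxP sG) hg.
apply/(measurable_wrt_mxP sG) => i j; under eq_fun do rewrite !mxE.
exact: measurable_funB.
Qed.

Lemma measurable_wrtD {m n} (f g : Omega -> 'M[R]_(m, n)) :
  measurable_wrt G f -> measurable_wrt G g -> measurable_wrt G (fun w => f w + g w).
Proof.
move=> /(measurable_wrt_mxP sG) hf /(measurable_wrt_mxP sG) hg.
apply/(measurable_wrt_mxP sG) => i j; under eq_fun do rewrite !mxE.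
exact: measurable_funD.
Qed.

End wrt_rows.

Lemma measurable_wrt_mono {Omega : Type} {V : topologicalType} (f : Omega -> V)
  (G F : set (set Omega)) : G `<=` F -> measurable_wrt G f -> measurable_wrt F f.
Proof. by move=> GF fG; exact: subset_trans fG GF. Qed.

(** * The filtrations *)

Section setting_independence.
Context {R : realType} {dd : measure_display} {Omega : measurableType dd}.
Context {n d : nat} (P : probability Omega R) (T : R) (F0 : set (set Omega)).
Context (W : R -> Omega -> 'M[R]_(n, d)) (xi : Omega -> 'M[R]_(n, d)).
Hypothesis hS : setting P T F0 W xi.

Local Notation past i t := (sigma_past (component i W) t).
Local Notation full := (full_filtration P F0 W).
Local Notation own i := (own_filtration P W xi i).

Let sm : sigma_algebra setT (@measurable _ Omega) := sigma_algebra_measurable Omega.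

Lemma sigma_past_sigma {V : topologicalType} (X : R -> Omega -> V) t :
  sigma_algebra setT (sigma_past X t).
Proof. exact: smallest_sigma_algebra. Qed.

Lemma full_sigma t : sigma_algebra setT (full t).
Proof. exact: smallest_sigma_algebra. Qed.

Lemma own_sigma i t : sigma_algebra setT (own i t).
Proof. exact: smallest_sigma_algebra. Qed.

Lemma sigma_past_wrt {V : topologicalType} (X : R -> Omega -> V) s t :
  0 <= s -> s <= t -> measurable_wrt (sigma_past X t) (X s).
Proof.
move=> s0 st B sB; apply: sub_gen_smallest; exists s => //=.
by rewrite in_itv/= s0.
Qed.

Lemma sigma_past_min {V : topologicalType} (X : R -> Omega -> V) t (G : set (set Omega)) :
  sigma_algebra setT G -> (forall s, 0 <= s -> s <= t -> measurable_wrt G (X s)) ->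
  sigma_past X t `<=` G.
Proof.
move=> sG XG; apply: smallest_sub => // A [s /=]; rewrite in_itv/= => /andP[s0 st].
exact: XG.
Qed.

Lemma sigma_past_mono {V : topologicalType} (X : R -> Omega -> V) s t :
  s <= t -> sigma_past X s `<=` sigma_past X t.
Proof.
move=> st; apply: sigma_past_min; first exact: sigma_past_sigma.
by move=> r r0 rs; apply: sigma_past_wrt => //; exact: le_trans st.
Qed.

Lemma W_component_measurable i t : 0 <= t -> t <= T -> measurable_wrt measurable (component i W t).
Proof.
move=> t0 tT; have := bm_measurable (set_W_bm hS i); apply.
by rewrite in_itv/= t0.
Qed.

Lemma W_measurable t : 0 <= t -> t <= T -> measurable_wrt measurable (W t).
Proof. by move=> t0 tT; apply/(measurable_wrt_rows sm) => i; exact: W_component_measurable. Qed.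

Lemma past_measurable i t : t <= T -> past i t `<=` measurable.
Proof.
move=> tT; apply: sigma_past_min => // s s0 st; apply: W_component_measurable => //.
exact: le_trans tT.
Qed.

Lemma F0_full t : F0 `<=` full t.
Proof. by move=> A FA; apply: sub_gen_smallest; left; left. Qed.

Lemma W_full s t : 0 <= s -> s <= t -> measurable_wrt (full t) (W s).
Proof.
move=> s0 st; have h : sigma_past W t `<=` full t.
  by move=> A FA; apply: sub_gen_smallest; left; right.
by apply: (measurable_wrt_mono h); exact: sigma_past_wrt.
Qed.

Lemma W_component_full i s t : 0 <= s -> s <= t -> measurable_wrt (full t) (component i W s).
Proof. by move=> s0 st; have /(measurable_wrt_rows (full_sigma t)) := W_full s0 st; exact. Qed.

Lemma past_full i t : past i t `<=` full t.
Proof.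
by apply: sigma_past_min => [|s s0 st]; [exact: full_sigma|exact: W_component_full].
Qed.

Lemma full_min t (G : set (set Omega)) : sigma_algebra setT G -> F0 `<=` G ->
  (forall i, past i t `<=` G) -> full t `<=` G.
Proof.
move=> sG F0G pG; apply: smallest_sub => //; rewrite !subUset; split; [split=> //|].
  apply: sigma_past_min => // s s0 st; apply/(measurable_wrt_rows sG) => i.
  apply: (@measurable_wrt_mono _ _ (component i W s) _ _ (pG i)).
  exact: sigma_past_wrt.
exact: subset_trans (set_F0_complete hS) F0G.
Qed.

Lemma full_measurable t : t <= T -> full t `<=` measurable.
Proof.
move=> tT; apply: full_min => //; first exact: set_F0_measurable hS.
by move=> i; exact: past_measurable.
Qed.

Lemma full_mono s t : s <= t -> full s `<=` full t.
Proof.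
move=> st; apply: full_min; [exact: full_sigma|exact: F0_full|move=> i].
exact: subset_trans (sigma_past_mono st) (@past_full i t).
Qed.

Lemma negligible_full t : P.-negligible `<=` full t.
Proof. by move=> A FA; apply: sub_gen_smallest; right. Qed.

Lemma negligible_own i t : P.-negligible `<=` own i t.
Proof. by move=> A FA; apply: sub_gen_smallest; right. Qed.

Lemma past_own i t : past i t `<=` own i t.
Proof. by move=> A FA; apply: sub_gen_smallest; left; right. Qed.

Lemma xi_own i t : measurable_wrt (own i t) (fun w => row i (xi w)).
Proof. by move=> A FA; apply: sub_gen_smallest; left; left. Qed.

Lemma xi_F0 i : measurable_wrt F0 (fun w => row i (xi w)).
Proof.
by have /(measurable_wrt_rows (set_F0_sigma hS)) := set_xi_measurable hS; exact.
Qed.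

Lemma own_min i t (G : set (set Omega)) : sigma_algebra setT G ->
  measurable_wrt G (fun w => row i (xi w)) -> past i t `<=` G -> P.-negligible `<=` G ->
  own i t `<=` G.
Proof. by move=> sG h1 h2 h3; apply: smallest_sub => //; rewrite !subUset. Qed.

Lemma own_full i t : own i t `<=` full t.
Proof.
apply: own_min; [exact: full_sigma| |exact: past_full|exact: negligible_full].
exact: measurable_wrt_mono (@F0_full t) (@xi_F0 i).
Qed.

Lemma own_mono i s t : s <= t -> own i s `<=` own i t.
Proof.
move=> st; apply: own_min; [exact: own_sigma|exact: xi_own| |exact: negligible_own].
exact: subset_trans (sigma_past_mono st) (@past_own i t).
Qed.

Lemma W_own i s t : 0 <= s -> s <= t -> measurable_wrt (own i t) (component i W s).
Proof.
by move=> s0 st; apply: measurable_wrt_mono (@past_own i t) _; exact: sigma_past_wrt.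
Qed.

Let fam : independent_all P (fun o : option 'I_n => if o is Some i then past i T else F0).
Proof. exact: independent_familyT (set_W_independent hS). Qed.

Lemma F0_W_independent (A : set Omega) (C : 'I_n -> set Omega) : F0 A ->
  (forall i, past i T (C i)) ->
  P (A `&` \bigcap_(i in [set: 'I_n]) C i) = (P A * \prod_i P (C i))%E.
Proof.
move=> FA pC; have := @fam (fun o => if o is Some i then C i else A).
rewrite big_option/= => <-; last by case.
congr (P _); apply/seteqP; split=> w /=; first by move=> [Aw Cw] [i|] _ //; exact: Cw.
by move=> h; split; [exact: (h None)|move=> i _; exact: (h (Some i))].
Qed.

(** [bm_independent] concerns the past of [W^i] alone. The other Brownian motions and [F0] are
    brought in by mutual independence, on the pi-system [Q] of intersections of an [F0] event with
    one event from each past. *)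
Lemma full_increment_independent i s u : 0 <= s -> s < u -> u <= T ->
  independent2 P (full s) (sigma_gen (fun w => component i W u w - component i W s w)).
Proof.
move=> s0 su uT; set E := sigma_gen _; have sT : s <= T by rewrite (le_trans (ltW su)).
have EP : E `<=` past i T.
  apply: sigma_gen_sub; apply: (measurable_wrtB (sigma_past_sigma (component i W) T)).
    by apply: sigma_past_wrt => //; exact: le_trans (ltW su).
  exact: sigma_past_wrt.
have sE : sigma_algebra setT E by exact: sigma_gen_sigma_algebra.
pose Q : set (set Omega) := [set a | exists A C, [/\ F0 A, forall j, past j s (C j) &
  a = A `&` \bigcap_(j in [set: 'I_n]) C j]].
have T1 : F0 setT by exact: sigma_algebraT (set_F0_sigma hS).
have T2 j r : past j r setT by exact: sigma_algebraT (sigma_past_sigma _ _).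
have QI : setI_closed Q.
  move=> _ _ [A [C [FA pC ->]]] [A' [C' [FA' pC' ->]]].
  exists (A `&` A'), (fun j => C j `&` C' j); split.
  - exact: (sigma_algebra_setI (set_F0_sigma hS)).
  - by move=> j; exact: (sigma_algebra_setI (sigma_past_sigma _ _)).
  - by rewrite setIACA bigcapI.
have Qm : Q `<=` measurable.
  move=> _ [A [C [FA pC ->]]]; apply: measurableI; first exact: (set_F0_measurable hS).
  apply: fin_bigcap_measurable => // j _; exact: (past_measurable sT (pC j)).
apply: (@independent2_sub _ _ _ P <<s Q >> _ E E) => //.
  apply: full_min; first exact: smallest_sigma_algebra.
    move=> A FA; apply: sub_gen_smallest; exists A, (fun=> setT); split=> //.
    by rewrite bigcap_const ?setIT//; exists i.
  move=> j C pC; apply: sub_gen_smallest.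
  exists setT, (fun k => if k == j then C else setT); split=> //.
    by move=> k; case: eqVneq => // ->.
  rewrite setTI; apply/seteqP; split=> w /=; last by move=> /(_ j I); rewrite eqxx.
  by move=> Cw k _; case: eqVneq.
have Em := subset_trans EP (past_measurable (i := i) (lexx T)).
apply: independent2_sym; apply: independent2_gen => //.
move=> e _ Ee [A [C [FA pC ->]]].
have pCT j : past j T (C j) by exact: (sigma_past_mono sT (pC j)).
rewrite setIC -setIA.
(* The increment event [e] belongs to the past of [W^i] at [T], so it can be absorbed into the event
   of index [i]. *)
pose C' j := if j == i then C i `&` e else C j.
rewrite (_ : _ `&` e = \bigcap_(j in [set: 'I_n]) C' j); last first.
  apply/seteqP; split=> w /=.
    by move=> [h ew] j _; rewrite /C'; case: eqVneq => // _; [split=> //|]; exact: h.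
  move=> h; split; last by have := h i I; rewrite /C' eqxx => -[].
  by move=> j _; have := h j I; rewrite /C'; case: eqVneq => // -> [].
rewrite !F0_W_independent//; last first.
  move=> j; rewrite /C'; case: eqVneq => // ->.
  by apply: (sigma_algebra_setI (sigma_past_sigma _ _)) => //; exact: EP.
rewrite [in RHS](bigD1 i)//= [in LHS](bigD1 i)//= {1}/C' eqxx.
rewrite (bm_independent (set_W_bm hS i) s0 su uT (pC i) Ee).
rewrite (eq_bigr (fun j => P (C j))); last first.
  by move=> j ji; rewrite /C' (negbTE ji).
by rewrite [(P (C i) * _)%E]muleC !muleA [(P A * _)%E]muleC.
Qed.

Lemma own_measurable i t : t <= T -> own i t `<=` measurable.
Proof. by move=> tT; exact: subset_trans (@own_full i t) (full_measurable tT). Qed.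

Section future.
Variables (i : 'I_n) (s : R).
Hypotheses (s0 : 0 <= s) (sT : s <= T).

Let V r (w : Omega) := component i W r w - component i W s w.

(** Finitely many times, given as a list, so that independence can be proved by induction on a
    sorted list. *)
Definition future_gen (l : seq R) : set (set Omega) :=
  <<s \bigcup_(r in [set` l]) sigma_gen (V r) >>.

Let fut_sigma l : sigma_algebra setT (future_gen l).
Proof. exact: smallest_sigma_algebra. Qed.

Let fut_min l (G : set (set Omega)) : sigma_algebra setT G ->
  (forall r, r \in l -> measurable_wrt G (V r)) -> future_gen l `<=` G.
Proof. by move=> sG VG; apply: smallest_sub => // A [r /= rl]; exact: VG. Qed.

Let V_fut l r : r \in l -> measurable_wrt (future_gen l) (V r).
Proof. by move=> rl A VA; apply: sub_gen_smallest; exists r. Qed.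

Let fut_sub l l' : {subset l <= l'} -> future_gen l `<=` future_gen l'.
Proof. by move=> ll'; apply: fut_min => // r /ll'; exact: V_fut. Qed.

Let fut_full l t : (forall r, r \in l -> s <= r <= t) -> s <= t -> future_gen l `<=` full t.
Proof.
move=> lt st; apply: fut_min => [|r /lt/andP[sr rt]]; first exact: full_sigma.
apply: (measurable_wrtB (full_sigma t)); apply: W_component_full => //.
exact: le_trans sr.
Qed.

Let past_mem l : path <%O s l -> forall r, r \in l -> s <= r <= last s l.
Proof.
elim/last_ind: l => [//|l u IH]; rewrite rcons_path last_rcons => /andP[pl lu] r.
have h : s <= last s l.
  by case: l pl IH {lu} => // a l pl IH; have /andP[] := IH pl _ (mem_last a l).
rewrite mem_rcons inE => /predU1P[->|rl]; first by rewrite lexx andbT (le_trans h)// ltW.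
by have /andP[-> rl'] := IH pl r rl; rewrite (le_trans rl')// ltW.
Qed.

(** Append the latest time [u]: its increment from the preceding time [r] is independent of
    [full r], which contains both [full s] and the sigma-algebra of the earlier increments. *)
Lemma full_future_sorted l : path <%O s l -> (forall r, r \in l -> r <= T) ->
  independent2 P (full s) (future_gen l).
Proof.
elim/last_ind: l => [_ _|l u IH].
  move=> A B FA; rewrite /future_gen set_nil bigcup_set0 => sB.
  have : B = set0 \/ B = setT.
    apply: (@smallest_sub _ _ _ [set B | B = set0 \/ B = setT]) sB => //=; split => /=.
    - by left.
    - by move=> C [->|->]; [right; rewrite setD0|left; rewrite setDv].
    - move=> C hC; have [[k Ck]|/forallNP nC] := pselect (exists k, C k = setT).
        by right; apply/seteqP; split=> // x _; exists k => //; rewrite Ck.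
      left; apply/seteqP; split=> // x [k _]; have [->//|] := hC k.
      by move/nC.
  by case=> ->; rewrite ?setI0 ?measure0 ?mule0// setIT probability_setT mule1.
rewrite rcons_path => /andP[pl lu] lT.
have lsT : last s l <= T by rewrite (le_trans (ltW lu))// lT// mem_rcons inE eqxx.
have uT : u <= T by rewrite lT// mem_rcons inE eqxx.
have sl : s <= last s l.
  case: l pl {IH lu lT lsT} => // a l pl.
  by have /andP[] := past_mem pl (mem_last a l).
set r := last s l in lu lsT sl *.
pose E := sigma_gen (fun w => component i W u w - component i W r w).
apply: (@independent2_sub _ _ _ P (full s) _ <<s future_gen l `|` E >>) => //.
  apply: fut_min => [|q]; first exact: smallest_sigma_algebra.
  have h1 : future_gen l `<=` <<s future_gen l `|` E >>.
    by move=> A fA; apply: sub_gen_smallest; left.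
  rewrite mem_rcons inE => /predU1P[->|ql]; last first.
    exact: measurable_wrt_mono h1 (V_fut ql).
  have -> : V u = fun w => (component i W u w - component i W r w) + V r w.
    by apply/funext => w; rewrite /V addrA subrK.
  apply: (measurable_wrtD (smallest_sigma_algebra _ _)).
    by move=> A EA; apply: sub_gen_smallest; right.
  (* For empty [l] the preceding time is [s] itself, where [V] vanishes. *)
  have [rs|rs] := eqVneq r s.
    apply/(measurable_wrt_mxP (smallest_sigma_algebra _ _)) => a b.
    by under eq_fun do rewrite /V rs subrr mxE; exact: measurable_cst.
  apply: (measurable_wrt_mono h1); apply: V_fut.
  by have := mem_last s l; rewrite inE -/r (negbTE rs).
apply: (@independent2_join _ _ _ P (full s) (future_gen l) (full r) E).
- exact: full_mono.
- by apply: fut_full => // q; exact: past_mem.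
- exact: full_measurable.
- apply: sigma_gen_sub; apply: (measurable_wrtB sm); apply: W_component_measurable => //.
    by rewrite (le_trans s0)// (le_trans sl)// ltW.
  exact: le_trans sl.
- exact: sigma_algebra_setI (full_sigma r).
- exact: sigma_algebra_setI (fut_sigma l).
- exact: sigma_algebra_setI (sigma_gen_sigma_algebra _).
- exact: sigma_algebraT (fut_sigma l).
- exact: sigma_algebraT (sigma_gen_sigma_algebra _).
- by apply: IH => // q ql; rewrite lT// mem_rcons inE ql orbT.
- by apply: full_increment_independent => //; exact: le_trans sl.
Qed.

Lemma full_future_independent l : (forall r, r \in l -> s < r <= T) ->
  independent2 P (full s) (future_gen l).
Proof.
move=> lT; apply: (@independent2_sub _ _ _ P (full s) _ (future_gen (sort <=%O (undup l)))) => //.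
  by apply: fut_sub => r; rewrite mem_sort mem_undup.
apply: full_future_sorted => [|r]; last first.
  by rewrite mem_sort mem_undup => /lT/andP[].
have := sort_lt_sorted (undup l); rewrite undup_uniq.
case E : (sort _ _) => [//|a l'] /= ->; rewrite andbT.
have /lT/andP[] // : a \in l.
by rewrite -mem_undup -(mem_sort <=%O) E inE eqxx.
Qed.

(** A directed union of sigma-algebras, hence stable under intersection; as a generating pi-system
    it need not be a sigma-algebra itself. *)
Definition future_system : set (set Omega) :=
  \bigcup_(l in [set l : seq R | forall r, r \in l -> s < r <= T]) future_gen l.

Lemma future_system_setI : setI_closed future_system.
Proof.
move=> A B [l hl fA] [l' hl' fB]; exists (l ++ l') => /=.
  by move=> r; rewrite mem_cat => /orP[/hl|/hl'].
apply: (sigma_algebra_setI (fut_sigma _)).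
  by apply: fut_sub fA => r; rewrite mem_cat => ->.
by apply: fut_sub fB => r; rewrite mem_cat orbC => ->.
Qed.

Lemma future_system_measurable : future_system `<=` measurable.
Proof.
move=> A [l hl]; apply: (subset_trans _ (full_measurable (lexx T))).
by apply: fut_full => // r /hl/andP[/ltW-> ->].
Qed.

(* [own i T] is generated by [own i s], which is part of [full s], and by the
   increments of [W^i] after [s], which are independent of [full s]. *)
Lemma own_markov (h psi : Omega -> R) :
  intg P h -> measurable_fun setT (h : g_sigma_algebraType (full s) -> R) ->
  (forall A, own i s A -> \int[P]_(x in A) h x = 0) ->
  measurable_fun setT (psi : g_sigma_algebraType (own i T) -> R) ->
  intg P (fun w => psi w * h w) -> \int[P]_w (psi w * h w) = 0.
Proof.
move=> hi mh h0 mpsi psih.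
apply: (@orth_gen _ _ _ P (own i T)) => //; [exact: own_sigma|exact: own_measurable|].
have fT : future_system setT by exists [::] => //; exact: sigma_algebraT (fut_sigma _).
have oT : own i s setT by exact: sigma_algebraT (own_sigma i s).
suff h1 : forall B, <<s setI_system (own i s) future_system >> B ->
    \int[P]_(x in B) h x = 0.
  move=> B oB; apply: h1; move: B oB; apply: own_min; first exact: smallest_sigma_algebra.
  - apply: (@measurable_wrt_mono _ _ _ (own i s)) (@xi_own i s).
    by move=> A oA; apply: sub_gen_smallest; exact: sub_setI_systeml.
  - apply: sigma_past_min => [|r r0 rT]; first exact: smallest_sigma_algebra.
    have [rs|sr] := leP r s.
      apply: (@measurable_wrt_mono _ _ _ (own i s)); last exact: W_own.
      by move=> A oA; apply: sub_gen_smallest; exact: sub_setI_systeml.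
    have -> : component i W r = fun w => V r w + component i W s w.
      by apply/funext => w; rewrite /V subrK.
    apply: (measurable_wrtD (smallest_sigma_algebra _ _)).
      apply: (@measurable_wrt_mono _ _ _ (future_gen [:: r])); last first.
        by apply: V_fut; rewrite inE.
      move=> A fA; apply: sub_gen_smallest; apply: sub_setI_systemr => //.
      by exists [:: r] => // q /=; rewrite inE => /eqP->; rewrite sr.
    apply: (@measurable_wrt_mono _ _ _ (own i s)); last exact: W_own.
    by move=> A oA; apply: sub_gen_smallest; exact: sub_setI_systeml.
  - move=> A nA; apply: sub_gen_smallest; apply: sub_setI_systeml => //.
    exact: negligible_own.
have os := @own_measurable i s sT.
apply: (dynkin_Rintegral0 hi).
- by apply: setI_system_measurable => //; exact: future_system_measurable.
- apply: setI_system_closed; first exact: sigma_algebra_setI (own_sigma i s).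
  exact: future_system_setI.
- exact: (h0 setT).
move=> _ [A oA [E fE <-]].
have mA := os _ oA; have mE := future_system_measurable fE.
pose pE := fine (P E).
have DE : intg P (fun w => \1_E w - pE).
  by apply: intgB; [exact: intg_indic|exact: intg_cst].
have hA : intg P (fun w => \1_A w * h w) by exact: intg_indicM.
have hAE : intg P (fun w => \1_E w * (\1_A w * h w)) by exact: intg_indicM.
have [l hl lE] := fE.
(* [1_A h] is known at [full s] and the centred indicator of [E] is independent of it. The integral
   of [h] over the intersection is therefore P(E) times the one over [A], which is 0. *)
have : \int[P]_w ((\1_A w * h w) * (\1_E w - pE)) = 0.
  apply: (@indep_mean0 _ _ _ P (full s) (future_gen l)) => //.
  - exact: full_sigma.
  - exact: full_measurable.
  - by move=> B fB; apply: future_system_measurable; exists l.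
  - exact: full_future_independent.
  - apply: measurable_funM => //; apply: measurable_indicG; first exact: full_sigma.
    exact: own_full oA.
  - by apply: measurable_funB => //; exact: measurable_indicG.
  - by rewrite (@Rintegral_indic_sub _ _ _ P E setT)// setIT probability_setT mulr1 subrr.
  - have := intgB hAE (intgZ pE hA).
    by apply: eq_integrable => // w _ /=; rewrite mulrBr [_ * \1_E w]mulrC [_ * pE]mulrC.
under eq_Rintegral do rewrite mulrBr [_ * \1_E _]mulrC [_ * pE]mulrC.
rewrite RintegralB//; last exact: intgZ.
rewrite RintegralZl// -(Rintegral_in_indic P h A) (h0 _ oA) mulr0 subr0 => e.
rewrite Rintegral_in_indic -e; apply: eq_Rintegral => w _.
by rewrite indicI/= mulrA [\1_E w * _]mulrC.
Qed.

(** The orthogonality says that [Y] is the conditional expectation of [eta] given [full s]. As [eta]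
    depends on the history of [(xi^i, W^i)] alone, [own_markov] identifies it with the one given
    [own i s], and completeness removes the null set. *)
Lemma own_descent (Y eta : Omega -> R) : sqi P Y -> sqi P eta ->
  measurable_fun setT (Y : g_sigma_algebraType (full s) -> R) ->
  measurable_fun setT (eta : g_sigma_algebraType (own i T) -> R) ->
  (forall phi : Omega -> R, measurable_fun setT (phi : g_sigma_algebraType (full s) -> R) ->
     (exists k : R, forall w, `|phi w| <= k) -> \int[P]_w (phi w * (Y w - eta w)) = 0) ->
  measurable_fun setT (Y : g_sigma_algebraType (own i s) -> R).
Proof.
move=> Y2 eta2 mY meta orth.
have so := own_sigma i s; have sf := full_sigma s.
have om := @own_measurable i s sT; have fm := full_measurable sT.
have mid := measurable_id_sub om so.
have [y [my y2 yE]] := cond_exp_sqi mid Y2.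
apply: (@ae_measurableG _ _ _ P (own i s) Y y) => //; first exact: negligible_own.
have myf : measurable_fun setT (y : g_sigma_algebraType (full s) -> R).
  exact: (measurable_fun_subG so sf (@own_full i s)).
have Yy2 : sqi P (fun w => Y w - y w) by exact: sqiB.
have Ye2 : sqi P (fun w => Y w - eta w) by exact: sqiB.
(* With [pt] the projection of [phi] on [own i s], the claim is the chain
   E[phi Y] = E[phi eta] = E[pt eta] = E[pt Y] = E[pt y] = E[phi y]. *)
have key (phi : Omega -> R) (k : R) : measurable_fun setT (phi : g_sigma_algebraType (full s) -> R) ->
    (forall w, `|phi w| <= k) -> \int[P]_w (phi w * (Y w - y w)) = 0.
  move=> mphi phik.
  have mphi' : measurable_fun setT phi by exact: (measurable_fun_sub fm sf mphi).
  have phi2 : sqi P phi by exact: (sqi_bounded P mphi' phik).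
  have [pt [mpt ptk ptE]] := cond_exp_bounded P mid mphi' phik.
  have mpt' : measurable_fun setT (pt : Omega -> R) by exact: (measurable_fun_sub om so mpt).
  have pt2 : sqi P (pt : Omega -> R) by exact: (sqi_bounded P mpt' ptk).
  have mptf : measurable_fun setT (pt : g_sigma_algebraType (full s) -> R).
    exact: (measurable_fun_subG so sf (@own_full i s)).
  have h2 : sqi P (fun w => phi w - pt w) by exact: sqiB.
  have hz (f : Omega -> R) : measurable_fun setT (f : g_sigma_algebraType (own i T) -> R) -> sqi P f ->
      \int[P]_w (f w * (phi w - pt w)) = 0.
    move=> mf f2; apply: own_markov => //; [exact: sqi_intg|exact: measurable_funB| |exact: sqiM].
    move=> A oA; rewrite Rintegral_in_indic.
    apply: (ptE (\1_A)); first exact: measurable_indicG.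
    by apply: intg_indicM; [exact: om|exact: sqi_intg].
  have e1 : \int[P]_w (phi w * Y w) = \int[P]_w (phi w * eta w).
    apply/eqP; rewrite -subr_eq0 -RintegralB//; [|exact: sqiM..].
    under eq_Rintegral do rewrite -mulrBr.
    by apply/eqP; apply: orth => //; exists k.
  have e2 : \int[P]_w (pt w * Y w) = \int[P]_w (pt w * eta w).
    apply/eqP; rewrite -subr_eq0 -RintegralB//; [|exact: sqiM..].
    under eq_Rintegral do rewrite -mulrBr.
    by apply/eqP; apply: orth => //; exists k.
  have e3 : \int[P]_w (phi w * eta w) = \int[P]_w (pt w * eta w).
    apply/eqP; rewrite -subr_eq0 -RintegralB//; [|exact: sqiM..].
    under eq_Rintegral do rewrite -mulrBl mulrC.
    by apply/eqP; exact: hz.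
  have e4 : \int[P]_w (phi w * y w) = \int[P]_w (pt w * y w).
    apply/eqP; rewrite -subr_eq0 -RintegralB//; [|exact: sqiM..].
    under eq_Rintegral do rewrite -mulrBl mulrC.
    apply/eqP; apply: hz => //.
    exact: (measurable_fun_subG so (own_sigma i T) (own_mono sT)).
  have e5 : \int[P]_w (pt w * Y w) = \int[P]_w (pt w * y w).
    apply/eqP; rewrite -subr_eq0 -RintegralB//; [|exact: sqiM..].
    under eq_Rintegral do rewrite -mulrBr.
    by apply/eqP; apply: yE => //; exact: sqiM.
  under eq_Rintegral do rewrite mulrBr.
  by rewrite RintegralB//; [rewrite e1 e3 -e2 e5 e4 subrr|exact: sqiM..].
have /(Rintegral_cvg0_ge0 (sqi_sq Yy2) (fun=> sqr_ge0 _)) :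
    \int[P]_w ((Y w - y w) ^+ 2) = 0.
  under eq_Rintegral do rewrite expr2.
  apply: (@orth_gen _ _ _ P (full s)) => //.
  - exact: sqi_intg.
  - move=> B fB; rewrite Rintegral_in_indic; apply: (key _ 1) => [|w].
      exact: measurable_indicG.
    exact: indic_le1.
  - exact: measurable_funB.
  - exact: sqiM.
by apply: filterS => w /eqP; rewrite sqrf_eq0 subr_eq0 => /eqP.
Qed.

End future.

End setting_independence.

(** * Calculus and convexity *)

Section directional_derivatives.
Context {R : realType} {V : normedModType R}.
Implicit Types (f : V -> R) (x y u v w : V).

Lemma is_derive_line f x v (s : R) : derivable f (x + s *: v) v ->
  is_derive s 1 (fun t => f (x + t *: v)) ('D_v f (x + s *: v)).
Proof.
have E : (fun h : R => h^-1 *: (((fun t => f (x + t *: v)) \o shift s) (h *: 1) - f (x + s *: v)))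
    = (fun h : R => h^-1 *: ((f \o shift (x + s *: v)) (h *: v) - f (x + s *: v))).
  apply/funext => h /=; congr (_ *: (f _ - _)).
  by rewrite [h *: 1]mulr1 scalerDl addrCA.
move=> df; apply: DeriveDef; first by rewrite /derivable E.
by rewrite /derive E.
Qed.

Lemma mvt_line f x v (a b : R) : a < b -> (forall z, derivable f z v) ->
  exists2 c, a < c < b & f (x + b *: v) - f (x + a *: v) = 'D_v f (x + c *: v) * (b - a).
Proof.
move=> ab df.
have [|c] := @MVT R (fun t => f (x + t *: v)) (fun t => 'D_v f (x + t *: v)) a b ab
    (fun s _ => is_derive_line (df (x + s *: v))).
  by apply: derivable_within_continuous => s _; have := is_derive_line (df (x + s *: v)).
by rewrite in_itv/= => h E; exists c.
Qed.

Lemma mvt_dir f x v : (forall z, derivable f z v) ->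
  exists2 c : R, 0 < c < 1 & f (x + v) - f x = 'D_v f (x + c *: v).
Proof.
move=> df; have [c c01] := mvt_line x ltr01 df.
by rewrite scale1r scale0r addr0 subr0 mulr1 => E; exists c.
Qed.

(** The derivative is in particular a limit from the right, so a bound on one side of 0 is
    enough. *)
Lemma derive_ge f x v (c : R) : derivable f x v ->
  (\forall h \near (0 : R)^'+, h * c <= f (x + h *: v) - f x) -> c <= 'D_v f x.
Proof.
move=> df hc; rewrite /derive.
have := df; rewrite /derivable; set g := (X in X @ _) => cg.
have cg' : g @ (0 : R)^'+ --> lim (g @ 0^').
  apply: cvg_trans cg; apply: cvg_app.
  move=> A [e /= e0 eA]; exists e => //= h he h0; apply: eA => //.
  by rewrite gt_eqF.
rewrite -(cvg_lim _ cg')//; apply: limr_ge; first by apply/cvg_ex; eexists; exact: cg'.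
near=> h.
have h0 : 0 < h by near: h; exact: nbhs_right_gt.
rewrite /g/= -[leRHS]/(h^-1 * _) mulrC ler_pdivlMr// mulrC [_ + x]addrC.
by near: h.
Unshelve. all: by end_near. Qed.

Lemma derive_opp f x v : differentiable f x -> 'D_(- v) f x = - 'D_v f x.
Proof. by move=> df; rewrite !deriveE// linearN. Qed.

Lemma convex_gradient f x v : differentiable f x -> convex_function setT f ->
  'D_v f x <= f (x + v) - f x.
Proof.
move=> df cf; rewrite -lerN2 -derive_opp//.
have dfo : derivable (fun z => - f z) x v by apply: derivableN; exact: diff_derivable.
rewrite derive_opp//.
have <- : 'D_v (\- f) x = - 'D_v f x by rewrite deriveN//; exact: diff_derivable.
apply: derive_ge => //.
near=> h.
have h0 : 0 < h by near: h; exact: nbhs_right_gt.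
have h1 : h <= 1 by near: h; exact: nbhs_right_le.
have hi : 0 <= h <= 1 by rewrite (ltW h0).
pose t : {i01 R} := Itv01 (ltW h0) h1.
have := cf t (x + v) x (in_setT _) (in_setT _).
rewrite /conv/= /t/= -[X in _ <= X]/(h * f (x + v) + (1 - h) * f x).
rewrite [X in f X <= _](_ : _ = x + h *: v); last first.
  by rewrite /unstable.onem scalerDr scalerBl scale1r addrAC [h *: x + _]addrC subrK.
by lra.
Unshelve. all: by end_near. Qed.

(** Sum of the gradient inequalities at [x] and at [y]. *)
Lemma convex_gradient_mono f x y : (forall z, differentiable f z) -> convex_function setT f ->
  0 <= 'D_(y - x) f y - 'D_(y - x) f x.
Proof.
move=> df cf; have h1 := convex_gradient (y - x) (df x) cf.
have := convex_gradient (x - y) (df y) cf.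
rewrite -(opprB y x) derive_opp// opprB => h2.
have e1 : x + (y - x) = y by rewrite addrC subrK.
have e2 : y + (x - y) = x by rewrite addrC subrK.
by rewrite e1 in h1; rewrite e2 in h2; lra.
Qed.

Lemma C2_differentiable f : C2 f -> forall x, differentiable f x.
Proof. by case=> -[]. Qed.

Lemma C2_differentiable2 f v : C2 f -> forall x, differentiable ('D_v f) x.
Proof. by case=> _ /(_ v)[]. Qed.

Lemma C2_derivable f v : C2 f -> forall x, derivable f x v.
Proof. by move=> cf x; apply: diff_derivable; exact: C2_differentiable. Qed.

Lemma C2_derivable2 f v w : C2 f -> forall x, derivable ('D_v f) x w.
Proof. by move=> cf x; apply: diff_derivable; exact: C2_differentiable2. Qed.

Lemma C2_continuous f : C2 f -> continuous f.
Proof. by move=> cf x; apply: differentiable_continuous; exact: C2_differentiable. Qed.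

Lemma C2_continuous_derive f v : C2 f -> continuous ('D_v f).
Proof. by case=> -[]. Qed.

Lemma second_derivative_mono f x v c : C2 f ->
  (forall z, c <= 'D_v ('D_v f) z) -> c <= 'D_v f (x + v) - 'D_v f x.
Proof.
move=> cf h; have [s _ ->] := mvt_dir x (fun z => @C2_derivable2 f v v cf z).
exact: h.
Qed.

Lemma second_derivative_convex f x v : C2 f ->
  (forall z, 0 <= 'D_v ('D_v f) z) -> 'D_v f x <= f (x + v) - f x.
Proof.
move=> cf h; have [s /andP[s0 s1] ->] := mvt_dir x (fun z => @C2_derivable f v cf z).
have [c _ E] := mvt_line x s0 (fun z => @C2_derivable2 f v v cf z).
move: E; rewrite scale0r addr0 subr0 => /eqP; rewrite subr_eq => /eqP ->.
by rewrite lerDr mulr_ge0// ltW.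
Qed.

Section bounded.
Variable f : V -> R.
Hypotheses (cf : C2 f) (bf : bounded_second_derivatives f).

Lemma bounded_second_derivatives_pos :
  exists2 K, 0 <= K & forall x u v, `|'D_u ('D_v f) x| <= K * (`|u| * `|v|).
Proof.
have [C hC] := bf; exists `|C| => // x u v; rewrite (le_trans (hC x u v))//.
by rewrite ler_wpM2r ?mulr_ge0// ler_norm.
Qed.

Lemma lipschitz_gradient : exists2 K, 0 <= K & forall x u v,
  `|'D_v f (x + u) - 'D_v f x| <= K * (`|u| * `|v|).
Proof.
have [K K0 hK] := bounded_second_derivatives_pos; exists K => // x u v.
by have [s _ ->] := mvt_dir x (fun z => @C2_derivable2 f v u cf z).
Qed.

(** The gradient is Lipschitz, and its value at 0 is a bounded linear map. *)
Lemma gradient_growth : exists2 K, 0 <= K & forall x v,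
  `|'D_v f x| <= K * (1 + `|x|) * `|v|.
Proof.
have [K K0 hK] := lipschitz_gradient.
have df0 := C2_differentiable cf 0.
have [M M0 hM] := linear_lipschitz (diff_continuous df0).
exists (K + M) => [|x v]; first by rewrite addr_ge0// ltW.
have := hK 0 x v; rewrite add0r => h1; have := hM v; rewrite -deriveE// => h2.
have -> : 'D_v f x = ('D_v f x - 'D_v f 0) + 'D_v f 0 by rewrite subrK.
rewrite (le_trans (ler_normD _ _))// (le_trans (lerD h1 h2))//.
rewrite mulrA -mulrDl ler_wpM2r//.
rewrite mulrDr mulr1 mulrDl addrC; have := normr_ge0 x; nra.
Qed.

Lemma quadratic_growth : exists2 K, 0 <= K & forall x, `|f x| <= K * (1 + `|x| ^+ 2).
Proof.
have [K K0 hK] := gradient_growth.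
exists (`|f 0| + 2 * K) => [|x]; first by rewrite addr_ge0// mulr_ge0.
have [s /andP[s0 s1]] := mvt_dir 0 (fun z => @C2_derivable f x cf z).
rewrite !add0r => /eqP; rewrite subr_eq => /eqP ->.
rewrite (le_trans (ler_normD _ _))//.
have h1 : `|s *: x| <= `|x|.
  by rewrite normrZ ger0_norm ?(ltW s0)// ler_piMl// ltW.
have h2 := hK (s *: x) x; set N := `|x| in h1 h2 *.
have N0 : 0 <= N by exact: normr_ge0.
have f0 : 0 <= `|f 0| by exact: normr_ge0.
have h3 : K * (1 + `|s *: x|) * N <= K * (1 + N) * N.
  by rewrite ler_wpM2r// ler_wpM2l// lerD2l.
rewrite (le_trans (lerD h2 (lexx _)))// (le_trans (lerD h3 (lexx _)))//.
have h4 : 0 <= `|f 0| * N ^+ 2 by rewrite mulr_ge0// sqr_ge0.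
have h5 : 0 <= K * (1 - N) ^+ 2 by rewrite mulr_ge0// sqr_ge0.
have h6 : 0 <= K by []. have h7 : 0 <= K * N ^+ 2 by rewrite mulr_ge0// sqr_ge0.
nra.
Qed.

Lemma taylor_bound : exists2 K, 0 <= K & forall x v,
  `|f (x + v) - f x - 'D_v f x| <= K * `|v| ^+ 2.
Proof.
have [K K0 hK] := lipschitz_gradient; exists K => // x v.
have [s /andP[s0 s1] ->] := mvt_dir x (fun z => @C2_derivable f v cf z).
rewrite (le_trans (hK x (s *: v) v))// ler_wpM2l// expr2 ler_wpM2r//.
by rewrite normrZ ger0_norm ?(ltW s0)// ler_piMl// ltW.
Qed.

End bounded.

End directional_derivatives.

Section gradients.
Context {R : realType} {n d : nat}.

Lemma derive_grad_i (F : 'M[R]_(n, d) -> R) z v : differentiable F z ->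
  'D_v F z = \sum_i dotp (grad_i F i z) (row i v).
Proof.
move=> dF; rewrite deriveE// {1}(matrix_sum_delta v) linear_sum; apply: eq_bigr => i _.
rewrite linear_sum; apply: eq_bigr => k _.
by rewrite linearZ/= /grad_i !mxE deriveE// mulrC.
Qed.

Lemma derive_grad_pair (L : 'rV[R]_d * 'rV[R]_d -> R) x p u v : differentiable L (x, p) ->
  'D_(u, v) L (x, p) = dotp (grad_fst L x p) u + dotp (grad_snd L x p) v.
Proof.
move=> dL; rewrite deriveE//.
have -> : (u, v) = (\sum_k u 0 k *: (delta_mx 0 k, 0 : 'rV[R]_d)) +
    (\sum_k v 0 k *: (0 : 'rV[R]_d, delta_mx 0 k)).
  rewrite [in LHS](row_sum_delta u) [in LHS](row_sum_delta v).
  have h1 := @big_morph _ _ (fun w : 'rV[R]_d => (w, 0 : 'rV[R]_d)) 0 +%R 0 +%R.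
  have h2 := @big_morph _ _ (fun w : 'rV[R]_d => (0 : 'rV[R]_d, w)) 0 +%R 0 +%R.
  have E (a b : 'rV[R]_d) : (a, b) = (a, 0) + (0, b) by congr pair; rewrite ?addr0 ?add0r.
  rewrite E h1// ?h2//.
  - congr (_ + _); apply: eq_bigr => k _.
      by congr pair; rewrite ?scaler0.
    by congr pair; rewrite ?scaler0.
  - by move=> a b; congr pair; rewrite addr0.
  - by move=> a b; congr pair; rewrite addr0.
rewrite linearD !linear_sum; congr (_ + _); apply: eq_bigr => k _.
  by rewrite linearZ/= /grad_fst mxE deriveE// mulrC.
by rewrite linearZ/= /grad_snd mxE deriveE// mulrC.
Qed.

End gradients.

Lemma continuous_dotp {R : realType} {d : nat} (p : 'rV[R]_d) :
  continuous (fun b : 'rV[R]_d => dotp b p).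
Proof.
rewrite /dotp; elim: (index_enum _) => [|k s IH].
  rewrite (_ : (fun b => _) = cst 0); first exact: cst_continuous.
  by apply/funext => b; rewrite big_nil.
rewrite (_ : (fun b => _) = fun b : 'rV[R]_d => b 0 k * p 0 k + \sum_(j <- s) b 0 j * p 0 j); last first.
  by apply/funext => b; rewrite big_cons.
move=> c; apply: (@continuousD _ _ _ (fun b : 'rV[R]_d => b 0 k * p 0 k)); last exact: IH.
apply: (@continuousM _ _ (fun b : 'rV[R]_d => b 0 k) (cst (p 0 k))); last exact: cst_continuous.
exact: coord_continuous.
Qed.

(** * The Hamiltonian and its maximiser *)

Section hamiltonian.
Context {R : realType} {d : nat}.
Variables (L H : 'rV[R]_d * 'rV[R]_d -> R).
Hypotheses (H_def : forall x p, (H (x, p))%:E =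
    ereal_sup (range (fun a => (- dotp a p - L (x, a))%:E))).
Hypotheses (cL : C2 L) (cH : C2 H) (bH : bounded_second_derivatives H).

Lemma dotpDr (x y z : 'rV[R]_d) : dotp x (y + z) = dotp x y + dotp x z.
Proof. by rewrite /dotp -big_split/=; apply: eq_bigr => k _; rewrite mxE mulrDr. Qed.

Lemma dotpZr k (x y : 'rV[R]_d) : dotp x (k *: y) = k * dotp x y.
Proof. by rewrite /dotp mulr_sumr; apply: eq_bigr => i _; rewrite mxE mulrCA. Qed.

Lemma dotp_delta (x : 'rV[R]_d) k : dotp x (delta_mx 0 k) = x 0 k.
Proof.
rewrite /dotp (bigD1 k)//= mxE !eqxx mulr1 big1 ?addr0// => j jk.
by rewrite mxE eqxx (negbTE jk) mulr0.
Qed.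

Lemma hamiltonian_ge x p a : - dotp a p - L (x, a) <= H (x, p).
Proof. by rewrite -lee_fin H_def; apply: ereal_sup_ubound; exists a. Qed.

Lemma norm_delta_snd_le1 k : `|(0 : 'rV[R]_d, delta_mx 0 k : 'rV[R]_d)| <= 1.
Proof.
rewrite prod_normE/= normr0 ge_max ler01/= [leLHS]mx_normrE.
by apply: bigmax_le => // -[i j] _; rewrite mxE; case: (_ && _); rewrite ?normr0 ?normr1.
Qed.

(* An [e^2]-maximiser [b] makes the affine function [q |-> - dotp b q - L (x, b)]
   touch [H (x, .)] at [p] from below up to [e^2], hence lies within [(K + 1) e]
   of [- D_pH]. *)
Lemma hamiltonian_argmax x p (a := - grad_snd H x p) b :
  - dotp b p - L (x, b) <= - dotp a p - L (x, a).
Proof.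
rewrite (le_trans (hamiltonian_ge _ _ _))//.
have [K K0 hK] := taylor_bound cH bH.
pose phi b := - dotp b p - L (x, b).
have cphi : continuous phi.
  move=> c; apply: (@continuousB _ _ _ (fun b => - dotp b p) (fun b => L (x, b))); last first.
    apply: (@continuous_comp _ _ _ (fun b => (x, b)) L); last exact: C2_continuous.
    move=> S /= /(nbhs_ballP (x, c))[e e0 eS]; apply/nbhs_ballP; exists e => //= z cz.
    by apply: eS; split => //=; exact: ballxx.
  apply: (@continuousN _ _ _ (fun b => dotp b p)).
  exact: continuous_dotp.
have near_a (e : R) : 0 < e -> exists2 b, H (x, p) - e ^+ 2 < phi b & `|b - a| <= (K + 1) * e.
  move=> e0.
  have : ((H (x, p) - e ^+ 2)%:E < ereal_sup (range (fun a => (- dotp a p - L (x, a))%:E)))%E.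
    by rewrite -H_def lte_fin ltrBlDr ltrDl exprn_gt0.
  move=> /ereal_sup_gt[_ [b' _ <-]]; rewrite lte_fin => hb; exists b' => //.
  rewrite [leLHS]mx_normrE; apply: bigmax_le => [|[i k] _].
    by rewrite mulr_ge0 ?addr_ge0// ltW.
  rewrite /= (ord1 i) /a !mxE opprK.
  set D := 'D_ _ H _.
  pose v : 'rV[R]_d * 'rV[R]_d := (0, delta_mx 0 k).
  (* At [p] shifted by [t] in direction [k], the supremum bounds [H] from below by the affine
     function of [b'], and Taylor bounds it from above. The values [t = e] and [t = - e] give the
     two halves of the estimate. *)
  have tay t : - (t * (b' 0 k + D)) <= (K * t ^+ 2 + e ^+ 2).
    have h1 := hamiltonian_ge x (p + t *: delta_mx 0 k) b'.
    rewrite dotpDr dotpZr dotp_delta in h1.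
    have h2 := hK (x, p) (t *: v).
    have E : (x, p) + t *: v = (x, p + t *: delta_mx 0 k).
      by congr pair; rewrite /= scaler0 addr0.
    have D2 : 'D_(t *: v) H (x, p) = t * D.
      have dH := C2_differentiable cH (x, p).
      by rewrite /D (deriveE _ dH) (deriveE _ dH) linearZ.
    rewrite E D2 in h2.
    have h3 : `|t *: v| ^+ 2 <= t ^+ 2.
      rewrite normrZ exprMn real_normK ?num_real// ler_piMr ?sqr_ge0//.
      by rewrite exprn_ile1// norm_delta_snd_le1.
    have h4 := le_trans h2 (ler_wpM2l K0 h3).
    by move: h4; rewrite ler_norml => /andP[_ h4]; lra.
  have h1 := tay e; have h2 := tay (- e).
  rewrite sqrrN in h2; set z := b' 0 k + D in h1 h2 *.
  have E : K * e ^+ 2 + e ^+ 2 = e * ((K + 1) * e) by ring.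
  rewrite E in h1 h2.
  rewrite ler_norml; apply/andP; split.
    by rewrite -(ler_pM2l e0) mulrN lerNl.
  by rewrite -(ler_pM2l e0); rewrite mulNr opprK in h2.
rewrite -[leRHS]/(phi a) leNgt; apply/negP => ha.
pose del := H (x, p) - phi a.
have del0 : 0 < del by rewrite subr_gt0.
have del2 : 0 < del / 2 by rewrite divr_gt0.
have /cvgrPdist_lt/(_ _ del2)/nbhs_ballP[r /= r0 hr] := cphi a.
(* The first two bounds give [e ^+ 2 <= del / 2] and the third puts [b'] within [r / 2] of [a].
   Continuity then keeps [phi b'] below [phi a + del / 2], against the near-optimality of [b']. *)
pose e := Num.min (Num.min 1 (del / 2)) (r / (2 * (K + 1))).
have K1 : 0 < K + 1 by rewrite ltr_wpDl.
have e0 : 0 < e by rewrite !lt_min ltr01 del2/= divr_gt0// mulr_gt0.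
have [b' hb1 hb2] := near_a e e0.
have e1 : e <= 1 by rewrite /e !ge_min lexx.
have e2 : e <= del / 2 by rewrite /e !ge_min lexx orbT.
have e3 : e <= r / (2 * (K + 1)) by rewrite /e !ge_min lexx orbT.
have ee : e ^+ 2 <= del / 2 by rewrite expr2 (le_trans _ e2)// ler_piMl// ltW.
have br : `|b' - a| < r.
  rewrite (le_lt_trans hb2)// (le_lt_trans (ler_wpM2l (ltW K1) e3))//.
  rewrite (_ : (K + 1) * _ = r / 2); last by field; rewrite gt_eqF.
  by rewrite ltr_pdivrMr// ltr_pMr// ltr1n.
have := hr b'; rewrite -ball_normE /= distrC => /(_ br).
rewrite ltr_distl => /andP[h1 h2]; rewrite /del in h1 h2 ee; lra.
Qed.

(** By [hamiltonian_argmax] the function [b |-> dotp b p + L (x, b)] is minimal at [a], so its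
    derivative vanishes there. This is what allows the costate to be read off the state and the
    control. *)
Lemma hamiltonian_foc x p : grad_snd L x (- grad_snd H x p) = - p.
Proof.
set a := - grad_snd H x p; apply/rowP => k; rewrite !mxE.
pose v : 'rV[R]_d * 'rV[R]_d := (0, delta_mx 0 k).
have dL := C2_differentiable cL (x, a).
have h (t : R) : t * - p 0 k <= L ((x, a) + t *: v) - L (x, a).
  have := hamiltonian_argmax x p (a + t *: delta_mx 0 k); rewrite -/a.
  have -> : (x, a) + t *: v = (x, a + t *: delta_mx 0 k).
    by congr pair; rewrite /= scaler0 addr0.
  have dotpC (y z : 'rV[R]_d) : dotp y z = dotp z y.
    by rewrite /dotp; apply: eq_bigr => j _; rewrite mulrC.
  by rewrite dotpC dotpDr dotpZr dotp_delta dotpC; lra.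
rewrite -/v; apply/eqP; rewrite eq_le; apply/andP; split; last first.
  by apply: derive_ge; [exact: diff_derivable|apply: nearW => t; exact: h].
rewrite -lerN2 opprK -derive_opp//; apply: derive_ge; first exact: diff_derivable.
by apply: nearW => t; have := h (- t); rewrite scalerN scaleNr mulrNN.
Qed.

End hamiltonian.

(** * Integration over time and probability *)

Section finite_product.
Context {d1 d2} {A : measurableType d1} {S : measurableType d2} {R : realType}.
Variables (m1 : {finite_measure set A -> \bar R}) (m2 : {finite_measure set S -> \bar R}).

(** The product measure under a name of its own, to carry the finite-measure structure under which
    square-integrable functions are integrable. *)
Definition fprodm : set (A * S) -> \bar R := (m1 \x m2)%E.

Let fprodm0 : fprodm set0 = 0%E. Proof. exact: measure0. Qed.
Let fprodm_ge0 B : (0 <= fprodm B)%E. Proof. exact: measure_ge0. Qed.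
Let fprodm_sigma_additive : semi_sigma_additive fprodm.
Proof. exact: measure_semi_sigma_additive. Qed.

HB.instance Definition _ := isMeasure.Build _ _ _ fprodm
  fprodm0 fprodm_ge0 fprodm_sigma_additive.

Let fprodm_fin : fin_num_fun fprodm.
Proof.
move=> B mB; rewrite ge0_fin_numE//; apply: (@le_lt_trans _ _ (fprodm setT)).
  by apply: le_measure; rewrite ?inE.
rewrite /fprodm -setXTT product_measure1E//.
by rewrite lte_mul_pinfty// ?ltey_eq fin_num_measure.
Qed.

HB.instance Definition _ := Measure_isFinite.Build _ _ _ fprodm fprodm_fin.

End finite_product.

Lemma measurable_pair_comp {d1 d2 d3 d4} {X : measurableType d1} {A : measurableType d2}
  {B : measurableType d3} {C : measurableType d4} (h : A * B -> C) (f : X -> A) (g : X -> B) :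
  measurable_fun setT h -> measurable_fun setT f -> measurable_fun setT g ->
  measurable_fun setT (fun x => h (f x, g x)).
Proof. by move=> mh mf mg; exact: measurableT_comp mh (measurable_fun_pair mf mg). Qed.

Section fubini_reals.
Context {d1 d2} {A : measurableType d1} {S : measurableType d2} {R : realType}.
Variables (m1 : {finite_measure set A -> \bar R}) (m2 : {finite_measure set S -> \bar R}).
Local Notation Q := (fprodm m1 m2).
Implicit Types (f g : A * S -> R).

Lemma measurable_section1 f t : measurable_fun setT f ->
  measurable_fun setT (fun w => f (t, w)).
Proof. by move=> mf; apply: measurableT_comp => //; exact: pair1_measurable. Qed.

Lemma measurable_section2 f w : measurable_fun setT f ->
  measurable_fun setT (fun t => f (t, w)).
Proof. by move=> mf; apply: measurableT_comp => //; exact: pair2_measurable. Qed.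

Lemma ae_intg1 f : intg Q f -> {ae m1, forall t, intg m2 (fun w => f (t, w))}.
Proof. by move=> fi; exact: (ae_integrable1 fi). Qed.

Lemma ae_intg2 f : intg Q f -> {ae m2, forall w, intg m1 (fun t => f (t, w))}.
Proof. by move=> fi; exact: (ae_integrable2 fi). Qed.

Lemma ae_sqi1 f : sqi Q f -> {ae m1, forall t, sqi m2 (fun w => f (t, w))}.
Proof.
move=> f2; have [mf _] := f2; have := ae_intg1 (sqi_sq f2).
by apply: filterS => t ft; apply: intg_sqi => //; exact: measurable_section1.
Qed.

Lemma ae_sqi2 f : sqi Q f -> {ae m2, forall w, sqi m1 (fun t => f (t, w))}.
Proof.
move=> f2; have [mf _] := f2; have := ae_intg2 (sqi_sq f2).
by apply: filterS => w fw; apply: intg_sqi => //; exact: measurable_section2.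
Qed.

(** Sections may fail to be integrable: both parts are measurable by Tonelli, and [fine] of their
    difference remains a measurable choice of value. *)
Lemma measurable_Rintegral1 f : measurable_fun setT f ->
  measurable_fun setT (fun t => \int[m2]_w f (t, w)).
Proof.
move=> mf.
have mE : measurable_fun setT (EFin \o f) by exact/measurable_EFinP.
rewrite (_ : (fun t => _) = fine \o (fun t => (\int[m2]_w (EFin \o f)^\+ (t, w))%E -
    (\int[m2]_w (EFin \o f)^\- (t, w))%E)%E); last first.
  apply/funext => t; rewrite /= /Rintegral integralE; congr (fine (_ - _)%E);
    by apply: eq_integral => w _; rewrite ?funeposE ?funenegE.
apply: measurableT_comp => //; apply: emeasurable_funB.
  by apply: (measurable_fun_fubini_tonelli_F (m2 := m2) (EFin \o f)^\+%E) => //; exact: measurable_funepos.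
by apply: (measurable_fun_fubini_tonelli_F (m2 := m2) (EFin \o f)^\-%E) => //; exact: measurable_funeneg.
Qed.

Lemma measurable_Rintegral2 f : measurable_fun setT f ->
  measurable_fun setT (fun w => \int[m1]_t f (t, w)).
Proof.
move=> mf.
have mE : measurable_fun setT (EFin \o f) by exact/measurable_EFinP.
rewrite (_ : (fun w => _) = fine \o (fun w => (\int[m1]_t (EFin \o f)^\+ (t, w))%E -
    (\int[m1]_t (EFin \o f)^\- (t, w))%E)%E); last first.
  apply/funext => w; rewrite /= /Rintegral integralE; congr (fine (_ - _)%E);
    by apply: eq_integral => t _; rewrite ?funeposE ?funenegE.
apply: measurableT_comp => //; apply: emeasurable_funB.
  by apply: (measurable_fun_fubini_tonelli_G (m1 := m1) (EFin \o f)^\+%E) => //; exact: measurable_funepos.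
by apply: (measurable_fun_fubini_tonelli_G (m1 := m1) (EFin \o f)^\-%E) => //; exact: measurable_funeneg.
Qed.

Lemma Rintegral_fprodm1 f : intg Q f ->
  \int[Q]_p f p = \int[m1]_t \int[m2]_w f (t, w).
Proof.
move=> fi; have mf := intg_measurable fi.
rewrite /Rintegral -(integral12_prod_meas1 fi); congr fine.
apply: ae_eq_integral => //; first exact: measurable_fubini_F fi.
  by apply/measurable_EFinP; exact: measurable_Rintegral1.
apply: filterS (ae_intg1 fi) => t ft _ /=.
by rewrite /Rintegral fineK//; exact: integrable_fin_num ft.
Qed.

Lemma Rintegral_fprodm2 f : intg Q f ->
  \int[Q]_p f p = \int[m2]_w \int[m1]_t f (t, w).
Proof.
move=> fi; have mf := intg_measurable fi.
rewrite /Rintegral -(integral21_prod_meas1 fi); congr fine.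
apply: ae_eq_integral => //; first exact: measurable_fubini_G fi.
  by apply/measurable_EFinP; exact: measurable_Rintegral2.
apply: filterS (ae_intg2 fi) => w fw _ /=.
by rewrite /Rintegral fineK//; exact: integrable_fin_num fw.
Qed.

Lemma intg_fprodm f : measurable_fun setT f ->
  (\int[m2]_w \int[m1]_t `|f (t, w)|%:E < +oo)%E -> intg Q f.
Proof. by move=> mf h; apply/(integrable21ltyP m1 m2) => //; exact/measurable_EFinP. Qed.

Lemma sqi_fst (g : S -> R) : sqi m2 g -> sqi Q (fun p => g p.2).
Proof.
move=> g2; have [mg _] := g2; have mg' : measurable_fun setT (fun p : A * S => g p.2).
  exact: measurableT_comp.
apply: intg_sqi => //; apply: intg_fprodm; first exact: measurable_funX.
rewrite (eq_integral (fun w => (m1 setT * ((g w) ^+ 2)%:E)%E)); last first.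
  by move=> w _; rewrite /= integral_cst// muleC ger0_norm ?sqr_ge0.
rewrite ge0_integralZl//; first by apply/lte_mul_pinfty; rewrite ?fin_num_measure//; case: g2.
- by apply/measurable_EFinP; exact: measurable_funX.
- by move=> w _; rewrite lee_fin sqr_ge0.
Qed.

Lemma sqi_snd (g : A -> R) : sqi m1 g -> sqi Q (fun p => g p.1).
Proof.
move=> g2; have [mg _] := g2; have mg' : measurable_fun setT (fun p : A * S => g p.1).
  exact: measurableT_comp.
apply: intg_sqi => //; apply/(integrable12ltyP m1 m2) => /=.
  by apply/measurable_EFinP; exact: measurable_funX.
rewrite (eq_integral (fun t => (m2 setT * ((g t) ^+ 2)%:E)%E)); last first.
  by move=> t _; rewrite /= integral_cst// muleC ger0_norm ?sqr_ge0.
rewrite ge0_integralZl//; first by apply/lte_mul_pinfty; rewrite ?fin_num_measure//; case: g2.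
- by apply/measurable_EFinP; exact: measurable_funX.
- by move=> w _; rewrite lee_fin sqr_ge0.
Qed.

Lemma Rintegral_fprodm_ae0 f : intg Q f -> {ae m1, forall t, \int[m2]_w f (t, w) = 0} ->
  \int[Q]_p f p = 0.
Proof.
move=> fi h; rewrite Rintegral_fprodm1// (@ae_eq_Rintegral _ _ _ m1 _ (fun=> 0)).
- by rewrite /Rintegral integral0.
- by apply: measurable_Rintegral1; exact: intg_measurable fi.
- exact: measurable_cst.
- exact: h.
Qed.

End fubini_reals.

(** * Integral operators in time *)

Section kernel_integral.
Context {d1} {A : measurableType d1} {R : realType}.
Variables (lam : {finite_measure set A -> \bar R}).

(** Integral operator in time acting on each path. A kernel bounded by 1 makes it bounded on L^2,
    with the operator of the swapped kernel as adjoint. *)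
Definition Kint {S : Type} (K : A * A -> R) (f : A * S -> R) (p : A * S) : R :=
  \int[lam]_s (K (p.1, s) * f (s, p.2)).

Variable K : A * A -> R.
Hypotheses (mK : measurable_fun setT K) (K1 : forall p, `|K p| <= 1).

Section measurability_Kint.
Context {d2} {S : measurableType d2}.
Implicit Types f g : A * S -> R.

Lemma measurable_Kint f : measurable_fun setT f -> measurable_fun setT (Kint K f).
Proof.
move=> mf; apply: (measurable_Rintegral1 lam
  (f := fun q : (A * S) * A => K (q.1.1, q.2) * f (q.2, q.1.2))).
apply: measurable_funM; apply: measurable_pair_comp => //.
- by apply: measurableT_comp measurable_fst _; exact: measurable_fst.
- by apply: measurableT_comp measurable_snd _; exact: measurable_fst.
Qed.

Lemma intg_Kpath f t w : sqi lam (fun s => f (s, w)) ->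
  intg lam (fun s => K (t, s) * f (s, w)).
Proof.
move=> fw; apply: sqi_intg; apply: (sqi_bnd fw) => [|s]; last exact: K1.
exact: measurable_section1.
Qed.

Lemma Kint_sq_le f t w : sqi lam (fun s => f (s, w)) ->
  (Kint K f (t, w)) ^+ 2 <= fine (lam setT) * \int[lam]_s (f (s, w) ^+ 2).
Proof.
move=> fw; have h := cauchy_schwarz_sqi (sqi_cst lam 1)
  (sqi_bnd (k := 1) fw (measurable_section1 t mK) (fun s => K1 (t, s))).
rewrite /Kint /=.
have -> : \int[lam]_s (K (t, s) * f (s, w)) = \int[lam]_s (1 * (K (t, s) * f (s, w))).
  by apply: eq_Rintegral => s _; rewrite mul1r.
apply: le_trans h _; rewrite expr1n Rintegral_cst// mul1r ler_wpM2l//.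
apply: le_Rintegral => //.
- by apply: sqi_sq; apply: (sqi_bnd fw) => [|s]; [exact: measurable_section1|exact: K1].
- exact: sqi_sq.
- move=> s _; rewrite exprMn ler_piMl ?sqr_ge0// -[K _ ^+ 2]real_normK ?num_real//.
  by rewrite exprn_ile1.
Qed.

End measurability_Kint.

Section square_Kint.
Context {d2} {S : measurableType d2} (m2 : {finite_measure set S -> \bar R}).
Local Notation Q := (fprodm lam m2).
Implicit Types f g : A * S -> R.

Let integral_sq f : sqi Q f ->
  (\int[Q]_p ((f p) ^+ 2)%:E = \int[m2]_w \int[lam]_s ((f (s, w)) ^+ 2)%:E)%E.
Proof.
move=> [mf _]; rewrite /fprodm (fubini_tonelli2 (fun p => ((f p) ^+ 2)%:E))//.
  by apply/measurable_EFinP; exact: measurable_funX.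
by move=> p; rewrite lee_fin sqr_ge0.
Qed.

(** Cauchy-Schwarz on almost every path, then integration. The bound holds at every [t] and not just
    almost every [t], which gives a meaning to the operator at the terminal time and at each fixed
    time of an adaptedness statement. *)
Lemma sq_Kint_le f t : sqi Q f ->
  (\int[m2]_w ((Kint K f (t, w)) ^+ 2)%:E <= lam setT * \int[Q]_p ((f p) ^+ 2)%:E)%E.
Proof.
move=> f2; have [mf _] := f2; rewrite integral_sq// -ge0_integralZl//; last 2 first.
- apply: (measurable_fun_fubini_tonelli_G (m1 := lam) (fun p => ((f p) ^+ 2)%:E)).
    by apply/measurable_EFinP; exact: measurable_funX.
  by move=> p; rewrite lee_fin sqr_ge0.
- by move=> w _; apply: integral_ge0 => s _; rewrite lee_fin sqr_ge0.
have [N [mN N0 hN]] := ae_sqi2 f2.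
apply: (le_integral_ae mN N0) => w Nw.
have fw : sqi lam (fun s => f (s, w)) by apply: contrapT => h; apply: Nw; exact: hN.
rewrite -EFin_Rintegral; last exact: sqi_sq.
by rewrite -[lam setT]fineK ?fin_num_measure// -EFinM lee_fin; exact: Kint_sq_le.
Qed.

Lemma sqi_Kint_section f t : sqi Q f -> sqi m2 (fun w => Kint K f (t, w)).
Proof.
move=> f2; have [mf _] := f2; split.
  by apply: measurable_section1; exact: measurable_Kint.
apply: le_lt_trans (sq_Kint_le t f2) _; apply: lte_mul_pinfty => //.
  by rewrite fin_num_measure.
by case: f2.
Qed.

Lemma sqi_Kint f : sqi Q f -> sqi Q (Kint K f).
Proof.
move=> f2; have [mf _] := f2; split; first exact: measurable_Kint.
rewrite /fprodm fubini_tonelli1//; last 2 first.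
- by apply/measurable_EFinP; apply: measurable_funX; exact: measurable_Kint.
- by move=> p; rewrite lee_fin sqr_ge0.
have fin : (\int[Q]_p ((f p) ^+ 2)%:E)%E \is a fin_num.
  by rewrite ge0_fin_numE; [case: f2|apply: integral_ge0 => p _; rewrite lee_fin sqr_ge0].
apply: (@le_lt_trans _ _ (\int[lam]_t (lam setT * \int[Q]_p ((f p) ^+ 2)%:E))%E).
  apply: (le_integral_ae measurable0 (measure0 lam)) => t _; exact: sq_Kint_le.
rewrite -[X in (lam _ * X)%E]fineK// -[lam setT]fineK ?fin_num_measure// -EFinM.
exact: (integrable_lty _ (intg_cst lam _)).
Qed.

Lemma Kint_ae0 f t : sqi Q f -> {ae Q, forall p, f p = 0} ->
  {ae m2, forall w, Kint K f (t, w) = 0}.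
Proof.
move=> f2 f0; have [mf _] := f2.
have k2 := sqi_Kint_section t f2.
have : \int[m2]_w ((Kint K f (t, w)) ^+ 2) = 0.
  apply/eqP; rewrite eq_le Rintegral_sq_ge0 andbT -lee_fin EFin_Rintegral; last exact: sqi_sq.
  apply: le_trans (sq_Kint_le t f2) _.
  rewrite [X in (_ * X)%E](_ : _ = 0%E) ?mule0//.
  rewrite -(integral0 Q setT); apply: ae_eq_integral => //.
    by apply/measurable_EFinP; exact: measurable_funX.
  by apply: filterS f0 => p -> _; rewrite expr0n.
move/(Rintegral_cvg0_ge0 (sqi_sq k2) (fun=> sqr_ge0 _)).
by apply: filterS => w /eqP; rewrite sqrf_eq0 => /eqP.
Qed.

Lemma KintB f g : sqi Q f -> sqi Q g ->
  {ae m2, forall w, forall t, Kint K (fun p => f p - g p) (t, w) = Kint K f (t, w) - Kint K g (t, w)}.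
Proof.
move=> /ae_sqi2 f2 /ae_sqi2 g2; apply: filterS2 f2 g2 => w fw gw t.
rewrite /Kint /= -RintegralB//; [|exact: intg_Kpath..].
by apply: eq_Rintegral => s _; rewrite mulrBr.
Qed.

End square_Kint.
End kernel_integral.

Section kernel_transpose.
Context {d1 d2} {A : measurableType d1} {S : measurableType d2} {R : realType}.
Variables (lam : {finite_measure set A -> \bar R}) (m2 : {finite_measure set S -> \bar R}).
Variable K : A * A -> R.
Hypotheses (mK : measurable_fun setT K) (K1 : forall p, `|K p| <= 1).
Local Notation Q := (fprodm lam m2).

Definition swapK (p : A * A) := K (p.2, p.1).

Lemma measurable_swapK : measurable_fun setT swapK.
Proof.
by apply: measurable_pair_comp.
Qed.

(** Fubini in the two time variables, on almost every path. It takes the place of integration by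
    parts between a state deviation, which is a time integral, and the drift of the costate. *)
Lemma Kint_transpose (f g : A * S -> R) : sqi Q f -> sqi Q g ->
  \int[Q]_p (g p * Kint lam K f p) = \int[Q]_p (f p * Kint lam swapK g p).
Proof.
move=> f2 g2; have [mf _] := f2; have [mg _] := g2.
have K1' p : `|swapK p| <= 1 by exact: K1.
have i1 : intg Q (fun p => g p * Kint lam K f p) by apply: sqiM => //; exact: sqi_Kint.
have i2 : intg Q (fun p => f p * Kint lam swapK g p).
  by apply: sqiM => //; apply: sqi_Kint => //; exact: measurable_swapK.
rewrite (Rintegral_fprodm2 i1) (Rintegral_fprodm2 i2); apply: ae_eq_Rintegral.
- exact: (measurable_Rintegral2 lam (intg_measurable i1)).
- exact: (measurable_Rintegral2 lam (intg_measurable i2)).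
apply: filterS2 (ae_sqi2 f2) (ae_sqi2 g2) => w fw gw.
pose h (q : A * A) := K q * (g (q.1, w) * f (q.2, w)).
have gf : intg (fprodm lam lam) (fun q => g (q.1, w) * f (q.2, w)).
  by apply: sqiM; [exact: (sqi_snd _ gw)|exact: (sqi_fst _ fw)].
have hi : intg (fprodm lam lam) h.
  apply: (intg_le _ (intg_abs gf)) => [|q].
    by apply: measurable_funM => //; exact: intg_measurable gf.
  by rewrite /h [leLHS]normrM ler_piMl.
transitivity (\int[fprodm lam lam]_q h q).
  rewrite (Rintegral_fprodm1 hi); apply: eq_Rintegral => t _.
  rewrite /Kint /= -RintegralZl//; last exact: intg_Kpath.
  by apply: eq_Rintegral => s _; rewrite /h/= mulrCA.
rewrite (Rintegral_fprodm2 hi); apply: eq_Rintegral => s _.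
rewrite /Kint /= -RintegralZl//; last exact: (intg_Kpath measurable_swapK).
by apply: eq_Rintegral => t _; rewrite /h/= /swapK/=; ring.
Qed.

End kernel_transpose.

(** * Independent states *)

Section tuple_measures.
Context {d} {V : measurableType d} {R : realType} {n : nat}.

Definition tuple_box (A : 'I_n -> set V) : set (n.-tuple V) :=
  [set y | forall k, A k (tnth y k)].

Definition tuple_boxes : set (set (n.-tuple V)) :=
  [set B | exists2 A, (forall k, measurable (A k)) & B = tuple_box A].

Lemma measurable_tuple_box A : (forall k, measurable (A k)) -> measurable (tuple_box A).
Proof.
move=> mA; rewrite (_ : tuple_box A = \bigcap_(k in [set: 'I_n]) ((@tnth n V ^~ k) @^-1` A k)).
  apply: fin_bigcap_measurable => // k _.
  by rewrite -[X in measurable X]setTI; exact: measurable_tnth.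
by apply/seteqP; split=> y /= h k => [_|]; exact: (h k).
Qed.

Lemma tuple_boxes_setI : setI_closed tuple_boxes.
Proof.
move=> _ _ [A mA ->] [B mB ->]; exists (fun k => A k `&` B k).
  by move=> k; exact: measurableI.
by apply/seteqP; split=> y /= => [[h1 h2] k|h]; [split|split=> k; case: (h k)].
Qed.

Lemma tuple_boxesT : tuple_boxes setT.
Proof. by exists (fun=> setT) => //; apply/seteqP; split. Qed.

Lemma tuple_boxes_gen : @measurable _ (n.-tuple V) = <<s tuple_boxes >>.
Proof.
apply/seteqP; split; last first.
  apply: smallest_sub; first exact: sigma_algebra_measurable.
  by move=> _ [A mA ->]; exact: measurable_tuple_box.
apply: smallest_sub; first exact: smallest_sigma_algebra.
move=> B; rewrite -bigcup_seq => -[k _ [A mA <-]]; rewrite setTI.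
apply: sub_gen_smallest; exists (fun j => if j == k then A else setT).
  by move=> j; case: eqVneq.
apply/seteqP; split=> y /= h; first by move=> j; case: eqVneq => [->|].
by have := h k; rewrite eqxx.
Qed.

Lemma tuple_measure_unique (m1 m2 : probability (n.-tuple V) R) :
  (forall A, (forall k, measurable (A k)) -> m1 (tuple_box A) = m2 (tuple_box A)) ->
  forall B, measurable B -> m1 B = m2 B.
Proof.
move=> h; apply: (measure_unique tuple_boxes (fun=> setT)).
- exact: tuple_boxes_gen.
- exact: tuple_boxes_setI.
- by move=> _; exact: tuple_boxesT.
- by rewrite bigcup_const.
- by move=> _ [A mA ->]; exact: h.
- by move=> _; rewrite ltey_eq fin_num_measure.
Qed.

End tuple_measures.

Section own_independence.
Context {R : realType} {dd : measure_display} {Omega : measurableType dd}.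
Context {n d : nat} (P : probability Omega R) (T : R) (F0 : set (set Omega)).
Context (W : R -> Omega -> 'M[R]_(n, d)) (xi : Omega -> 'M[R]_(n, d)).
Hypothesis hS : setting P T F0 W xi.

Local Notation past i t := (sigma_past (component i W) t).
Local Notation own i := (own_filtration P W xi i).

(** The events of [xi^i] together with the negligible sets form a pi-system inside [F0]. Their
    intersections with events of the past of [W^i] form a pi-system generating [own i T], on which
    probabilities factor by the independence of the [xi^i] and that of [F0] and the [W^i]. *)
Lemma own_independent : independent_all P (fun i => own i T).
Proof.
pose X0 i : set (set Omega) := sigma_gen (fun w => row i (xi w)) `|` P.-negligible.
have sgen i : sigma_algebra setT (sigma_gen (fun w => row i (xi w))).
  exact: sigma_gen_sigma_algebra.
have X0F i : X0 i `<=` F0.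
  by rewrite subUset; split; [exact: (xi_F0 hS)|exact: (set_F0_complete hS)].
have X0I i : setI_closed (X0 i).
  move=> A B [xA|nA] [xB|nB]; try by [right; apply: negligibleS nB => w []|
    right; apply: negligibleS nA => w []].
  by left; exact: (sigma_algebra_setI (sgen i)).
have X0T i : X0 i setT by left; exact: sigma_algebraT.
have X0m i : X0 i `<=` measurable by exact: subset_trans (X0F i) (set_F0_measurable hS).
have pm i : past i T `<=` measurable by exact: (past_measurable hS).
have ps i : sigma_algebra setT (past i T) by exact: sigma_past_sigma.
have X0ind : independent_all P X0.
  (* Either every event comes from the initial values, or one of them is null and both sides
     vanish. *)
  move=> E XE; have [hE|] := pselect (forall i, sigma_gen (fun w => row i (xi w)) (E i)).
    exact: (independent_familyT (set_xi_independent hS)).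
  move=> /existsNP[i nEi]; have [//|nE] := XE i.
  have E0 : P (E i) = 0%E by apply/negligibleP => //; exact: X0m.
  rewrite (bigD1 i)//= E0 mul0e; apply/negligibleP.
    by apply: fin_bigcap_measurable => // j _; exact: X0m.
  by apply: negligibleS nE; exact: bigcap_inf.
pose S i := setI_system (X0 i) (past i T).
have indS : independent_all P S.
  move=> E SE; have /choice[A] : forall i, exists A, exists C, (X0 i A /\ past i T C) /\ A `&` C = E i.
    by move=> i; have [A XA [C pC <-]] := SE i; exists A, C.
  move=> /choice[C] hAC.
  have XA i : X0 i (A i) by case: (hAC i) => -[].
  have pC i : past i T (C i) by case: (hAC i) => -[].
  have EE i : A i `&` C i = E i by case: (hAC i).
  have -> : \bigcap_(i in [set: 'I_n]) E i =
      (\bigcap_(i in [set: 'I_n]) A i) `&` \bigcap_(i in [set: 'I_n]) C i.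
    by rewrite -bigcapI; apply: eq_bigcapr => i _; rewrite EE.
  have FA : F0 (\bigcap_(i in [set: 'I_n]) A i).
    have sF := set_F0_sigma hS; rewrite -(measurable_gE sF).
    by apply: fin_bigcap_measurable => // i _; rewrite (measurable_gE sF); exact: X0F.
  rewrite (F0_W_independent hS FA pC) (X0ind A XA) -big_split/=; apply: eq_bigr => i _.
  have FAi : F0 (A i) by exact: X0F.
  have pC' j : past j T (if j == i then C i else setT).
    by case: eqVneq => [->//|_]; exact: sigma_algebraT.
  have := F0_W_independent hS FAi pC'.
  rewrite (bigD1 i)//= eqxx big1 ?mule1; last first.
    by move=> j /negbTE ->; exact: probability_setT.
  rewrite -EE => <-; congr (P (_ `&` _)); apply/seteqP; split=> w /=.
    by move=> /(_ i Logic.I); rewrite eqxx.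
  by move=> h j _; case: eqVneq.
have := independent_all_gen _ _ _ indS.
move=> /(_ _ _ _)/wrap[].
- by move=> i; exact: setI_system_measurable.
- by move=> i; apply: setI_system_closed => //; exact: sigma_algebra_setI.
- by move=> i; exists setT => //; exists setT; rewrite ?setIT//; exact: sigma_algebraT.
move=> h E oE; apply: h => i; move: (E i) (oE i); apply: own_min.
- exact: smallest_sigma_algebra.
- move=> A xA; apply: sub_gen_smallest; apply: sub_setI_systeml; last by left.
  exact: sigma_algebraT.
- move=> A pA; apply: sub_gen_smallest; exact: sub_setI_systemr.
- move=> A nA; apply: sub_gen_smallest; apply: sub_setI_systeml; last by right.
  exact: sigma_algebraT.
Qed.

End own_independence.

Section borel_rows.
Context {R : realType} {d : nat}.
Local Notation V := (borelRn R d).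

Lemma measurable_borelRn_coord l : measurable_fun setT (fun v : V => (v : 'rV[R]_d) 0 l).
Proof.
apply: (measurability _ (@RGenOInfty.measurableE R)).
move=> _ [_ [x ->] <-]; rewrite setTI; apply: sub_gen_smallest.
apply: (@open_comp _ _ (fun v : 'rV[R]_d => v 0 l)) => [v _|].
  exact: coord_continuous.
exact: rray_open.
Qed.

Lemma measurable_borelRnP {dd} {S : measurableType dd} (f : S -> V) :
  measurable_fun setT f <-> forall l, measurable_fun setT (fun s => (f s : 'rV[R]_d) 0 l).
Proof.
split=> [mf l|h]; first exact: (measurableT_comp (measurable_borelRn_coord l) mf).
move=> _ B mB; rewrite setTI; apply: (@measurable_preimage_mx R 1 d _ S f B) => // i j.
by rewrite (ord1 i).
Qed.

End borel_rows.

(** * Brackets as integrals and as conditional expectations *)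

Section bracket_representation.
Context {R : realType} {dd : measure_display} {Omega : measurableType dd}.
Context {n d : nat} (P : probability Omega R).
Local Notation V := (borelRn R d).

(** Each row is evaluated at its own point of [Omega]; under the product of copies of [P] the rows
    become independent with unchanged laws. *)
Definition row_law (Xr : 'I_n -> Omega -> 'rV[R]_d) (i : 'I_n) (y : n.-1.-tuple Omega)
    : n.-1.-tuple V := [tuple (Xr (lift i k) (tnth y k) : V) | k < n.-1].

Local Notation PO := (@product_probability R _ Omega n.-1 (fun=> P)).

Lemma insert_row_lawE (Xr : 'I_n -> Omega -> 'rV[R]_d) i x y j l :
  insert_at i x (row_law Xr i y) j l =
    if unlift i j is Some k then Xr j (tnth y k) 0 l else x 0 l.
Proof.
rewrite /insert_at mxE; case: unliftP => [k ->|//].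
by rewrite /row_law tnth_mktuple.
Qed.

Lemma measurable_row_law (Xr : 'I_n -> Omega -> 'rV[R]_d) i :
  (forall j l, measurable_fun setT (fun w => Xr j w 0 l)) ->
  measurable_fun setT (row_law Xr i).
Proof.
move=> mX; apply/measurable_fun_tnthP => k; apply/measurable_borelRnP => l.
rewrite (_ : (fun s => _) = (fun w => Xr (lift i k) w 0 l) \o (fun y => tnth y k)).
  by apply: measurableT_comp => //; exact: measurable_tnth.
by apply/funext => y /=; rewrite /row_law tnth_mktuple.
Qed.

(* On the fixed space [Omega^(n-1)], time and [x] enter through the integrand
   only, so that brackets along a flow of laws are jointly measurable. *)
Lemma bracket_rep (Xr : 'I_n -> Omega -> 'rV[R]_d) (m : 'I_n -> probability V R) i
    (f : 'M[R]_(n, d) -> R) x :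
  (forall j l, measurable_fun setT (fun w => Xr j w 0 l)) ->
  (forall j (A : set V), measurable A -> m j A = pushforward P (Xr j : Omega -> V) A) ->
  continuous f ->
  intg PO (fun y => f (insert_at i x (row_law Xr i y))) ->
  intg (product_probability (fun k => m (lift i k))) (fun z => f (insert_at i x z)) /\
  bracket m i f x = \int[PO]_y f (insert_at i x (row_law Xr i y)).
Proof.
move=> mX mE cf fi.
have mrow := measurable_row_law i mX.
have mf : measurable_fun setT (fun y : n.-1.-tuple V => f (insert_at i x y)).
  apply: measurable_cont_mx => // j l; rewrite /insert_at.
  rewrite (_ : (fun t => _) = fun y : n.-1.-tuple V =>
    if unlift i j is Some k then (tnth y k : 'rV[R]_d) 0 l else x 0 l); last first.
    by apply/funext => y; rewrite mxE; case: unlift.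
  case: unlift => [k|]; last exact: measurable_cst.
  by apply: (measurableT_comp (measurable_borelRn_coord l)); exact: measurable_tnth.
pose rowM := HB.pack_for {mfun n.-1.-tuple Omega >-> n.-1.-tuple V} (row_law Xr i)
  (isMeasurableFun.Build _ _ _ _ (row_law Xr i) mrow).
have mEQ A : measurable A -> product_probability (fun k => m (lift i k)) A = distribution PO rowM A.
  move=> mA; apply: tuple_measure_unique mA => B mB.
  rewrite [LHS]product_probability_box//.
  transitivity (PO [set y | forall k, (Xr (lift i k) @^-1` B k) (tnth y k)]); last first.
    rewrite /distribution/= /pushforward; congr (PO _).
    by apply/seteqP; split=> y /= h k; have := h k; rewrite /row_law tnth_mktuple.
  have mB' k : measurable (Xr (lift i k) @^-1` B k).
    apply: (measurable_preimageT (f := Xr (lift i k) : Omega -> V)) => //.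
    by apply/measurable_borelRnP => l; exact: mX.
  rewrite (@product_probability_box R _ Omega n.-1 (fun=> P) _ mB').
  by apply: eq_bigr => k _; rewrite mE.
have fd : intg (distribution PO rowM) (fun z => f (insert_at i x z)).
  by apply: integrable_pushforward => //; exact/measurable_EFinP.
split.
  apply/integrableP; split; first exact/measurable_EFinP.
  have /integrableP[_] := fd; rewrite [X in _ -> (X < _)%E](eq_measure_integral (distribution PO rowM))// => A mA _.
  exact: mEQ.
rewrite /bracket /Rintegral (eq_measure_integral (distribution PO rowM)); last first.
  by move=> A mA _; exact: mEQ.
by rewrite integral_pushforward//; exact/measurable_EFinP.
Qed.

End bracket_representation.

Section law_of_the_others.
Context {R : realType} {dd : measure_display} {Omega : measurableType dd}.
Context {n d : nat} (P : probability Omega R) (T : R) (F0 : set (set Omega)).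
Context (W : R -> Omega -> 'M[R]_(n, d)) (xi : Omega -> 'M[R]_(n, d)).
Hypothesis hS : setting P T F0 W xi.
Local Notation V := (borelRn R d).
Local Notation own i := (own_filtration P W xi i).

Variables (Xr : 'I_n -> Omega -> 'rV[R]_d) (m : 'I_n -> probability V R) (i : 'I_n).
Hypothesis oX : forall j l,
  measurable_fun setT (fun w : g_sigma_algebraType (own j T) => Xr j w 0 l).
Hypothesis mE : forall j (A : set V), measurable A ->
  m j A = pushforward P (Xr j : Omega -> V) A.

Let own_sig j : sigma_algebra setT (own j T). Proof. exact: own_sigma. Qed.
Let own_meas j : own j T `<=` measurable. Proof. exact: (own_measurable hS). Qed.

Let Zr (w : Omega) : n.-1.-tuple V := [tuple (Xr (lift i k) w : V) | k < n.-1].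

Let XrV j (B : set V) : measurable B -> own j T (Xr j @^-1` B).
Proof.
move=> mB; rewrite -(measurable_gE (own_sig j)).
apply: (measurable_preimageT (f := Xr j : g_sigma_algebraType (own j T) -> V)) => //.
by apply/measurable_borelRnP => l; exact: oX.
Qed.

Let box_indep (A : set Omega) (B : 'I_n.-1 -> set V) : own i T A ->
  (forall k, measurable (B k)) ->
  P (A `&` Zr @^-1` tuple_box B) = (P A * \prod_k m (lift i k) (B k))%E.
Proof.
move=> oA mB.
pose E j : set Omega := if unlift i j is Some k then Xr j @^-1` B k else A.
have oE j : own j T (E j).
  by rewrite /E; case: unliftP => [k ->|->//]; exact: XrV.
have := own_independent hS oE; rewrite (bigD1_ord i)//= /E unlift_none.
under eq_bigr => k _ do rewrite liftK -[P _]/(pushforward P (Xr (lift i k) : Omega -> V) (B k)) -mE//.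
move=> <-; congr (P _); apply/seteqP; split=> w /=.
  move=> [Aw Zw] j _ /=; case: unliftP => [k ->|//].
  by have := Zw k; rewrite /Zr tnth_mktuple.
move=> h; split; first by have := h i Logic.I; rewrite /= unlift_none.
by move=> k; have := h (lift i k) Logic.I; rewrite /= liftK /Zr tnth_mktuple.
Qed.

Let mZr : measurable_fun setT Zr.
Proof.
apply/measurable_fun_tnthP => k.
rewrite (_ : _ \o _ = (Xr (lift i k) : Omega -> V)); last first.
  by apply/funext => w /=; rewrite /Zr tnth_mktuple.
apply/measurable_borelRnP => l.
by apply: (measurable_fun_sub (@own_meas (lift i k))) => //; exact: oX.
Qed.

(** Preimages of boxes form a pi-system, which gives independence from [own i T]; the case of the
    whole space then identifies the law of the other rows as a product. *)
Let rect_indep (A : set Omega) (B : set (n.-1.-tuple V)) : own i T A -> measurable B ->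
  P (A `&` Zr @^-1` B) = (P A * product_probability (fun k => m (lift i k)) B)%E.
Proof.
move=> oA mB.
pose S : set (set Omega) := [set Zr @^-1` C | C in tuple_boxes].
have SM : S `<=` measurable.
  move=> _ [_ [C mC ->] <-]; apply: measurable_preimageT; first exact: mZr.
  exact: measurable_tuple_box.
have SI : setI_closed S.
  move=> _ _ [C1 b1 <-] [C2 b2 <-]; exists (C1 `&` C2) => //; exact: tuple_boxes_setI.
have indS : independent2 P (own i T) S.
  move=> a _ oa [_ [C mC ->] <-]; rewrite box_indep//.
  have := @box_indep setT C (sigma_algebraT (own_sig i)) mC.
  by rewrite setTI probability_setT mul1e => ->.
have mZS : measurable_fun setT (Zr : g_sigma_algebraType S -> _).
  apply/measurable_fun_tnthP => k.
  move=> _ C mC; rewrite setTI; apply: sub_gen_smallest.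
  exists (tuple_box (fun j => if j == k then C else setT)).
    by exists (fun j => if j == k then C else setT) => // j; case: eqVneq.
  apply/seteqP; split=> w /= h; first by have := h k; rewrite eqxx.
  by move=> j; case: eqVneq => [->|].
have SB : <<s S >> (Zr @^-1` B) by have := mZS measurableT B mB; rewrite setTI.
have := independent2_gen (@own_meas i) SM SI indS oA SB.
move=> ->; congr (_ * _)%E.
pose ZM := HB.pack_for {mfun Omega >-> n.-1.-tuple V} Zr
  (isMeasurableFun.Build _ _ _ _ Zr mZr).
apply: (@tuple_measure_unique _ V R n.-1 (distribution P ZM)) => // C mC.
rewrite [RHS]product_probability_box//.
have := @box_indep setT C (sigma_algebraT (own_sig i)) mC.
by rewrite setTI probability_setT mul1e.
Qed.

(** By [rect_indep], the history of [(xi^i, W^i)] and the other rows have a product as joint law, so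
    the other rows can be integrated out with the history frozen. *)
Lemma own_bracket (phi : Omega -> R) (g : 'M[R]_(n, d) -> R) :
  measurable_fun setT (phi : g_sigma_algebraType (own i T) -> R) -> continuous g ->
  (forall x, intg (product_probability (fun k => m (lift i k))) (fun z => g (insert_at i x z))) ->
  intg P (fun w => phi w * g (\matrix_j Xr j w)) ->
  intg P (fun w => phi w * bracket m i g (Xr i w)) ->
  \int[P]_w (phi w * g (\matrix_j Xr j w)) = \int[P]_w (phi w * bracket m i g (Xr i w)).
Proof.
move=> mphi cg gi i1 i2.
pose Og := g_sigma_algebraType (own i T).
pose m2 := product_probability (fun k => m (lift i k)).
have mid : measurable_fun setT (id : Omega -> Og).
  by exact: (measurable_id_sub (@own_meas i) (own_sig i)).
pose idM := HB.pack_for {mfun Omega >-> Og} (id : Omega -> Og)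
  (isMeasurableFun.Build _ _ _ _ (id : Omega -> Og) mid).
pose pr (w : Omega) : Og * n.-1.-tuple V := (w, Zr w).
have mpr : measurable_fun setT pr by exact: (measurable_fun_pair mid mZr).
pose prM := HB.pack_for {mfun Omega >-> (Og * n.-1.-tuple V)%type} pr
  (isMeasurableFun.Build _ _ _ _ pr mpr).
pose m1 := image_measure P idM.
pose f (p : Og * n.-1.-tuple V) := phi p.1 * g (insert_at i (Xr i p.1) p.2).
have mins : measurable_fun setT (fun p : Og * n.-1.-tuple V => g (insert_at i (Xr i p.1) p.2)).
  apply: measurable_cont_mx => // j l; rewrite /insert_at.
  rewrite (_ : (fun t => _) = fun p : Og * n.-1.-tuple V =>
    if unlift i j is Some k then (tnth p.2 k : 'rV[R]_d) 0 l else Xr i p.1 0 l); last first.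
    by apply/funext => y; rewrite mxE; case: unlift.
  case: unlift => [k|].
    apply: (measurableT_comp (measurable_borelRn_coord l)).
    by apply: (measurableT_comp (@measurable_tnth _ _ _ k)).
  exact: (measurableT_comp (@oX i l)).
have mf : measurable_fun setT f.
  by apply: measurable_funM => //; apply: (measurableT_comp (f := phi : Og -> R)).
have fE w : f (pr w) = phi w * g (\matrix_j Xr j w).
  rewrite /f /pr /=; congr (_ * g _); apply/matrixP => j l; rewrite !mxE.
  by case: unliftP => [k ->|->//]; rewrite /Zr tnth_mktuple.
have fP : intg P (f \o pr).
  rewrite (_ : f \o pr = fun w => phi w * g (\matrix_j Xr j w))//.
  by apply/funext => w; exact: fE.
have mEQ X : measurable X -> fprodm m1 m2 X = image_measure P prM X.
  move=> mX; apply: product_measure_unique mX => A B mA mB.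
  by rewrite /image_measure /pushforward /= -rect_indep//; rewrite -(measurable_gE (own_sig i)).
have fim : intg (image_measure P prM) f.
  by apply: integrable_pushforward => //; exact/measurable_EFinP.
have fQ : intg (fprodm m1 m2) f.
  apply/integrableP; split; first exact/measurable_EFinP.
  have /integrableP[_] := fim; rewrite (eq_measure_integral (fprodm m1 m2))// => X mX _.
  exact/esym/mEQ.
have mb : measurable_fun setT (fun w : Og => bracket m i g (Xr i w)).
  exact: (measurable_Rintegral1 m2 mins).
have -> : \int[P]_w (phi w * g (\matrix_j Xr j w)) = \int[fprodm m1 m2]_p f p.
  rewrite /Rintegral; congr fine.
  rewrite (eq_measure_integral (image_measure P prM)); last by move=> X mX _; exact: mEQ.
  rewrite integral_pushforward//; last exact/measurable_EFinP.
  by apply: eq_integral => w _; rewrite /= fE.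
rewrite Rintegral_fprodm1//.
under eq_Rintegral => w _ do rewrite /f /= RintegralZl//.
rewrite /Rintegral; congr fine; rewrite integral_pushforward//.
by apply/measurable_EFinP; apply: measurable_funM.
Qed.
End law_of_the_others.

(** * Stochastic integrals *)

(** One term within distance 1 suffices: the limit is this term minus a square-integrable
    difference. *)
Lemma sqi_cvg {d} {T : measurableType d} {R : realType} (mu : {measure set T -> \bar R})
    (fn : nat -> T -> R) (f : T -> R) :
  (forall m, sqi mu (fn m)) -> measurable_fun setT f ->
  (\int[mu]_x ((fn m x - f x) ^+ 2)%:E @[m --> \oo] --> 0)%E -> sqi mu f.
Proof.
move=> fni mf h.
have [m _ /(_ m (leqnn m)) hm] : \forall m \near \oo, (\int[mu]_x ((fn m x - f x) ^+ 2)%:E < 1)%E.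
  have /= hh := h [set y | (y < 1)%E]; apply: hh; apply: open_ereal_lt'.
  exact: lte01.
have : sqi mu (fun x => fn m x - f x).
  split; first by apply: measurable_funB => //; case: (fni m).
  by apply: lt_trans hm _; rewrite ltry.
by move=> h2; apply: (sqi_le mf (sqiB (fni m) h2)) => x; rewrite subKr.
Qed.

Section time_measure.
Context {R : realType}.
Variable T : R.

Let mI : measurable (`[0, T]%classic : set (measurableTypeR R)).
Proof. exact: measurable_itv. Qed.

Let Ioo : (@lebesgue_measure R `[0%R, T]%classic < +oo)%E.
Proof. by rewrite lebesgue_measure_itv/=; case: ifP => // _; rewrite ltry. Qed.

Definition time_measure : {finite_measure set (measurableTypeR R) -> \bar R} :=
  mfrestr mI Ioo.

Lemma ae_time (Q : R -> Prop) : (forall t, t \in `[0, T] -> Q t) ->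
  {ae time_measure, forall t : measurableTypeR R, Q t}.
Proof.
move=> h; exists (~` `[0, T]%classic); split; first exact: measurableC.
  by rewrite /time_measure /= /mfrestr /mrestr setICl measure0.
by move=> t /= nQ tI; apply: nQ; exact: h.
Qed.

#[global] Instance time_measure_filter : Filter (almost_everywhere time_measure).
Proof. exact: (ae_filter_ringOfSetsType time_measure). Qed.

Lemma ae_time2 (Q Q' : measurableTypeR R -> Prop) :
  {ae time_measure, forall t, Q t} ->
  (forall t : R, t \in `[0, T] -> Q t -> Q' t) ->
  {ae time_measure, forall t, Q' t}.
Proof.
by move=> h QQ'; apply: (filterS2 _ _ (@ae_time (fun t => t \in `[0, T]) (fun=> id)) h) => t; exact: QQ'.
Qed.

Lemma integral_time_measure (f : R -> \bar R) :
  (\int[time_measure]_t f t = \int[@lebesgue_measure R]_(t in `[0%R, T]) f t)%E.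
Proof.
have mC : measurable (~` `[0, T]%classic : set (measurableTypeR R)) by exact: measurableC.
have C0 : time_measure (~` `[0, T]%classic) = 0%E.
  by rewrite /time_measure /= /mfrestr /mrestr setICl measure0.
transitivity (\int[time_measure]_(t in `[0%R, T]) f t)%E.
  rewrite [RHS]integral_mkcond; apply/le_anti/andP; split; apply: (le_integral_ae mC C0) => t /contrapT tI.
    by rewrite patchE mem_set.
  by rewrite patchE mem_set.
by apply: eq_measure_integral => A mA AI; rewrite /time_measure /= /mfrestr /mrestr setIidl.
Qed.

End time_measure.

Lemma sqi_time_bound {R : realType} {dd} {Omega : measurableType dd} (P : probability Omega R)
    (T C : R) (f : measurableTypeR R * Omega -> R) : measurable_fun setT f ->
  (forall t : R, t \in `[0, T] -> (\int[P]_w ((f (t, w)) ^+ 2)%:E <= C%:E)%E) ->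
  sqi (fprodm (time_measure T) P) f.
Proof.
move=> mf h; have mf2 : measurable_fun setT (fun p => f p ^+ 2) by exact: measurable_funX.
apply: intg_sqi => //; apply/(integrable12ltyP (time_measure T) P) => /=; first exact/measurable_EFinP.
pose lam := time_measure T.
apply: (@le_lt_trans _ _ (\int[lam]_t (C%:E))%E).
  have mC : measurable (~` `[0, T]%classic : set (measurableTypeR R)) by exact: measurableC.
  have C0 : time_measure T (~` `[0, T]%classic) = 0%E.
    by rewrite /time_measure /= /mfrestr /mrestr setICl measure0.
  apply: (le_integral_ae mC C0) => t /contrapT tI.
  apply: le_trans (h t tI); under eq_integral => w _ do rewrite ger0_norm ?sqr_ge0//.
  by [].
rewrite integral_cst// ltey_eq fin_numM// fin_num_measure//.
Qed.

Section normal_symmetry.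
Context {R : realType}.

Lemma normal_prob_opp (s : R) (A : set (measurableTypeR R)) : s != 0 -> measurable A ->
  normal_prob 0 s (-%R @^-1` A) = normal_prob 0 s A.
Proof.
move=> s0 mA; rewrite /normal_prob.
transitivity (\int[pushforward lebesgue_measure (-%R : _ -> measurableTypeR R)]_(x in A)
  (normal_pdf 0 s x)%:E)%E; last first.
  by apply: eq_measure_integral => B mB _; exact: lebesgue_measureN.
rewrite ge0_integral_pushforward.
- apply: eq_integral => x _ /=; rewrite /normal_pdf (negbTE s0) /normal_fun.
  by rewrite !subr0 sqrrN.
- exact: oppr_measurable.
- exact: mA.
- by apply/measurable_EFinP/measurable_funTS; exact: measurable_normal_pdf.
- by move=> x _; rewrite lee_fin normal_pdf_ge0.
Qed.

(** [D] and [- D] have the same law, the density being even; the mean then equals its opposite. *)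
Lemma normal_mean0 {dd} {Omega : measurableType dd} (P : probability Omega R)
    (D : Omega -> R) (s : R) : s != 0 -> intg P D ->
  (forall A : set (measurableTypeR R), measurable A -> P (D @^-1` A) = normal_prob 0 s A) -> \int[P]_w D w = 0.
Proof.
move=> s0 Di DE; have mD := intg_measurable Di.
have mN : measurable_fun setT (fun w => - D w) by exact: measurableT_comp.
pose DM := HB.pack_for {mfun Omega >-> measurableTypeR R} D
  (isMeasurableFun.Build _ _ _ (measurableTypeR R) D mD).
pose NM := HB.pack_for {mfun Omega >-> measurableTypeR R} (fun w => - D w)
  (isMeasurableFun.Build _ _ _ (measurableTypeR R) (fun w => - D w) mN).
have push (M : {mfun Omega >-> measurableTypeR R}) : intg P (M : Omega -> R) ->
    (\int[image_measure P M]_x (x%:E : \bar R) = \int[P]_w (M w : R)%:E)%E.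
  by move=> Mi; rewrite integral_pushforward//; exact/measurable_EFinP.
have Ni : intg P (fun w => - D w).
  by have := intgZ (-1) Di; apply: eq_integrable => // x _ /=; rewrite mulN1r.
have h : (\int[P]_w (D w)%:E = \int[P]_w (- D w)%:E)%E.
  rewrite -(push DM Di) -(push NM Ni).
  apply: eq_measure_integral => A mA _; rewrite /image_measure /pushforward /=.
  rewrite DE// -(normal_prob_opp s0 mA) -DE//.
  by rewrite -[X in measurable X]setTI; exact: oppr_measurable.
have : \int[P]_w D w = - \int[P]_w D w.
  rewrite {1}/Rintegral h -[- _]mul1r mulrN -mulNr -RintegralZl//.
  by apply: congr1; apply: eq_integral => w _; rewrite mulN1r.
by move=> e; apply/eqP; rewrite -[_ == 0](mulrn_eq0 _ 2) mulr2n {1}e addNr.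
Qed.

End normal_symmetry.

Section martingale.
Context {R : realType} {dd : measure_display} {Omega : measurableType dd}.
Context {n d : nat} (P : probability Omega R) (T : R) (F0 : set (set Omega)).
Context (W : R -> Omega -> 'M[R]_(n, d)) (xi : Omega -> 'M[R]_(n, d)).
Hypothesis hS : setting P T F0 W xi.
Hypothesis W2 : forall (t : R) i l, t \in `[0, T] -> sqi P (fun w => W t w i l).

Local Notation full := (full_filtration P F0 W).
Local Notation B i l := (fun t w => component i W t w 0 l).

Lemma brownian_mean0 i l (s u : R) : 0 <= s -> s < u -> u <= T ->
  \int[P]_w (W u w i l - W s w i l) = 0.
Proof.
move=> s0 su uT.
have us : 0 < Num.sqrt (u - s) by rewrite sqrtr_gt0 subr_gt0.
have uI : u \in `[0, T] by rewrite in_itv/= uT (le_trans s0 (ltW su)).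
have sI : s \in `[0, T] by rewrite in_itv/= s0 (le_trans (ltW su) uT).
apply: (@normal_mean0 _ _ _ P _ (Num.sqrt (u - s))); first by rewrite gt_eqF.
  by apply: sqi_intg; apply: sqiB; exact: W2.
move=> A mA; have mA' k : measurable (if k == l then A else setT) by case: eqVneq.
have := bm_gaussian (set_W_bm hS i) s0 su uT mA'.
rewrite (bigD1 l)//= eqxx big1 ?mule1; last first.
  by move=> k /negbTE ->; exact: probability_setT.
move=> <-; congr (P _); apply/seteqP; split=> w /=.
  by move=> h k; case: eqVneq => // ->; rewrite !mxE.
by move=> /(_ l); rewrite eqxx !mxE.
Qed.

Lemma increment_orth i l (r u : R) (phi : Omega -> R) : 0 <= r -> r <= u -> u <= T ->
  measurable_fun setT (phi : g_sigma_algebraType (full r) -> R) ->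
  intg P (fun w => phi w * (W u w i l - W r w i l)) ->
  \int[P]_w (phi w * (W u w i l - W r w i l)) = 0.
Proof.
move=> r0; rewrite le_eqVlt => /predU1P[<- _ _ _|ru uT mphi i1].
  by under eq_Rintegral do rewrite subrr mulr0; rewrite /Rintegral integral0.
have uI : u \in `[0, T] by rewrite in_itv/= uT (le_trans r0 (ltW ru)).
have rI : r \in `[0, T] by rewrite in_itv/= r0 (le_trans (ltW ru) uT).
pose G := sigma_gen (fun w => component i W u w - component i W r w).
have sG : sigma_algebra setT G by exact: sigma_gen_sigma_algebra.
have sF : sigma_algebra setT (full r) by exact: full_sigma.
have GM : G `<=` measurable.
  apply: sigma_gen_sub; apply: (measurable_wrtB (sigma_algebra_measurable Omega));
    by apply: (W_component_measurable hS); rewrite ?(itvP uI) ?(itvP rI).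
apply: (@indep_mean0 _ _ _ P (full r) G) => //.
- by apply: (full_measurable hS); rewrite (itvP rI).
- exact: (full_increment_independent hS).
- have : measurable_wrt G (fun w => component i W u w - component i W r w) by [].
  move=> /(measurable_wrt_mxP sG)/(_ 0 l).
  by apply: eq_measurable_fun => w _; rewrite !mxE.
- by apply: sqi_intg; apply: sqiB; exact: W2.
- exact: brownian_mean0.
Qed.

Section simple.
Variables (S : @simple_process R dd Omega) (Swf : simple_wf T full S).

Lemma simple_coef_measurable j : (j < sp_size S)%N ->
  measurable_fun setT (sp_coef S j : g_sigma_algebraType (full (sp_time S j)) -> R).
Proof.
move=> jS; have [_ _ h _] := Swf.
have := h j jS; move=> h1.
by apply: (measurable_wrt_cont (h := id) _ _ h1) => [|x]; [exact: full_sigma|exact: cvg_id].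
Qed.

(** For [tau <= T] one has b(min(tau, T)) - b(min(tau, s)) = b(max(tau, s)) - b(s). All increments
    now start at [s] or later, so a factor known at [s] can be joined to the coefficients. *)
Lemma simple_incrementE (b : R -> Omega -> R) s w : s \in `[0, T] ->
  simple_integral S b T w - simple_integral S b s w =
  \sum_(j < sp_size S) sp_coef S j w *
    (b (Num.max (sp_time S j.+1) s) w - b (Num.max (sp_time S j) s) w).
Proof.
move=> sI; have [h _ _ _] := Swf.
rewrite /simple_integral -sumrB; apply: eq_bigr => j _; rewrite -mulrBr; congr (_ * _).
have step (k : nat) : (k <= sp_size S)%N ->
  b (Num.min (sp_time S k) T) w - b (Num.min (sp_time S k) s) w =
  b (Num.max (sp_time S k) s) w - b s w.
  move=> kS; have kT : sp_time S k <= T by have := h k kS; rewrite in_itv/= => /andP[].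
  rewrite (min_l kT); case: (leP (sp_time S k) s) => ks; last by [].
  by rewrite !subrr.
have h1 := step j.+1 (ltn_ord j); have h2 := step j (ltnW (ltn_ord j)).
rewrite [LHS](_ : _ = (b (Num.min (sp_time S j.+1) T) w - b (Num.min (sp_time S j.+1) s) w) -
  (b (Num.min (sp_time S j) T) w - b (Num.min (sp_time S j) s) w)); last by ring.
by rewrite h1 h2; ring.
Qed.

Lemma simple_time_max j s : (j < sp_size S)%N -> s \in `[0, T] ->
  [/\ 0 <= Num.max (sp_time S j) s,
      Num.max (sp_time S j) s <= Num.max (sp_time S j.+1) s &
      Num.max (sp_time S j.+1) s <= T].
Proof.
move=> jS sI; have [h hle _ _] := Swf; split.
- by rewrite le_max (itvP sI) orbT.
- by rewrite ge_max le_max hle//= le_max lexx orbT.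
- by rewrite ge_max (itvP sI) andbT; have := h j.+1 jS; rewrite in_itv/= => /andP[].
Qed.

Lemma sqi_simple i l s : s \in `[0, T] -> sqi P (simple_integral S (B i l) s).
Proof.
move=> sI; have [h _ _ hb] := Swf.
have W2' (k : nat) : (k <= sp_size S)%N ->
    sqi P (fun w => component i W (Num.min (sp_time S k) s) w 0 l).
  move=> kS; have kI := h k kS.
  rewrite (_ : (fun w => _) = fun w => W (Num.min (sp_time S k) s) w i l); last first.
    by apply/funext => w; rewrite mxE.
  apply: W2; rewrite in_itv/= le_min ge_min.
  by move: kI sI; rewrite !in_itv/= => /andP[-> ->] /andP[-> _].
apply: sqi_sum => j.
have [k hk] := hb j (ltn_ord j).
apply: (sqi_bnd (k := k)) => //.
  by apply: sqiB; apply: W2' => //; exact: ltnW.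
have := simple_coef_measurable (ltn_ord j); apply: measurable_fun_sub.
  by apply: (full_measurable hS); have := h j (ltnW (ltn_ord j)); rewrite in_itv/= => /andP[].
exact: full_sigma.
Qed.

Lemma simple_orth i l s (phi : Omega -> R) : s \in `[0, T] ->
  measurable_fun setT (phi : g_sigma_algebraType (full s) -> R) -> sqi P phi ->
  \int[P]_w (phi w * (simple_integral S (B i l) T w - simple_integral S (B i l) s w)) = 0.
Proof.
move=> sI mphi phi2; have [h _ _ hb] := Swf.
under eq_Rintegral => w _ do rewrite simple_incrementE// mulr_sumr.
have term (j : 'I_(sp_size S)) : intg P (fun w => phi w * (sp_coef S j w *
    (component i W (Num.max (sp_time S j.+1) s) w 0 l -
     component i W (Num.max (sp_time S j) s) w 0 l))) /\
  \int[P]_w (phi w * (sp_coef S j w *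
    (component i W (Num.max (sp_time S j.+1) s) w 0 l -
     component i W (Num.max (sp_time S j) s) w 0 l))) = 0.
  have [k hk] := hb j (ltn_ord j).
  have [m0 mm mT] := simple_time_max (ltn_ord j) sI.
  set r := Num.max (sp_time S j) s in m0 mm *; set u := Num.max (sp_time S j.+1) s in mm mT *.
  have mc : measurable_fun setT (sp_coef S j : g_sigma_algebraType (full r) -> R).
    apply: (measurable_fun_subG _ _ _ (simple_coef_measurable (ltn_ord j))).
    - exact: full_sigma.
    - exact: full_sigma.
    - have rr : sp_time S j <= r by rewrite /r le_max lexx.
      exact: (full_mono hS rr).
  have mp : measurable_fun setT (phi : g_sigma_algebraType (full r) -> R).
    apply: (measurable_fun_subG _ _ _ mphi).
    - exact: full_sigma.
    - exact: full_sigma.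
    - have rr : s <= r by rewrite /r le_max lexx orbT.
      exact: (full_mono hS rr).
  have rT : r <= T by exact: le_trans mT.
  have uI : u \in `[0, T] by rewrite in_itv/= mT (le_trans m0 mm).
  have rI : r \in `[0, T] by rewrite in_itv/= m0.
  have mcO : measurable_fun setT (sp_coef S j).
    by apply: (measurable_fun_sub _ _ mc); [exact: (full_measurable hS)|exact: full_sigma].
  have i1 : intg P (fun w => (sp_coef S j w * phi w) * (W u w i l - W r w i l)).
    apply: sqiM; first exact: (sqi_bnd phi2 mcO hk).
    by apply: sqiB; exact: W2.
  have fE w : phi w * (sp_coef S j w * (component i W u w 0 l - component i W r w 0 l)) =
      (sp_coef S j w * phi w) * (W u w i l - W r w i l) by rewrite !mxE; ring.
  split; first by apply: eq_integrable i1 => // w _ /=; rewrite fE.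
  under eq_Rintegral => w _ do rewrite fE.
  apply: increment_orth => //.
  exact: (measurable_funM mc mp).
rewrite Rintegral_sum; first by apply: big1 => j _; have [] := term j.
by move=> j; have [] := term j.
Qed.

End simple.

Lemma ito_sqi i l K N t : ito_integral P T full K (B i l) N -> t \in `[0, T] -> sqi P (N t).
Proof.
move=> [_ aN _ [S [Swf _ SN]]] tI.
have fs : sigma_algebra setT (full t) by exact: full_sigma.
have mN : measurable_fun setT (N t).
  apply: (measurable_fun_sub _ fs).
    by apply: (full_measurable hS); rewrite (itvP tI).
  by apply: (measurable_wrt_cont (h := id) fs _ (aN t tI)) => x; exact: cvg_id.
apply: (sqi_cvg (fun m => sqi_simple (Swf m) i l tI)) => //; exact: SN.
Qed.

Lemma ito_orth i l K N s (phi : Omega -> R) :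
  ito_integral P T full K (B i l) N -> s \in `[0, T] ->
  measurable_fun setT (phi : g_sigma_algebraType (full s) -> R) -> sqi P phi ->
  \int[P]_w (phi w * (N T w - N s w)) = 0.
Proof.
move=> hN sI mphi phi2; have [_ aN _ [S [Swf _ SN]]] := hN.
have TI : T \in `[0, T] by move: sI; rewrite !in_itv/= lexx andbT => /andP[s0]; exact: le_trans.
have lim t : t \in `[0, T] -> \int[P]_w (simple_integral (S m) (B i l) t w * phi w)
    @[m --> \oo] --> \int[P]_w (N t w * phi w).
  move=> tI; apply: sqiM_cvg => //; last exact: SN.
    by move=> m; exact: sqi_simple.
  exact: (ito_sqi hN).
have := cvgB (lim T TI) (lim s sI) _.
rewrite [X in _ -> X @ _ --> _](_ : _ = fun=> 0) => [/(_ _)/cvg_lim|]; last first.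
  apply/funext => m; rewrite /= -[LHS]/(_ - _) -RintegralB//.
  - rewrite -[RHS](simple_orth (Swf m) i l sI mphi phi2).
    by apply: eq_Rintegral => w _; rewrite -mulrBl mulrC.
  - by apply: sqiM => //; exact: sqi_simple.
  - by apply: sqiM => //; exact: sqi_simple.
move=> /(_ (@Rhausdorff R)); rewrite lim_cst// -RintegralB//.
- by move=> e; rewrite [RHS]e; apply: eq_Rintegral => w _; rewrite -mulrBl mulrC.
- by apply: sqiM => //; exact: (ito_sqi hN).
- by apply: sqiM => //; exact: (ito_sqi hN).
Qed.
End martingale.

Lemma continuous_within_clip {R : realType} {V : topologicalType} (T : R) (f : R -> V) : 0 <= T ->
  {within `[0, T], continuous f} -> continuous (fun t => f (clip T t)).
Proof.
move=> T0 /subspace_continuousP cf t.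
have tI : `[0, T]%classic (clip T t) by exact: clip_itv.
apply: (@cvg_comp _ _ _ (clip T) f _ (within `[0, T]%classic (nbhs (clip T t)))); last exact: cf.
move=> U /= wU; have /= := @continuous_clip R T t _ wU.
by apply: (@filterS _ (nbhs t)) => s /=; apply; exact: clip_itv.
Qed.

Lemma measurable_timeE {R : realType} {dd} {S : measurableType dd} (f : R * S -> R) :
  measurable_fun setT f -> measurable_fun setT (f : measurableTypeR R * S -> R).
Proof. by []. Qed.

Lemma intg_Rintegral1 {d1 d2} {A : measurableType d1} {S : measurableType d2} {R : realType}
    (m1 : {finite_measure set A -> \bar R}) (m2 : {finite_measure set S -> \bar R})
    (f : A * S -> R) : intg (fprodm m1 m2) f -> intg m1 (fun t => \int[m2]_w f (t, w)).
Proof.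
move=> fi; have := integrable_fubini_F fi; apply: le_integrable => //.
  by apply/measurable_EFinP; apply: measurable_Rintegral1; exact: intg_measurable fi.
move=> t _; rewrite /fubini_F /=; rewrite /Rintegral.
by case: (integral _ _ _) => [r||]; rewrite ?normr0 /= ?lexx ?leey// leey.
Qed.

(** * Stochastic integrals and projection on the history of one index *)

Section projection.
Context {R : realType} {dd : measure_display} {Omega : measurableType dd}.
Context {n d : nat} (P : probability Omega R) (T : R) (F0 : set (set Omega)).
Context (W : R -> Omega -> 'M[R]_(n, d)) (xi : Omega -> 'M[R]_(n, d)).
Hypothesis hS : setting P T F0 W xi.
Local Notation lam := (time_measure T).
Local Notation Q := (fprodm lam P).
Local Notation TR := (measurableTypeR R).
Local Notation RO := (TR * Omega)%type.
Hypothesis W2 : forall (t : R) i l, t \in `[0, T] -> sqi P (fun w => W t w i l).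
Hypothesis W2Q : forall i l, exists C : R, forall t : R, t \in `[0, T] ->
  (\int[P]_w ((W t w i l) ^+ 2)%:E <= C%:E)%E.

Local Notation full := (full_filtration P F0 W).
Local Notation own i := (own_filtration P W xi i).
Local Notation gO i := (g_sigma_algebraType (own i T)).
Local Notation B i l := (fun t w => component i W t w 0 l).

Let T0 : 0 <= T. Proof. exact: ltW (set_T hS). Qed.

(* The exceptional set belongs to the filtration, so discontinuous paths can be
   set to zero without losing adaptedness. *)
Definition bad_paths i : set Omega :=
  ~` [set w | {within `[0, T], continuous ((component i W)^~ w)}].

Definition regular_path i l (p : RO) : R :=
  \1_(~` bad_paths i) p.2 * W (clip T p.1) p.2 i l.

Lemma negligible_bad_paths i : P.-negligible (bad_paths i).
Proof. exact: bm_continuous (set_W_bm hS i). Qed.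

Lemma regular_pathE i l t w : ~ bad_paths i w ->
  regular_path i l (t, w) = W (clip T t) w i l.
Proof. by move=> h; rewrite /regular_path /= indicE mem_set ?mul1r. Qed.

Lemma measurable_regular_path i l :
  measurable_fun setT (regular_path i l : TR * gO i -> R).
Proof.
have so : sigma_algebra setT (own i T) by exact: own_sigma.
apply: measurable_timeE; apply: (@measurable_continuous_process R _ (gO i) (fun t w => regular_path i l (t, w))) => [t|w].
  apply: measurable_funM.
    apply: measurable_indicG => //; rewrite -(measurable_gE so); apply: measurableC.
    by rewrite (measurable_gE so); apply: negligible_own; exact: negligible_bad_paths.
  have /andP[c0 cT] : 0 <= clip T t <= T by have := clip_itv T0 t; rewrite in_itv.
  have /(measurable_wrt_mxP so)/(_ 0 l) := @W_own _ _ _ _ _ P W xi i (clip T t) T c0 cT.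
  by apply: eq_measurable_fun => w _; rewrite mxE.
have [bw|gw] := pselect (bad_paths i w).
  rewrite (_ : (fun t => _) = fun=> 0); first exact: cst_continuous.
  by apply/funext => t; rewrite /regular_path /= indicE memNset ?mul0r.
rewrite (_ : (fun t => _) = fun t => (fun v : 'rV[R]_d => v 0 l) (component i W (clip T t) w)).
  have cW : continuous (fun t => component i W (clip T t) w).
    by apply: (@continuous_within_clip _ _ T (fun t => component i W t w)) => //; exact: (contrapT gw).
  move=> t; apply: (@continuous_comp _ _ _ (fun t => component i W (clip T t) w)
    (fun v : 'rV[R]_d => v 0 l)); [exact: cW|exact: coord_continuous].
by apply/funext => t; rewrite regular_pathE// mxE.
Qed.

Lemma measurable_gOfun i (f : TR * gO i -> R) : measurable_fun setT f ->
  measurable_fun setT (f : RO -> R).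
Proof.
move=> mf; have mid : measurable_fun setT (id : Omega -> gO i).
  by apply: measurable_id_sub; [exact: (own_measurable hS)|exact: own_sigma].
rewrite (_ : f = fun p : RO => f (p.1, p.2 : gO i)); last by apply/funext => -[].
exact: (measurable_pair_comp mf measurable_fst (measurableT_comp mid measurable_snd)).
Qed.

Lemma sqi_regular_path_time i l (tau : R) : sqi Q (fun p : RO => regular_path i l (Num.max tau p.1, p.2)).
Proof.
have mr := (@measurable_regular_path i l); have [C hC] := W2Q i l.
have m1 : measurable_fun setT (fun p : RO => regular_path i l (Num.max tau p.1, p.2)).
  have mid : measurable_fun setT (id : Omega -> gO i).
    by apply: measurable_id_sub; [exact: (own_measurable hS)|exact: own_sigma].
  apply: (measurable_pair_comp mr (f := fun p : RO => Num.max tau p.1)).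
    by apply: measurable_maxr.
  exact: measurableT_comp mid measurable_snd.
apply: (sqi_time_bound m1 (C := C)) => t tI; apply: le_trans (hC _ (clip_itv T0 (Num.max tau t))).
apply: ge0_le_integral => //=; try by move=> w _; rewrite lee_fin sqr_ge0.
- by apply/measurable_EFinP; apply: measurable_funX; exact: (measurable_section1 t m1).
- by apply/measurable_EFinP; apply: measurable_funX; case: (W2 i l (clip_itv T0 (Num.max tau t))).
- move=> w _; rewrite lee_fin /regular_path /= exprMn indicE; case: (_ \in _).
    by rewrite expr1n mul1r.
  by rewrite expr0n mul0r sqr_ge0.
Qed.

Section projected.
Variables (i : 'I_n) (a at_ : RO -> R).
Hypotheses (a2 : sqi Q (a : RO -> R)) (at2 : sqi Q (at_ : RO -> R)).
Hypothesis mat : measurable_fun setT (at_ : TR * gO i -> R).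
Hypothesis a_full : forall s : R, s \in `[0, T] ->
  measurable_fun setT ((fun w => a (s, w)) : g_sigma_algebraType (full s) -> R).
Hypothesis proj : forall psi : RO -> R, measurable_fun setT (psi : TR * gO i -> R) ->
  intg Q (fun p : RO => psi p * (a p - at_ p)) ->
  \int[Q]_p (psi p * (a p - at_ p)) = 0.

(** [proj] holds after integration in time. Testing it with [psi] times [h], the clamp of the inner
    integral [H] to [-1, 1], gives a nonnegative [h H] of integral 0, hence [H = 0] almost
    everywhere; the clamp keeps the tested product integrable. *)
Lemma proj_section (psi : RO -> R) : measurable_fun setT (psi : TR * gO i -> R) ->
  intg Q (fun p : RO => psi p * (a p - at_ p)) ->
  {ae lam, forall s : measurableTypeR R, \int[P]_w (psi (s, w) * (a (s, w) - at_ (s, w))) = 0}.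
Proof.
move=> mpsi ipsi; have mpsiO := measurable_gOfun mpsi.
pose H (s : measurableTypeR R) := \int[P]_w (psi (s, w) * (a (s, w) - at_ (s, w))).
have mH : measurable_fun setT H.
  exact: (measurable_Rintegral1 P (intg_measurable ipsi)).
pose h s := Num.max (-1) (Num.min 1 (H s)).
have h1 s : `|h s| <= 1.
  rewrite ler_norml /h le_max lexx/= ge_max ge_min lexx andbT.
  by rewrite (le_trans (lerN10 _) ler01).
have mh : measurable_fun setT h.
  by apply: measurable_maxr => //; exact: measurable_minr.
have i2 : intg Q (fun p : RO => (psi p * h p.1) * (a p - at_ p)).
  apply: (intg_le _ (intg_abs ipsi)) => [|p].
    apply: measurable_funM; last by apply: measurable_funB; [case: a2|case: at2].
    by apply: measurable_funM => //; exact: measurableT_comp mh measurable_fst.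
  by rewrite -mulrA mulrCA [h _ * _]mulrC normrM ler_piMr.
have mpsih : measurable_fun setT ((fun p => psi p * h p.1) : TR * gO i -> R).
  by apply: measurable_funM => //; exact: (measurableT_comp mh measurable_fst).
have hE : \int[Q]_p ((psi p * h p.1) * (a p - at_ p)) = \int[lam]_s (h s * H s).
  rewrite Rintegral_fprodm1//; apply: ae_eq_Rintegral.
  - exact: (measurable_Rintegral1 P (intg_measurable i2)).
  - exact: measurable_funM.
  - apply: filterS (ae_intg1 ipsi) => s si /=.
    by rewrite -RintegralZl//; apply: eq_Rintegral => w _; rewrite mulrCA mulrA.
have hH0 s : 0 <= h s * H s.
  rewrite /h; case: (leP 0 (H s)) => H0.
    by apply: mulr_ge0 => //; rewrite le_max le_min ler01 H0 orbT.
  apply: mulr_le0; last exact: ltW.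
  by rewrite ge_max lerN10 ge_min (ltW H0) orbT.
have hHi : intg lam (fun s => h s * H s).
  apply: (intg_le _ (intg_abs (intg_Rintegral1 ipsi))) => [|s]; first exact: measurable_funM.
  by rewrite normrM ler_piMl.
have := Rintegral_cvg0_ge0 hHi hH0; rewrite -hE proj// => /(_ erefl).
apply: filterS => s /eqP; rewrite mulf_eq0 => /orP[|/eqP//].
rewrite /h -/(H s) => /eqP hs; case: (ltgtP 0 (H s)) => H0; last by [].
- have : 0 < Num.max (-1) (Num.min 1 (H s)) by rewrite lt_max lt_min ltr01 H0 orbT.
  by rewrite hs ltxx.
- have : Num.max (-1) (Num.min 1 (H s)) < 0 by rewrite gt_max ltrN10 gt_min H0 orbT.
  by rewrite hs ltxx.
Qed.

(* A coefficient can be replaced by its projection on the history of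
   [(xi^i, W^i)], by [own_markov]; then [at_ s] can be replaced by [a s], and the
   increments are centred given [full s]. *)
Lemma simple_proj l (S : @simple_process R dd Omega) : simple_wf T full S ->
  {ae lam, forall s : TR, \int[P]_w (at_ (s, w) *
    (simple_integral S (B i l) T w - simple_integral S (B i l) s w)) = 0}.
Proof.
move=> Swf; have [h _ _ hb] := Swf.
have own_sig t : sigma_algebra setT (own i t) by exact: own_sigma.
have full_sig t : sigma_algebra setT (full t) by exact: full_sigma.
pose u (j : nat) s := Num.max (sp_time S j) s.
suff term (j : 'I_(sp_size S)) : {ae lam, forall s : TR,
    intg P (fun w => at_ (s, w) * (sp_coef S j w * (B i l (u j.+1 s) w - B i l (u j s) w))) /\
    \int[P]_w (at_ (s, w) * (sp_coef S j w * (B i l (u j.+1 s) w - B i l (u j s) w))) = 0}.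
  have allj : {ae lam, forall s : TR, forall j : 'I_(sp_size S),
    intg P (fun w => at_ (s, w) * (sp_coef S j w * (B i l (u j.+1 s) w - B i l (u j s) w))) /\
    \int[P]_w (at_ (s, w) * (sp_coef S j w * (B i l (u j.+1 s) w - B i l (u j s) w))) = 0}.
    by apply: filter_forall.
  apply: (ae_time2 allj) => s sI hs.
  under eq_Rintegral => w _ do rewrite (simple_incrementE Swf)// mulr_sumr.
  rewrite Rintegral_sum; first by apply: big1 => j _; have [] := hs j.
  by move=> j; have [] := hs j.
have tI := h j (ltnW (ltn_ord j)); have [k hk] := hb j (ltn_ord j).
have /andP[t0 tT] : 0 <= sp_time S j <= T by move: tI; rewrite in_itv.
have mc := simple_coef_measurable Swf (ltn_ord j).
have mcO : measurable_fun setT (sp_coef S j).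
  by apply: (measurable_fun_sub _ _ mc) => //; exact: (full_measurable hS).
have mid : measurable_fun setT (id : Omega -> g_sigma_algebraType (own i (sp_time S j))).
  by apply: measurable_id_sub => //; exact: (own_measurable hS).
have [c [mct ck cproj]] := cond_exp_bounded P mid mcO hk.
pose ct : Omega -> R := c.
have mctO : measurable_fun setT ct.
  by apply: (measurable_fun_sub _ (own_sig _) mct); exact: (own_measurable hS).
have subT : own i (sp_time S j) `<=` own i T by exact: own_mono tT.
have mctT : measurable_fun setT (ct : gO i -> R).
  exact: (measurable_fun_subG (own_sig _) (own_sig _) subT mct).
(* The increment between the times [max(tau_j, s)] and [max(tau_{j+1}, s)] in its regularised
   version, which makes [psi] jointly measurable in [s] and the history of [(xi^i, W^i)]. *)
pose db (p : RO) := regular_path i l (Num.max (sp_time S j.+1) p.1, p.2) -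
  regular_path i l (Num.max (sp_time S j) p.1, p.2).
have mdb : measurable_fun setT (db : TR * gO i -> R).
  have mr := @measurable_regular_path i l.
  apply: measurable_funB; apply: (measurable_pair_comp mr) => //; exact: measurable_maxr.
have db2 : sqi Q db by apply: sqiB; exact: sqi_regular_path_time.
pose psi (p : RO) := ct p.2 * db p.
have mctRO : measurable_fun setT (fun p : RO => ct p.2) by exact: measurableT_comp.
have psi2 : sqi Q psi by apply: (sqi_bnd db2 mctRO) => p; exact: ck.
have mpsi : measurable_fun setT (psi : TR * gO i -> R).
  by apply: measurable_funM => //; exact: (measurableT_comp mctT measurable_snd).
have ps := proj_section mpsi (sqiM psi2 (sqiB a2 at2)).
apply: (ae_time2 (filterI (filterI (ae_sqi1 a2) (ae_sqi1 at2)) ps)) => s sI [[as2 ats2] ps0].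
have [m0 mm mT] := simple_time_max Swf (ltn_ord j) sI.
have uI : u j.+1 s \in `[0, T] by rewrite in_itv/= mT (le_trans m0 mm).
have rI : u j s \in `[0, T] by rewrite in_itv/= m0 (le_trans mm mT).
have dB2 : sqi P (fun w => W (u j.+1 s) w i l - W (u j s) w i l) by apply: sqiB; exact: W2.
have ctb w : `|ct w| <= k by exact: ck.
have i1 : intg P (fun w => at_ (s, w) * (sp_coef S j w * (W (u j.+1 s) w i l - W (u j s) w i l))).
  by apply: sqiM => //; exact: (sqi_bnd dB2 mcO hk).
have i2 : intg P (fun w => at_ (s, w) * (ct w * (W (u j.+1 s) w i l - W (u j s) w i l))).
  by apply: sqiM => //; exact: (sqi_bnd dB2 mctO ctb).
have i3 : intg P (fun w => a (s, w) * (ct w * (W (u j.+1 s) w i l - W (u j s) w i l))).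
  by apply: sqiM => //; exact: (sqi_bnd dB2 mctO ctb).
have BW t w : B i l t w = W t w i l by rewrite mxE.
split; first by apply: eq_integrable i1 => // w _ /=; rewrite !BW.
under eq_Rintegral => w _ do rewrite !BW.
have Wm i' t w : component i' W t w 0 l = W t w i' l by rewrite mxE.
have mW t : t \in `[0, T] -> measurable_fun setT ((fun w => W t w i l) : gO i -> R).
  rewrite in_itv/= => /andP[t0' tT'].
  have /(measurable_wrt_mxP (own_sig T))/(_ 0 l) := @W_own _ _ _ _ _ P W xi i t T t0' tT'.
  by apply: eq_measurable_fun => w _; rewrite mxE.
have mats : measurable_fun setT ((fun w => at_ (s, w)) : gO i -> R).
  exact: (measurable_section1 s mat).
have splitE w : at_ (s, w) * (sp_coef S j w * (W (u j.+1 s) w i l - W (u j s) w i l)) -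
    at_ (s, w) * (ct w * (W (u j.+1 s) w i l - W (u j s) w i l)) =
  (at_ (s, w) * (W (u j.+1 s) w i l - W (u j s) w i l)) * (sp_coef S j w - ct w) by ring.
have i12 : intg P (fun w => (at_ (s, w) * (W (u j.+1 s) w i l - W (u j s) w i l)) *
    (sp_coef S j w - ct w)).
  by have := intgB i1 i2; apply: eq_integrable => // w _; rewrite /comp splitE.
have A0 : \int[P]_w ((at_ (s, w) * (W (u j.+1 s) w i l - W (u j s) w i l)) *
    (sp_coef S j w - ct w)) = 0.
  apply: (own_markov hS t0 tT (i := i)) => //.
  - by apply: sqi_intg; apply: sqiB; [exact: (sqi_bounded P mcO hk)|exact: (sqi_bounded P mctO ctb)].
  - apply: measurable_funB => //; apply: (measurable_fun_subG (own_sig _) (full_sig _) _ mct).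
    exact: (own_full hS).
  - move=> A oA; rewrite Rintegral_in_indic; apply: (cproj (\1_A)).
      exact: measurable_indicG.
    apply: intg_indicM; first exact: (own_measurable hS tT oA).
    by apply: sqi_intg; apply: sqiB; [exact: (sqi_bounded P mcO hk)|exact: (sqi_bounded P mctO ctb)].
  - by apply: measurable_funM => //; apply: measurable_funB; exact: mW.
(* [a (s, .)] and [ct] are both known at [max(tau_j, s)], where the increment starts. *)
have B0 : \int[P]_w (a (s, w) * (ct w * (W (u j.+1 s) w i l - W (u j s) w i l))) = 0.
  have fE w : a (s, w) * (ct w * (W (u j.+1 s) w i l - W (u j s) w i l)) =
    (a (s, w) * ct w) * (W (u j.+1 s) w i l - W (u j s) w i l) by rewrite mulrA.
  under eq_Rintegral => w _ do rewrite fE.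
  apply: (increment_orth hS W2) => //.
    apply: measurable_funM.
      apply: (measurable_fun_subG (full_sig s) (full_sig _) _ (a_full sI)).
      by apply: (full_mono hS); rewrite /u le_max lexx orbT.
    apply: (measurable_fun_subG (own_sig _) (full_sig _) _ mct).
    apply: (subset_trans (@own_full _ _ _ _ _ _ _ _ _ _ hS i _)).
    by apply: (full_mono hS); rewrite /u le_max lexx.
  by apply: eq_integrable i3 => // w _ /=; rewrite fE.
have C0 : \int[P]_w (ct w * (W (u j.+1 s) w i l - W (u j s) w i l) * (a (s, w) - at_ (s, w))) = 0.
  rewrite -[RHS]ps0; apply: ae_eq_Rintegral.
  - apply: measurable_funM; first by apply: measurable_funM => //; case: dB2.
    by apply: measurable_funB; [case: as2|case: ats2].
  - apply: (measurable_section1 s (f := fun p : RO => psi p * (a p - at_ p))).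
    by apply: measurable_funM; [case: psi2|apply: measurable_funB; [case: a2|case: at2]].
  - have := negligible_bad_paths i; apply: negligibleS => w /= nE bw; apply: nE.
    by rewrite /psi /db /= !regular_pathE// !clipE.
have -> : \int[P]_w (at_ (s, w) * (sp_coef S j w * (W (u j.+1 s) w i l - W (u j s) w i l))) =
  \int[P]_w (at_ (s, w) * (ct w * (W (u j.+1 s) w i l - W (u j s) w i l))).
  apply/eqP; rewrite -subr_eq0 -RintegralB//; apply/eqP; rewrite -[RHS]A0.
  by apply: eq_Rintegral => w _; exact: splitE.
have /eqP : \int[P]_w (a (s, w) * (ct w * (W (u j.+1 s) w i l - W (u j s) w i l))) -
    \int[P]_w (at_ (s, w) * (ct w * (W (u j.+1 s) w i l - W (u j s) w i l))) = 0.
  by rewrite -RintegralB// -[RHS]C0; apply: eq_Rintegral => w _; rewrite -mulrBl mulrC.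
by rewrite B0 sub0r oppr_eq0 => /eqP.
Qed.

Lemma ito_proj l K N : ito_integral P T full K (B i l) N ->
  {ae lam, forall s : TR, \int[P]_w (at_ (s, w) * (N T w - N s w)) = 0}.
Proof.
move=> hN; have [_ _ _ [S [Swf _ SN]]] := hN.
have TI : T \in `[0, T] by rewrite in_itv/= T0 lexx.
(* There are countably many simple processes, hence one null set of times serves them all. *)
have hS0 : {ae lam, forall s : TR, forall m, \int[P]_w (at_ (s, w) *
    (simple_integral (S m) (B i l) T w - simple_integral (S m) (B i l) s w)) = 0}.
  by apply: ae_foralln => m; exact: simple_proj.
apply: (ae_time2 (filterI (ae_sqi1 at2) hS0)) => s sI [ats2 hs].
have sim t m : t \in `[0, T] -> sqi P (simple_integral (S m) (B i l) t).
  by move=> tI; exact: (sqi_simple hS W2 (Swf m)).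
have Nt t : t \in `[0, T] -> sqi P (N t) by exact: (ito_sqi hS W2 hN).
have lim t : t \in `[0, T] -> \int[P]_w (simple_integral (S m) (B i l) t w * at_ (s, w))
    @[m --> \oo] --> \int[P]_w (N t w * at_ (s, w)).
  by move=> tI; apply: sqiM_cvg; [move=> m; exact: sim|exact: Nt|by []|exact: SN].
have := cvgB (lim T TI) (lim s sI) _.
rewrite [X in _ -> X @ _ --> _](_ : _ = fun=> 0) => [/(_ _)/cvg_lim|]; last first.
  apply/funext => m; rewrite /= -[LHS]/(_ - _) -RintegralB//.
  - by rewrite -[RHS](hs m); apply: eq_Rintegral => w _; rewrite -mulrBl mulrC.
  - by apply: sqiM => //; exact: sim.
  - by apply: sqiM => //; exact: sim.
move=> /(_ (@Rhausdorff R)); rewrite lim_cst// -RintegralB//.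
- by move=> e; rewrite [RHS]e; apply: eq_Rintegral => w _; rewrite -mulrBl mulrC.
- by apply: sqiM => //; exact: Nt.
- by apply: sqiM => //; exact: Nt.
Qed.

End projected.
End projection.

(** * Mean-field coefficients *)

Section max_norm.
Context {R : realType} {m n : nat}.
Implicit Types A : 'M[R]_(m, n).

Lemma mx_norm_le A c : 0 <= c -> (forall i j, `|A i j| <= c) -> `|A| <= c.
Proof.
by move=> c0 h; rewrite [leLHS]mx_normrE; apply: bigmax_le => // -[i j] _; exact: h.
Qed.

Lemma mx_norm_ge A i j : `|A i j| <= `|A|.
Proof.
by rewrite [leRHS]mx_normrE; apply: (le_bigmax _ (fun ij => `|A ij.1 ij.2|) (i, j)).
Qed.

Lemma mx_norm_le_sum A : `|A| <= \sum_i \sum_j `|A i j|.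
Proof.
apply: mx_norm_le => [|i j]; first by do 2 apply: sumr_ge0 => ? _.
rewrite (bigD1 i)//= (bigD1 j)//= -addrA lerDl addr_ge0//; first by apply: sumr_ge0.
by do 2 apply: sumr_ge0 => ? _.
Qed.

Lemma continuous_mx_norm : continuous (fun A => `|A|).
Proof. by move=> A; exact: norm_continuous. Qed.

Lemma delta_mx_norm_le1 i j : `|delta_mx i j : 'M[R]_(m, n)| <= 1.
Proof.
by apply: mx_norm_le => // k l; rewrite mxE; case: (_ && _); rewrite ?normr0 ?normr1.
Qed.

End max_norm.

Lemma row_norm_le {R : realType} {m n : nat} (A : 'M[R]_(m, n)) i : `|row i A| <= `|A|.
Proof. by apply: mx_norm_le => // k l; rewrite mxE; exact: mx_norm_ge. Qed.

Lemma mxB {R : realType} {m n : nat} (A B : 'M[R]_(m, n)) i j : (A - B) i j = A i j - B i j.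
Proof. by rewrite !mxE. Qed.

Section marginal.
Context {R : realType} {dd : measure_display} {Omega : measurableType dd}.
Context {n : nat} (P : probability Omega R).
Local Notation PO := (@product_probability R _ Omega n (fun=> P)).

Lemma marginal_law k (A : set Omega) : measurable A ->
  PO ((fun y => tnth y k) @^-1` A) = P A.
Proof.
move=> mA; pose B j := if j == k then A else setT.
have mB j : measurable (B j) by rewrite /B; case: eqVneq.
rewrite (_ : _ @^-1` A = [set y | forall j, B j (tnth y j)]); last first.
  apply/seteqP; split=> y /= h; first by move=> j; rewrite /B; case: eqVneq => [->|].
  by have := h k; rewrite /B eqxx.
rewrite product_probability_box// (bigD1 k)//= /B eqxx big1 ?mule1// => j /negbTE ->.
exact: probability_setT.
Qed.

Lemma marginal_intg k (h : Omega -> R) : intg P h ->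
  intg PO (fun y => h (tnth y k)) /\ \int[PO]_y h (tnth y k) = \int[P]_w h w.
Proof.
move=> hi; have mh := intg_measurable hi.
have mt : measurable_fun setT ((fun y => tnth y k) : n.-tuple Omega -> Omega) by exact: measurable_tnth.
pose tM := HB.pack_for {mfun n.-tuple Omega >-> Omega} (fun y : n.-tuple Omega => tnth y k)
  (isMeasurableFun.Build _ _ _ _ (fun y : n.-tuple Omega => tnth y k) mt).
have i1 : intg PO (fun y => h (tnth y k)).
  apply/integrableP; split; first by apply/measurable_EFinP; exact: measurableT_comp.
  have /integrableP[_] := hi.
  rewrite [X in (X < _)%E -> _](eq_measure_integral (image_measure PO tM)); last first.
    by move=> A mA _; rewrite [RHS]marginal_law.
  by rewrite ge0_integral_pushforward//; apply: measurableT_comp => //; exact/measurable_EFinP.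
split=> //; rewrite /Rintegral; congr fine; apply/esym.
rewrite (eq_measure_integral (image_measure PO tM)); last first.
  by move=> A mA _; rewrite [RHS]marginal_law.
by rewrite integral_pushforward//; exact/measurable_EFinP.
Qed.

End marginal.

Section bracket_facts.
Context {R : realType} {dd : measure_display} {Omega : measurableType dd}.
Context {n d : nat} (P : probability Omega R).
Local Notation V := (borelRn R d).
Local Notation PO := (@product_probability R _ Omega n.-1 (fun=> P)).
Variables (Xr : 'I_n -> Omega -> 'rV[R]_d) (m : 'I_n -> probability V R) (i : 'I_n).
Hypothesis mX : forall j l, measurable_fun setT (fun w => Xr j w 0 l).
Hypothesis mE : forall j (A : set V), measurable A ->
  m j A = pushforward P (Xr j : Omega -> V) A.
Hypothesis X1 : forall j, intg P (fun w => `|Xr j w|).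

Lemma insert_at_norm (x : 'rV[R]_d) (z : n.-1.-tuple V) : `|insert_at i x z| <= `|x| + \sum_k `|(tnth z k : 'rV[R]_d)|.
Proof.
have s0 : 0 <= \sum_k `|(tnth z k : 'rV[R]_d)| by apply: sumr_ge0.
apply: mx_norm_le => [|j l]; first by rewrite addr_ge0.
rewrite mxE; case: unliftP => [k _|_].
  apply: (le_trans (mx_norm_ge _ _ _)); apply: ler_wpDl => //.
  by rewrite (bigD1 k)//= lerDl; apply: sumr_ge0.
by apply: (le_trans (mx_norm_ge _ _ _)); rewrite lerDl.
Qed.

Lemma measurable_insert_row_law (f : 'M[R]_(n, d) -> R) x : continuous f ->
  measurable_fun setT (fun y => f (insert_at i x (row_law Xr i y))).
Proof.
move=> cf; apply: measurable_cont_mx => // j l.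
under eq_fun => y do rewrite insert_row_lawE.
case: unlift => [k|]; last exact: measurable_cst.
by apply: (measurableT_comp (mX j l)); exact: measurable_tnth.
Qed.

Section growth.
Variables (f : 'M[R]_(n, d) -> R) (K : R).
Hypotheses (cf : continuous f) (K0 : 0 <= K) (fK : forall z, `|f z| <= K * (1 + `|z|)).

Let bnd (x : 'rV[R]_d) (y : n.-1.-tuple Omega) := K * (1 + `|x|) + K * \sum_(k < n.-1) `|Xr (lift i k) (tnth y k)|.

Let f_bnd x y : `|f (insert_at i x (row_law Xr i y))| <= bnd x y.
Proof.
rewrite (le_trans (fK _))// /bnd -mulrDr ler_wpM2l// -addrA lerD2l.
apply: (le_trans (insert_at_norm _ _)); rewrite lerD2l.
by under eq_bigr => k _ do rewrite tnth_mktuple.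
Qed.

Let bnd_intg x : intg PO (bnd x).
Proof.
apply: intgD; first exact: intg_cst.
by apply: intgZ; apply: intg_sum => k; have [] := marginal_intg k (X1 (lift i k)).
Qed.

Lemma intg_insert_row_law x : intg PO (fun y => f (insert_at i x (row_law Xr i y))).
Proof.
apply: (intg_le _ (bnd_intg x)); last exact: f_bnd.
exact: measurable_insert_row_law.
Qed.

Lemma intg_insert_at x :
  intg (product_probability (fun k => m (lift i k))) (fun z => f (insert_at i x z)).
Proof. by have [] := bracket_rep mX mE cf (intg_insert_row_law x). Qed.

Lemma bracketE x : bracket m i f x = \int[PO]_y f (insert_at i x (row_law Xr i y)).
Proof. by have [] := bracket_rep mX mE cf (intg_insert_row_law x). Qed.

Lemma bracket_growth x :
  `|bracket m i f x| <= K * (1 + `|x|) + K * \sum_(k < n.-1) \int[P]_w `|Xr (lift i k) w|.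
Proof.
rewrite bracketE; apply: (@le_trans _ _ (\int[PO]_y bnd x y)).
  apply: le_trans (le_normr_Rintegral _ (intg_insert_row_law x)) _ => //.
  apply: le_Rintegral => //; first exact: intg_abs (intg_insert_row_law x).
rewrite /bnd RintegralD//; last 2 first.
- exact: intg_cst.
- by apply: intgZ; apply: intg_sum => k; have [] := marginal_intg k (X1 (lift i k)).
rewrite Rintegral_cst// RintegralZl//; last first.
  by apply: intg_sum => k; have [] := marginal_intg k (X1 (lift i k)).
rewrite Rintegral_sum; last by move=> k; have [] := marginal_intg k (X1 (lift i k)).
have PT : PO [set: n.-1.-tuple Omega] = 1%E by exact: probability_setT.
rewrite [fine _](_ : _ = 1); last exact: (congr1 fine PT).
rewrite mulr1 lerD2l ler_wpM2l//; apply: ler_sum => k _.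
by have [_ ->] := marginal_intg k (X1 (lift i k)).
Qed.

End growth.

(** The two insertions share all rows other than [i]. The integrand is therefore the difference of
    the derivatives of [F] at the two points along the segment joining them, nonnegative by
    convexity. *)
Lemma bracket_grad_mono (F : 'M[R]_(n, d) -> R) x x' : C2 F -> bounded_second_derivatives F ->
  convex_function setT F ->
  0 <= dotp (bracket_grad F i x' m - bracket_grad F i x m) (x' - x).
Proof.
move=> cF bF conv; have [K K0 hK] := gradient_growth cF bF.
have cf k : continuous (fun z => grad_i F i z 0 k).
  move=> z; rewrite (_ : (fun z => _) = 'D_(delta_mx i k) F); first exact: C2_continuous_derive.
  by apply/funext => y; rewrite mxE.
have fK k z : `|grad_i F i z 0 k| <= K * (1 + `|z|).
  rewrite mxE (le_trans (hK _ _))// ler_piMr ?delta_mx_norm_le1//.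
  by rewrite mulr_ge0// addr_ge0.
have hi k y := intg_insert_row_law (cf k) K0 (fK k) y.
have bE y k : bracket_grad F i y m 0 k =
    \int[PO]_z grad_i F i (insert_at i y (row_law Xr i z)) 0 k.
  by rewrite mxE; exact: (bracketE (cf k) K0 (fK k)).
have E y : \sum_k (grad_i F i (insert_at i x' (row_law Xr i y)) 0 k -
    grad_i F i (insert_at i x (row_law Xr i y)) 0 k) * (x' - x) 0 k =
    'D_(insert_at i x' (row_law Xr i y) - insert_at i x (row_law Xr i y)) F
      (insert_at i x' (row_law Xr i y)) -
    'D_(insert_at i x' (row_law Xr i y) - insert_at i x (row_law Xr i y)) F
      (insert_at i x (row_law Xr i y)).
  set z' := insert_at i x' _; set z := insert_at i x _.
  have ri : row i (z' - z) = x' - x.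
    by apply/rowP => l; rewrite mxE !mxB /z' /z !insert_row_lawE unlift_none.
  have rj j : j != i -> row j (z' - z) = 0.
    move=> ji; apply/rowP => l; rewrite mxE mxB /z' /z !insert_row_lawE.
    by case: unliftP ji => [k -> _|->]; rewrite ?eqxx// subrr mxE.
  have DE u : 'D_(z' - z) F u = dotp (grad_i F i u) (x' - x).
    rewrite (derive_grad_i _ (C2_differentiable cF u)) (bigD1 i)//= ri big1 ?addr0// => j ji.
    by rewrite rj// /dotp big1// => l _; rewrite [X in _ * X]mxE mulr0.
  by rewrite !DE /dotp -sumrB; apply: eq_bigr => k _; rewrite mulrBl.
have gi k : intg PO (fun y => (grad_i F i (insert_at i x' (row_law Xr i y)) 0 k -
    grad_i F i (insert_at i x (row_law Xr i y)) 0 k) * (x' - x) 0 k).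
  have := intgZ ((x' - x) 0 k) (intgB (hi k x') (hi k x)).
  by apply: eq_integrable => // y _; rewrite /comp mulrC.
rewrite (_ : dotp _ _ = \int[PO]_y \sum_k (grad_i F i (insert_at i x' (row_law Xr i y)) 0 k -
    grad_i F i (insert_at i x (row_law Xr i y)) 0 k) * (x' - x) 0 k).
  apply: Rintegral_ge0 => // y _; rewrite E.
  exact: (convex_gradient_mono _ _ (C2_differentiable cF) conv).
rewrite Rintegral_sum; last exact: gi.
have dB k : \int[PO]_y ((grad_i F i (insert_at i x' (row_law Xr i y)) 0 k -
    grad_i F i (insert_at i x (row_law Xr i y)) 0 k) * (x' - x) 0 k) =
    (bracket_grad F i x' m 0 k - bracket_grad F i x m 0 k) * (x' - x) 0 k.
  rewrite RintegralZr//; last exact: intgB (hi k x') (hi k x).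
  congr (_ * _); rewrite (RintegralB _ (hi k x') (hi k x))//.
  by congr (_ - _); exact/esym/bE.
rewrite /dotp; apply: eq_bigr => k _; rewrite dB; congr (_ * _); exact: mxB.
Qed.

End bracket_facts.

Section bracket_flow.
Context {R : realType} {dd : measure_display} {Omega : measurableType dd}.
Context {n d : nat} (P : probability Omega R) (T : R).
Local Notation V := (borelRn R d).
Variables (X : R -> Omega -> 'M[R]_(n, d)) (m : R -> 'I_n -> probability V R) (i : 'I_n).
Hypothesis T0 : 0 <= T.
Hypothesis mX : forall j l,
  measurable_fun setT (fun p : measurableTypeR R * Omega => X (clip T p.1) p.2 j l).
Hypothesis lawX : is_law_flow P T m X.
Hypothesis X1 : forall t, t \in `[0, T] -> intg P (fun w => `|X t w|).

Let mXt t j l : t \in `[0, T] -> measurable_fun setT (fun w => X t w j l).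
Proof. by move=> tI; have := measurable_section1 t (mX j l); rewrite /= clipE. Qed.

Let mXr t j l : t \in `[0, T] -> measurable_fun setT (fun w => row j (X t w) 0 l).
Proof. by move=> tI; under eq_fun => w do rewrite mxE; exact: mXt. Qed.

Lemma law_flow_row t j (A : set V) : t \in `[0, T] -> measurable A ->
  m t j A = pushforward P ((fun w => row j (X t w)) : Omega -> V) A.
Proof. by move=> tI mA; rewrite lawX. Qed.

Lemma intg_row_norm t j : t \in `[0, T] -> intg P (fun w => `|row j (X t w)|).
Proof.
move=> tI; apply: (intg_le _ (X1 tI)) => [|w].
  apply: (measurable_cont_mx (h := fun A : 'rV[R]_d => `|A|)); first exact: continuous_mx_norm.
  by move=> i' l; rewrite (ord1 i'); exact: mXr.
by rewrite normr_id row_norm_le.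
Qed.

Let Xr t j (w : Omega) : 'rV[R]_d := row j (X t w).
Let mXr' t : t \in `[0, T] -> forall j l, measurable_fun setT (fun w => Xr t j w 0 l).
Proof. by move=> tI j l; exact: mXr. Qed.
Let lawXr t : t \in `[0, T] -> forall j (A : set V), measurable A ->
  m t j A = pushforward P (Xr t j : Omega -> V) A.
Proof. by move=> tI j A; exact: law_flow_row. Qed.
Let Xr1 t : t \in `[0, T] -> forall j, intg P (fun w => `|Xr t j w|).
Proof. by move=> tI j; exact: intg_row_norm. Qed.

Lemma bracket_grad_flow_mono (F : 'M[R]_(n, d) -> R) t x x' : t \in `[0, T] ->
  C2 F -> bounded_second_derivatives F -> convex_function setT F ->
  0 <= dotp (bracket_grad F i x' (m t) - bracket_grad F i x (m t)) (x' - x).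
Proof. by move=> tI; exact: (bracket_grad_mono i (mXr' tI) (lawXr tI) (Xr1 tI)). Qed.

Variables (f : 'M[R]_(n, d) -> R) (K : R).
Hypotheses (cf : continuous f) (K0 : 0 <= K) (fK : forall z, `|f z| <= K * (1 + `|z|)).

Lemma intg_insert_at_flow t x : t \in `[0, T] ->
  intg (product_probability (fun k => m t (lift i k))) (fun z => f (insert_at i x z)).
Proof. by move=> tI; exact: (intg_insert_at i (mXr' tI) (lawXr tI) (Xr1 tI) cf K0 fK). Qed.

Lemma measurable_bracket_flow {d'} {S : measurableType d'} (tt : S -> R) (x : S -> 'rV[R]_d) :
  measurable_fun setT tt -> (forall l, measurable_fun setT (fun s => x s 0 l)) ->
  measurable_fun setT (fun s => bracket (m (clip T (tt s))) i f (x s)).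
Proof.
move=> mt mx.
pose PO := @product_probability R _ Omega n.-1 (fun=> P).
rewrite (_ : (fun s => _) = fun s => \int[PO]_y
  f (insert_at i (x s) (row_law (fun j w => row j (X (clip T (tt s)) w)) i y))); last first.
  apply/funext => s; have tI := clip_itv T0 (tt s).
  exact: (bracketE i (mXr' tI) (lawXr tI) (Xr1 tI) cf K0 fK).
apply: (measurable_Rintegral1 PO (f := fun p : S * n.-1.-tuple Omega =>
  f (insert_at i (x p.1) (row_law (fun j w => row j (X (clip T (tt p.1)) w)) i p.2)))).
apply: measurable_cont_mx => // j l.
under eq_fun => y do rewrite insert_row_lawE.
case: unlift => [k|]; last exact: (measurableT_comp (mx l) measurable_fst).
under eq_fun => y do rewrite mxE.
apply: (measurable_pair_comp (mX j l) (f := fun p : S * n.-1.-tuple Omega => (tt p.1 : measurableTypeR R))).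
  exact: (measurableT_comp mt measurable_fst).
exact: (measurableT_comp (@measurable_tnth _ Omega n.-1 k) measurable_snd).
Qed.

Lemma bracket_flow_growth C t x : t \in `[0, T] -> \int[P]_w `|X t w| <= C ->
  `|bracket (m t) i f x| <= K * (1 + `|x|) + K * (n.-1%:R * C).
Proof.
move=> tI hC; apply: le_trans (bracket_growth i (mXr' tI) (lawXr tI) (Xr1 tI) cf K0 fK x) _.
rewrite lerD2l ler_wpM2l// mulr_natl -[n.-1 in leRHS]card_ord -sumr_const; apply: ler_sum => k _.
apply: le_trans hC; apply: le_Rintegral => //; [exact: intg_row_norm|exact: X1|].
by move=> w _; exact: row_norm_le.
Qed.

End bracket_flow.

Section growth_square_integrable.
Context {R : realType} {d : measure_display} {S : measurableType d}
  (mu : {finite_measure set S -> \bar R}).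

Lemma sqi_mx_norm {m n} (X : S -> 'M[R]_(m, n)) :
  (forall i j, sqi mu (fun s => X s i j)) -> sqi mu (fun s => `|X s|).
Proof.
move=> hX; have h : sqi mu (fun s => \sum_i \sum_j `|X s i j|).
  by apply: sqi_sum => i; apply: sqi_sum => j; exact: sqi_abs.
apply: (sqi_le _ h) => [|s].
  apply: (measurable_cont_mx (h := fun A : 'M[R]_(m, n) => `|A|)); first exact: continuous_mx_norm.
  by move=> i j; case: (hX i j).
rewrite normr_id ger0_norm; first exact: mx_norm_le_sum.
by do 2 apply: sumr_ge0 => ? _.
Qed.

Lemma sqi_growth {m n} (X : S -> 'M[R]_(m, n)) (f : S -> R) K :
  (forall i j, sqi mu (fun s => X s i j)) -> measurable_fun setT f -> 0 <= K ->
  (forall s, `|f s| <= K * (1 + `|X s|)) -> sqi mu f.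
Proof.
move=> hX mf K0 fK; apply: (sqi_le mf (sqiZ K (sqiD (sqi_cst mu 1) (sqi_mx_norm hX)))) => s.
by rewrite [leRHS]ger0_norm ?mulr_ge0 ?addr_ge0.
Qed.

Lemma sqi_growth2 {m n m' n'} (X : S -> 'M[R]_(m, n)) (Y : S -> 'M[R]_(m', n')) (f : S -> R) K :
  (forall i j, sqi mu (fun s => X s i j)) -> (forall i j, sqi mu (fun s => Y s i j)) ->
  measurable_fun setT f -> 0 <= K ->
  (forall s, `|f s| <= K * (1 + `|X s| + `|Y s|)) -> sqi mu f.
Proof.
move=> hX hY mf K0 fK.
apply: (sqi_le mf (sqiZ K (sqiD (sqiD (sqi_cst mu 1) (sqi_mx_norm hX)) (sqi_mx_norm hY)))) => s.
by rewrite [leRHS]ger0_norm ?mulr_ge0 ?addr_ge0.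
Qed.

Lemma sqi_ae (f g : S -> R) : measurable_fun setT f -> sqi mu g ->
  {ae mu, forall s, f s = g s} -> sqi mu f.
Proof.
move=> mf [mg gi] fg; split=> //; apply: le_lt_trans gi; rewrite le_eqVlt; apply/orP; left; apply/eqP.
apply: ae_eq_integral => //.
- by apply/measurable_EFinP; exact: measurable_funX.
- by apply/measurable_EFinP; exact: measurable_funX.
- by apply: filterS fg => s -> _.
Qed.

End growth_square_integrable.

Lemma grad_snd_growth {R : realType} {d : nat} (H : 'rV[R]_d * 'rV[R]_d -> R) :
  C2 H -> bounded_second_derivatives H -> exists2 K, 0 <= K & forall x p k,
  `|grad_snd H x p 0 k| <= K * (1 + `|x| + `|p|) /\ `|grad_fst H x p 0 k| <= K * (1 + `|x| + `|p|).
Proof.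
move=> cH bH; have [K K0 hK] := gradient_growth cH bH; exists K => // x p k.
have h v : `|v| <= 1 -> `|'D_v H (x, p)| <= K * (1 + `|x| + `|p|).
  move=> v1; apply: (le_trans (hK _ _)); rewrite prod_normE/=.
  have M0 : 0 <= Num.max `|x| `|p| by rewrite le_max normr_ge0.
  rewrite -mulrA ler_wpM2l// -addrA; apply: (@le_trans _ _ (1 + Num.max `|x| `|p|)).
    by rewrite ler_piMr// addr_ge0.
  by rewrite lerD2l ge_max lerDl lerDr !normr_ge0.
rewrite !mxE; split; apply: h; rewrite prod_normE/= normr0 ge_max ler01/= ?andbT;
  exact: delta_mx_norm_le1.
Qed.

Lemma continuous_grad_snd {R : realType} {d : nat} (H : 'rV[R]_d * 'rV[R]_d -> R) k :
  C2 H -> continuous (fun z : 'rV[R]_d * 'rV[R]_d => grad_snd H z.1 z.2 0 k).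
Proof.
move=> cH; rewrite (_ : (fun z => _) = 'D_(0, delta_mx 0 k) H).
  exact: C2_continuous_derive.
by apply/funext => -[x p]; rewrite mxE.
Qed.

Lemma continuous_grad_fst {R : realType} {d : nat} (H : 'rV[R]_d * 'rV[R]_d -> R) k :
  C2 H -> continuous (fun z : 'rV[R]_d * 'rV[R]_d => grad_fst H z.1 z.2 0 k).
Proof.
move=> cH; rewrite (_ : (fun z => _) = 'D_(delta_mx 0 k, 0) H).
  exact: C2_continuous_derive.
by apply/funext => -[x p]; rewrite mxE.
Qed.

(* [Kint lam kle f (t, w)] is the integral of [f (., w)] over [[0, t]], and
   [Kint lam (swapK kle) f (t, w)] the one over [[t, T]]. *)
Definition kle {R : realType} (p : measurableTypeR R * measurableTypeR R) : R :=
  (((p.2 : R) <= p.1 :> R)%R : bool)%:R.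

Section time_kernel.
Context {R : realType} (T : R).
Local Notation lam := (time_measure T).

Lemma measurable_kle : measurable_fun setT (@kle R).
Proof.
rewrite (_ : kle = fun p => \1_[set q : measurableTypeR R * measurableTypeR R | (q.2 : R) <= q.1] p).
  apply: measurable_indic.
  rewrite (_ : [set q | _] = ~` [set q : measurableTypeR R * measurableTypeR R | (q.1 : R) < q.2]).
    by apply: measurableC; apply: measurable_set_lt; [exact: measurable_fst|exact: measurable_snd].
  by apply/seteqP; split=> q /=; rewrite leNgt => /negP.
by apply/funext => p; rewrite /kle indicE; congr ((_ : bool)%:R); apply/idP/idP; rewrite inE.
Qed.

Lemma kle_le1 p : `|kle p : R| <= 1.
Proof. by rewrite /kle ger0_norm ?ler0n// lern1 leq_b1. Qed.

Lemma Rintegral_past (f : R -> R) t : t \in `[0, T] ->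
  \int[@lebesgue_measure R]_(s in `[0, t]) f s = \int[lam]_s (kle (t, s) * f (clip T s)).
Proof.
rewrite in_itv/= => /andP[t0 tT]; rewrite /Rintegral integral_time_measure; congr fine.
rewrite integral_mkcond [RHS]integral_mkcond; apply: eq_integral => s _.
have [/=|nI] := pselect (`[0, t]%classic (s : R)).
  rewrite in_itv/= => /andP[s0 st]; have sT := le_trans st tT.
  have sI : s \in `[0, T] by rewrite in_itv/= s0.
  by rewrite !patchE !mem_set/= ?in_itv/= ?s0// /kle /= st mul1r clipE.
rewrite patchE memNset//; apply/esym.
have [/=|nI'] := pselect (`[0, T]%classic (s : R)); last by rewrite patchE memNset.
rewrite in_itv/= => /andP[s0 sT]; rewrite patchE mem_set/= ?in_itv/= ?s0// /kle /=.
by case: (leP (s : R) t) => st; rewrite ?mul0r//; case: nI; rewrite /= in_itv/= s0.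
Qed.

Lemma Rintegral_future (f : R -> R) t : t \in `[0, T] ->
  \int[@lebesgue_measure R]_(s in `[t, T]) f s = \int[lam]_s (swapK kle (t, s) * f (clip T s)).
Proof.
rewrite in_itv/= => /andP[t0 tT]; rewrite /Rintegral integral_time_measure; congr fine.
rewrite integral_mkcond [RHS]integral_mkcond; apply: eq_integral => s _.
have [/=|nI] := pselect (`[t, T]%classic (s : R)).
  rewrite in_itv/= => /andP[ts sT]; have s0 := le_trans t0 ts.
  have sI : s \in `[0, T] by rewrite in_itv/= s0.
  by rewrite !patchE !mem_set/= ?in_itv/= ?s0 ?ts// /swapK /kle /= ts mul1r clipE.
rewrite patchE memNset//; apply/esym.
have [/=|nI'] := pselect (`[0, T]%classic (s : R)); last by rewrite patchE memNset.
rewrite in_itv/= => /andP[s0 sT]; rewrite patchE mem_set/= ?in_itv/= ?s0// /swapK /kle /=.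
by case: (leP t (s : R)) => st; rewrite ?mul0r//; case: nI; rewrite /= in_itv/= st.
Qed.

(** The kernel [kle (T, .)] is 1 on [0, T]; this is the transposition with a terminal weight in
    place of a running one. *)
Lemma Kint_terminal {dd} {Omega : measurableType dd} (P : probability Omega R)
    (f : measurableTypeR R * Omega -> R) (g : Omega -> R) :
  sqi (fprodm lam P) f -> sqi P g ->
  \int[fprodm lam P]_p (f p * g p.2) =
  \int[P]_w (g w * Kint lam kle f ((T : measurableTypeR R), w)).
Proof.
move=> f2 g2; have [mf _] := f2; have hQ := sqiM f2 (sqi_fst lam g2).
rewrite Rintegral_fprodm2//; apply: ae_eq_Rintegral.
- exact: (measurable_Rintegral2 lam (intg_measurable hQ)).
- apply: measurable_funM; first by case: g2.
  by case: (sqi_Kint_section measurable_kle kle_le1 (T : measurableTypeR R) f2).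
- apply: filterS (ae_sqi2 f2) => w fw; rewrite /= RintegralZr//; last exact: sqi_intg.
  rewrite mulrC; congr (_ * _); apply: ae_eq_Rintegral.
  + exact: (measurable_section2 w mf).
  + apply: measurable_funM; last exact: (measurable_section2 w mf).
    exact: (measurable_section1 (T : measurableTypeR R) measurable_kle).
  + apply: ae_time => t; rewrite in_itv/= => /andP[_ tT].
    by rewrite /kle /= tT mul1r.
Qed.

End time_kernel.

Lemma ae_fprodm_time {R : realType} {dd} {Omega : measurableType dd} (P : probability Omega R)
    (T : R) (U : R -> Omega -> Prop) :
  {ae P, forall w, forall t, t \in `[0, T] -> U t w} ->
  {ae fprodm (time_measure T) P, forall p : measurableTypeR R * Omega, U p.1 p.2}.
Proof.
move=> [N [mN N0 UN]].
pose A : set (measurableTypeR R) := ~` `[0, T]%classic.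
have mA : measurable A by exact: measurableC.
have A0 : time_measure T A = 0%E.
  by rewrite /time_measure /= /mfrestr /mrestr /A setICl measure0.
exists ((A `*` setT) `|` (setT `*` N)); split.
- by apply: measurableU; exact: measurableX.
- have z1 : fprodm (time_measure T) P (A `*` setT) = 0%E.
    by transitivity (time_measure T A * P setT)%E; [exact: product_measure1E|rewrite A0 mul0e].
  have z2 : fprodm (time_measure T) P (setT `*` N) = 0%E.
    by transitivity (time_measure T setT * P N)%E; [exact: product_measure1E|rewrite N0 mule0].
  by rewrite measureU0//; exact: measurableX.
- move=> [t w] /= nU; have [tI|tI] := pselect (t \in `[0, T]); last by left.
  by right; split=> //; apply: UN => /= h; apply: nU; exact: h.
Qed.

Lemma intg_Rintegral2 {d1 d2} {A : measurableType d1} {S : measurableType d2} {R : realType}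
    (m1 : {finite_measure set A -> \bar R}) (m2 : {finite_measure set S -> \bar R})
    (f : A * S -> R) : intg (fprodm m1 m2) f -> intg m2 (fun w => \int[m1]_t f (t, w)).
Proof.
move=> fi; have mf := intg_measurable fi; have mE : measurable_fun setT (EFin \o f) by exact/measurable_EFinP.
apply/integrableP; split; first by apply/measurable_EFinP; exact: (measurable_Rintegral2 m1).
apply: le_lt_trans ((integrable21ltyP m1 m2 mE).1 fi).
apply: (@le_integral_ae _ _ _ m2 set0) => // w _.
apply: (@le_trans _ _ `|\int[m1]_t (f (t, w))%:E|%E).
  by rewrite /= /Rintegral; case: (integral _ _ _) => [r||]; rewrite ?normr0 /= ?lexx ?leey.
apply: le_abse_integral => //; apply/measurable_EFinP; exact: measurable_section2.
Qed.

Lemma le_integral_of_ae {d} {T : measurableType d} {R : realType}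
    (mu : {measure set T -> \bar R}) (f g : T -> \bar R) :
  {ae mu, forall x, (f x <= g x)%E} -> (\int[mu]_x f x <= \int[mu]_x g x)%E.
Proof.
move=> [N [mN N0 sub]]; apply: (le_integral_ae mN N0) => x Nx.
by apply: contrapT => h; apply: Nx; exact: sub.
Qed.

Lemma sq_le_sqnorm {R : realType} {k l} (A : 'M[R]_(k, l)) i j : A i j ^+ 2 <= sqnorm A.
Proof.
rewrite /sqnorm (bigD1 i)//= (bigD1 j)//= -addrA lerDl addr_ge0//.
  by apply: sumr_ge0 => ? _; exact: sqr_ge0.
by do 2 apply: sumr_ge0 => ? _; exact: sqr_ge0.
Qed.

Lemma sqnorm_ge0 {R : realType} {k l} (A : 'M[R]_(k, l)) : 0 <= sqnorm A.
Proof. by do 2 apply: sumr_ge0 => ? _; exact: sqr_ge0. Qed.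

Lemma mx_norm_le_sqnorm {R : realType} {k l} (A : 'M[R]_(k, l)) : `|A| <= 1 + sqnorm A.
Proof.
apply: mx_norm_le => [|i j]; first by rewrite addr_ge0// sqnorm_ge0.
have := sq_le_sqnorm A i j; rewrite -real_normK ?num_real//.
have := normr_ge0 (A i j); nra.
Qed.

(** Passage between the iterated integral in the definition of admissibility and square
    integrability on the product space, where Fubini and the kernel operators apply. *)
Lemma square_control {R : realType} {dd} {Omega : measurableType dd} {n d : nat}
    (P : probability Omega R) (T : R) (b : R -> Omega -> 'M[R]_(n, d)) :
  (forall i k, measurable_fun setT (fun p : measurableTypeR R * Omega => b (clip T p.1) p.2 i k)) ->
  (\int[P]_w \int[@lebesgue_measure R]_(t in `[0%R, T]) (sqnorm (b t w))%:E < +oo)%E <->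
  forall i k, sqi (fprodm (time_measure T) P) (fun p : measurableTypeR R * Omega => b (clip T p.1) p.2 i k).
Proof.
move=> mb.
have E w : (\int[@lebesgue_measure R]_(t in `[0%R, T]) (sqnorm (b t w))%:E =
    \int[time_measure T]_t (sqnorm (b (clip T t) w))%:E)%E.
  rewrite integral_time_measure; apply: eq_integral => t; rewrite inE/= => tI.
  by rewrite clipE.
have msq : measurable_fun setT (fun p : measurableTypeR R * Omega => sqnorm (b (clip T p.1) p.2)).
  apply: measurable_sum => i; apply: measurable_sum => k; exact: measurable_funX.
under eq_integral => w _ do rewrite E.
split=> [h i k|b2].
  have hQ : intg (fprodm (time_measure T) P) (fun p : measurableTypeR R * Omega => sqnorm (b (clip T p.1) p.2)).
    apply: intg_fprodm; first exact: msq.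
    apply: le_lt_trans h; rewrite le_eqVlt; apply/orP; left; apply/eqP.
    apply: eq_integral => w _; apply: eq_integral => t _; rewrite ger0_norm; [reflexivity|exact: sqnorm_ge0].
  apply: intg_sqi => //; apply: (intg_le _ hQ) => [|p]; first exact: measurable_funX.
  by rewrite ger0_norm ?sqr_ge0// sq_le_sqnorm.
have hQ : intg (fprodm (time_measure T) P) (fun p : measurableTypeR R * Omega => sqnorm (b (clip T p.1) p.2)).
  by apply: intg_sum => i; apply: intg_sum => k; exact: sqi_sq.
have := (integrable21ltyP (time_measure T) P (measurable_int _ hQ)).1 hQ.
apply: le_lt_trans; rewrite le_eqVlt; apply/orP; left; apply/eqP.
apply: eq_integral => w _; apply: eq_integral => t _; rewrite /= ger0_norm; [reflexivity|exact: sqnorm_ge0].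
Qed.

(** * Estimates and adjoint relations along a solution *)

Section solution.
Context {R : realType} {dd : measure_display} {Omega : measurableType dd}.
Context {n d : nat} {P : probability Omega R} {T : R} {F0 : set (set Omega)}.
Context {W : R -> Omega -> 'M[R]_(n, d)} {xi : Omega -> 'M[R]_(n, d)}.
Context {L H : 'I_n -> 'rV[R]_d * 'rV[R]_d -> R} {F G : 'M[R]_(n, d) -> R}.
Context {X Y : R -> Omega -> 'M[R]_(n, d)} {Z : 'I_n -> R -> Omega -> 'M[R]_d}.
Context {m : R -> 'I_n -> probability (borelRn R d) R}.
Hypotheses (hS : setting P T F0 W xi) (hA : assumptions_A L H F G)
  (hF : fbsde_solution P T F0 W xi L H F G X Y Z m).
Local Notation lam := (time_measure T).
Local Notation TR := (measurableTypeR R).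
Local Notation RO := (TR * Omega)%type.
Local Notation Q := (fprodm lam P).
Local Notation full := (full_filtration P F0 W).
Local Notation own i := (own_filtration P W xi i).
Local Notation alpha := (feedback H X Y).
Local Notation J := (Kint lam (swapK kle)).

Lemma T_ge0 : 0 <= T. Proof. exact: ltW (set_T hS). Qed.
Lemma T_itv : T \in `[0, T]. Proof. by rewrite in_itv/= T_ge0 lexx. Qed.

Let TI := T_itv.
Let mkle := @measurable_kle R.
Let kle1 := @kle_le1 R.
Let sK1 : forall p, `|swapK (@kle R) p| <= 1. Proof. by move=> p; exact: kle1. Qed.

Lemma measurable_fullfun (f : TR * g_sigma_algebraType (full T) -> R) :
  measurable_fun setT f -> measurable_fun setT (f : RO -> R).
Proof.
move=> mf; have mid : measurable_fun setT (id : Omega -> g_sigma_algebraType (full T)).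
  by apply: measurable_id_sub; [exact: (full_measurable hS)|exact: full_sigma].
rewrite (_ : f = fun p : RO => f (p.1, p.2 : g_sigma_algebraType (full T))); last first.
  by apply/funext => -[].
exact: (measurable_pair_comp mf measurable_fst (measurableT_comp mid measurable_snd)).
Qed.

Lemma measurable_progressive (V : R -> Omega -> 'M[R]_(n, d)) i j : progressive T full V ->
  measurable_fun setT (fun p : RO => V (clip T p.1) p.2 i j).
Proof.
move=> pV; apply: measurable_fullfun; apply: measurable_timeE.
exact: (jointly_measurable_clip T_ge0 (full_sigma _ _ _ _) (pV T T_itv)).
Qed.

(** Joint measurability on [0, t], taken with [t] itself as horizon, restricts to the section at
    [t]. *)
Lemma progressive_adapted (V : R -> Omega -> 'M[R]_(n, d)) t i j : progressive T full V ->
  t \in `[0, T] -> measurable_fun setT ((fun w => V t w i j) : g_sigma_algebraType (full t) -> R).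
Proof.
move=> pV tI; have /andP[t0 tT] : 0 <= t <= T by move: tI; rewrite in_itv.
have := measurable_section1 t (jointly_measurable_clip t0 (full_sigma _ _ _ _) (pV t tI) i j).
by rewrite /= clipE// in_itv/= t0 lexx.
Qed.

(** The supremum in [sol_integrable] runs over uncountably many times and enters through
    monotonicity of the integral alone, as an upper bound for each single time. *)
Lemma solution_moment : exists2 C, 0 <= C & forall t, t \in `[0, T] ->
  (\int[P]_w (sqnorm (X t w) + sqnorm (Y t w))%:E <= C%:E)%E.
Proof.
have := sol_integrable hF; set I := (\int[P]_w _)%E => Ioo.
have h t : t \in `[0, T] -> (\int[P]_w (sqnorm (X t w) + sqnorm (Y t w))%:E <= I)%E.
  move=> tI; apply: (@le_integral_ae _ _ _ P set0) => // w _.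
  rewrite -[leLHS]adde0; apply: leeD.
    by apply: ereal_sup_ubound; exists t.
  apply: integral_ge0 => s _; rewrite lee_fin; apply: sumr_ge0 => i _.
  by do 2 apply: sumr_ge0 => ? _; exact: sqr_ge0.
have I0 : (0 <= I)%E.
  apply: le_trans (h T T_itv); apply: integral_ge0 => w _; rewrite lee_fin.
  by rewrite addr_ge0//; do 2 apply: sumr_ge0 => ? _; exact: sqr_ge0.
have If : I \is a fin_num by rewrite ge0_fin_numE.
exists (fine I); first exact: fine_ge0.
by move=> t tI; rewrite fineK//; exact: h.
Qed.

Lemma X_measurable t i j : t \in `[0, T] -> measurable_fun setT (fun w => X t w i j).
Proof.
move=> tI; have := measurable_section1 t (measurable_progressive i j (sol_X_progressive hF)).
by rewrite /= clipE.
Qed.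

Lemma Y_measurable t i j : t \in `[0, T] -> measurable_fun setT (fun w => Y t w i j).
Proof.
move=> tI; have := measurable_section1 t (measurable_progressive i j (sol_Y_progressive hF)).
by rewrite /= clipE.
Qed.

Lemma coord_moment : exists C, forall t i j, t \in `[0, T] ->
  (\int[P]_w ((X t w i j) ^+ 2)%:E <= C%:E)%E /\ (\int[P]_w ((Y t w i j) ^+ 2)%:E <= C%:E)%E.
Proof.
have [C C0 hC] := solution_moment; exists C => t i j tI.
by split; apply: le_trans (hC t tI); apply: (@le_integral_ae _ _ _ P set0) => // w _;
  rewrite lee_fin; [apply: ler_wpDr|apply: ler_wpDl]; rewrite ?sqnorm_ge0 ?sq_le_sqnorm.
Qed.

Lemma X_sqi t i j : t \in `[0, T] -> sqi P (fun w => X t w i j).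
Proof.
move=> tI; split; first exact: X_measurable.
by have [C hC] := coord_moment; apply: le_lt_trans (hC t i j tI).1 _; rewrite ltry.
Qed.

Lemma Y_sqi t i j : t \in `[0, T] -> sqi P (fun w => Y t w i j).
Proof.
move=> tI; split; first exact: Y_measurable.
by have [C hC] := coord_moment; apply: le_lt_trans (hC t i j tI).2 _; rewrite ltry.
Qed.

Lemma X_sqiQ i j : sqi Q (fun p : RO => X (clip T p.1) p.2 i j).
Proof.
have [C hC] := coord_moment; apply: (@sqi_time_bound _ _ _ P T C).
  exact: (measurable_progressive i j (sol_X_progressive hF)).
by move=> t tI /=; have [h _] := hC t i j tI; rewrite clipE.
Qed.

Lemma Y_sqiQ i j : sqi Q (fun p : RO => Y (clip T p.1) p.2 i j).
Proof.
have [C hC] := coord_moment; apply: (@sqi_time_bound _ _ _ P T C).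
  exact: (measurable_progressive i j (sol_Y_progressive hF)).
by move=> t tI /=; have [_ h] := hC t i j tI; rewrite clipE.
Qed.

Lemma X_norm : exists C, forall t, t \in `[0, T] ->
  intg P (fun w => `|X t w|) /\ \int[P]_w `|X t w| <= C.
Proof.
have [C C0 hC] := solution_moment; exists (1 + C) => t tI.
have mN : measurable_fun setT (fun w => `|X t w|).
  apply: (measurable_cont_mx (h := fun A : 'M[R]_(n, d) => `|A|)); first exact: continuous_mx_norm.
  by move=> i j; exact: X_measurable.
have msq (V : Omega -> 'M[R]_(n, d)) : (forall i j, measurable_fun setT (fun w => V w i j)) ->
    measurable_fun setT (fun w => sqnorm (V w)).
  move=> mV; rewrite /sqnorm; apply: measurable_sum => i; apply: measurable_sum => j.
  exact: measurable_funX.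
have si : intg P (fun w => sqnorm (X t w) + sqnorm (Y t w)).
  apply: intg_ge0.
  - by apply: measurable_funD; apply: msq => i j; [exact: X_measurable|exact: Y_measurable].
  - by move=> w; rewrite addr_ge0 ?sqnorm_ge0.
  - by apply: le_lt_trans (hC t tI) _; rewrite ltry.
have bi := intgD (intg_cst P 1) si.
have le w : `|X t w| <= 1 + (sqnorm (X t w) + sqnorm (Y t w)).
  apply: (le_trans (mx_norm_le_sqnorm _)); rewrite lerD2l lerDl; exact: sqnorm_ge0.
have i1 : intg P (fun w => `|X t w|) by apply: (intg_le mN bi) => w; rewrite normr_id.
split=> //; apply: (@le_trans _ _ (\int[P]_w (1 + (sqnorm (X t w) + sqnorm (Y t w))))).
  exact: le_Rintegral.
rewrite RintegralD//; last exact: intg_cst.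
rewrite Rintegral_cst// mul1r [fine _](_ : _ = 1); last exact: (congr1 fine (probability_setT P)).
by rewrite lerD2l -lee_fin EFin_Rintegral//; exact: hC.
Qed.

(* With [c = cfun], [g = gfun] along the solution, the backward equation reads
   Y_t = g + \int_t^T c ds - (M_T - M_t); since [afun] is then [- Y] by the
   first-order condition, [rsol] below equals M_T - M_t. *)
Definition cfun i k (t : R) (x a : 'rV[R]_d) : R :=
  n%:R^-1 * grad_fst (L i) x a 0 k + bracket_grad F i x (m (clip T t)) 0 k.

Definition afun i k (x a : 'rV[R]_d) : R := n%:R^-1 * grad_snd (L i) x a 0 k.

Definition gfun i k (x : 'rV[R]_d) : R := bracket_grad G i x (m T) 0 k.

Lemma grad_i_cont_growth (f : 'M[R]_(n, d) -> R) : C2 f -> bounded_second_derivatives f ->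
  exists2 K, 0 <= K & forall i k, continuous (fun z => grad_i f i z 0 k) /\
    forall z, `|grad_i f i z 0 k| <= K * (1 + `|z|).
Proof.
move=> cf bf; have [K K0 hK] := gradient_growth cf bf; exists K => // i k; split.
  rewrite (_ : (fun z => _) = 'D_(delta_mx i k) f); first exact: C2_continuous_derive.
  by apply/funext => y; rewrite mxE.
move=> z; rewrite mxE (le_trans (hK _ _))// ler_piMr ?delta_mx_norm_le1//.
by rewrite mulr_ge0// addr_ge0.
Qed.

Let mXRO i j := measurable_progressive i j (sol_X_progressive hF).

Lemma measurable_bracket_grad (f : 'M[R]_(n, d) -> R) {d'} {S : measurableType d'}
    (tt : S -> R) (x : S -> 'rV[R]_d) i k : C2 f -> bounded_second_derivatives f ->
  measurable_fun setT tt -> (forall l, measurable_fun setT (fun s => x s 0 l)) ->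
  measurable_fun setT (fun s => bracket_grad f i (x s) (m (clip T (tt s))) 0 k).
Proof.
move=> cf bf mt mx; have [K K0 hK] := grad_i_cont_growth cf bf.
have [C hC] := X_norm; have [c1 c2] := hK i k.
under eq_fun => s do rewrite mxE.
exact: (measurable_bracket_flow i T_ge0 mXRO (sol_law hF) (fun t tI => (hC t tI).1) c1 K0 c2).
Qed.

(** The other states enter through their first moments, bounded uniformly by [X_norm]; hence a
    constant that does not depend on [t]. *)
Lemma bracket_grad_growth (f : 'M[R]_(n, d) -> R) : C2 f -> bounded_second_derivatives f ->
  exists2 K, 0 <= K & forall t i k x, t \in `[0, T] ->
    `|bracket_grad f i x (m t) 0 k| <= K * (1 + `|x|).
Proof.
move=> cf bf; have [K K0 hK] := grad_i_cont_growth cf bf; have [C hC] := X_norm.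
have C0 : 0 <= C.
  by apply: le_trans (hC T T_itv).2; apply: Rintegral_ge0 => w _; exact: normr_ge0.
exists (K * (1 + n.-1%:R * C)) => [|t i k x tI].
  by rewrite mulr_ge0// addr_ge0// mulr_ge0.
have [c1 c2] := hK i k; rewrite mxE.
apply: le_trans (bracket_flow_growth i mXRO (sol_law hF) (fun t tI => (hC t tI).1) c1 K0 c2 x tI (hC t tI).2) _.
rewrite -mulrDr -mulrA ler_wpM2l//.
have : 0 <= (n.-1%:R * C) * `|x| by rewrite !mulr_ge0.
by rewrite mulrDl mul1r mulrDr mulr1 !addrA => h; lra.
Qed.

Lemma feedbackE t w i k :
  alpha t w i k = - grad_snd (H i) (row i (X t w)) (n%:R *: row i (Y t w)) 0 k.
Proof. by rewrite mxE [LHS]mxE. Qed.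

Let cL i := A_L_C2 hA i.
Let cH i := A_H_C2 hA i.

Lemma measurable_feedback_of {d'} {S : measurableType d'} i k (x y : S -> 'rV[R]_d) :
  (forall l, measurable_fun setT (fun s => x s 0 l)) ->
  (forall l, measurable_fun setT (fun s => y s 0 l)) ->
  measurable_fun setT (fun s => - grad_snd (H i) (x s) (n%:R *: y s) 0 k).
Proof.
move=> mx my; apply: measurableT_comp => //.
apply: (measurable_cont_pair (h := fun z => grad_snd (H i) z.1 z.2 0 k)) => //.
  exact: continuous_grad_snd.
by move=> l; under eq_fun => s do rewrite mxE; exact: measurable_funM.
Qed.

Lemma sqi_feedback_of {d'} {S : measurableType d'} (mu : {finite_measure set S -> \bar R}) i k
    (x y : S -> 'rV[R]_d) :
  (forall l, sqi mu (fun s => x s 0 l)) -> (forall l, sqi mu (fun s => y s 0 l)) ->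
  sqi mu (fun s => - grad_snd (H i) (x s) (n%:R *: y s) 0 k).
Proof.
move=> x2 y2; have [K K0 hK] := grad_snd_growth (cH i) (A_H_bounded hA i).
have s2 (z : S -> 'rV[R]_d) : (forall l, sqi mu (fun s => z s 0 l)) ->
  forall j l, sqi mu (fun s => z s j l) by move=> z2 j l; rewrite (ord1 j).
apply: (sqi_growth2 (s2 x x2) (s2 (fun s => n%:R *: y s) _) _ K0).
- by move=> l; under eq_fun => s do rewrite mxE; exact: sqiZ.
- by apply: measurable_feedback_of => l; [case: (x2 l)|case: (y2 l)].
- by move=> s; rewrite normrN; exact: (hK (x s) (n%:R *: y s) k).1.
Qed.

Lemma measurable_feedback i k : measurable_fun setT (fun p : RO => alpha (clip T p.1) p.2 i k).
Proof.
under eq_fun => p do rewrite feedbackE; apply: measurable_feedback_of => l;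
  under eq_fun => p do rewrite mxE.
  exact: (measurable_progressive i l (sol_X_progressive hF)).
exact: (measurable_progressive i l (sol_Y_progressive hF)).
Qed.

Lemma feedback_sqiQ i k : sqi Q (fun p : RO => alpha (clip T p.1) p.2 i k).
Proof.
under eq_fun => p do rewrite feedbackE.
by apply: sqi_feedback_of => l; under eq_fun => p do rewrite mxE; [exact: X_sqiQ|exact: Y_sqiQ].
Qed.

Lemma feedback_full t i k : t \in `[0, T] ->
  measurable_fun setT ((fun w => alpha t w i k) : g_sigma_algebraType (full t) -> R).
Proof.
move=> tI; under eq_fun => p do rewrite feedbackE; apply: measurable_feedback_of => l;
  under eq_fun => p do rewrite mxE.
  exact: (progressive_adapted i l (sol_X_progressive hF) tI).
exact: (progressive_adapted i l (sol_Y_progressive hF) tI).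
Qed.

Lemma measurable_cfun {d'} {S : measurableType d'} (tt : S -> R) (x a : S -> 'rV[R]_d) i k :
  measurable_fun setT tt -> (forall l, measurable_fun setT (fun s => x s 0 l)) ->
  (forall l, measurable_fun setT (fun s => a s 0 l)) ->
  measurable_fun setT (fun s => cfun i k (tt s) (x s) (a s)).
Proof.
move=> mt mx ma; apply: measurable_funD.
  apply: measurable_funM => //.
  apply: (measurable_cont_pair (h := fun z => grad_fst (L i) z.1 z.2 0 k)) => //.
  exact: continuous_grad_fst.
exact: (measurable_bracket_grad i k (A_F_C2 hA) (A_F_bounded hA) mt mx).
Qed.

Lemma measurable_afun {d'} {S : measurableType d'} (x a : S -> 'rV[R]_d) i k :
  (forall l, measurable_fun setT (fun s => x s 0 l)) ->
  (forall l, measurable_fun setT (fun s => a s 0 l)) ->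
  measurable_fun setT (fun s => afun i k (x s) (a s)).
Proof.
move=> mx ma; apply: measurable_funM => //.
apply: (measurable_cont_pair (h := fun z => grad_snd (L i) z.1 z.2 0 k)) => //.
exact: continuous_grad_snd.
Qed.

Lemma measurable_gfun {d'} {S : measurableType d'} (x : S -> 'rV[R]_d) i k :
  (forall l, measurable_fun setT (fun s => x s 0 l)) ->
  measurable_fun setT (fun s => gfun i k (x s)).
Proof.
move=> mx; have := measurable_bracket_grad i k (A_G_C2 hA) (A_G_bounded hA)
  (measurable_cst (T : R)) mx.
by apply: eq_measurable_fun => s _; rewrite /= clipE// T_itv.
Qed.

Let s2 {d'} {S : measurableType d'} (mu : {finite_measure set S -> \bar R}) (z : S -> 'rV[R]_d) :
  (forall l, sqi mu (fun s => z s 0 l)) -> forall j l, sqi mu (fun s => z s j l).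
Proof. by move=> z2 j l; rewrite (ord1 j). Qed.

Lemma sqi_cfun {d'} {S : measurableType d'} (mu : {finite_measure set S -> \bar R})
    (tt : S -> R) (x a : S -> 'rV[R]_d) i k : measurable_fun setT tt ->
  (forall l, sqi mu (fun s => x s 0 l)) -> (forall l, sqi mu (fun s => a s 0 l)) ->
  sqi mu (fun s => cfun i k (tt s) (x s) (a s)).
Proof.
move=> mt x2 a2; have [K K0 hK] := grad_snd_growth (cL i) (A_L_bounded hA i).
have [K' K'0 hK'] := bracket_grad_growth (A_F_C2 hA) (A_F_bounded hA).
apply: (sqi_growth2 (s2 x2) (s2 a2) (K := n%:R^-1 * K + K')) => [||s].
- by apply: measurable_cfun => // l; [case: (x2 l)|case: (a2 l)].
- by rewrite addr_ge0// mulr_ge0.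
- rewrite /cfun (le_trans (ler_normD _ _))// [leRHS]mulrDl lerD//.
    rewrite normrM ger0_norm// -mulrA ler_wpM2l//; exact: (hK _ _ k).2.
  apply: (le_trans (hK' _ i k (x s) (clip_itv T_ge0 (tt s)))).
  by rewrite ler_wpM2l// lerDl.
Qed.

Lemma sqi_afun {d'} {S : measurableType d'} (mu : {finite_measure set S -> \bar R})
    (x a : S -> 'rV[R]_d) i k :
  (forall l, sqi mu (fun s => x s 0 l)) -> (forall l, sqi mu (fun s => a s 0 l)) ->
  sqi mu (fun s => afun i k (x s) (a s)).
Proof.
move=> x2 a2; have [K K0 hK] := grad_snd_growth (cL i) (A_L_bounded hA i).
apply: (sqi_growth2 (s2 x2) (s2 a2) (K := n%:R^-1 * K)) => [||s].
- by apply: measurable_afun => // l; [case: (x2 l)|case: (a2 l)].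
- by rewrite mulr_ge0.
- by rewrite /afun normrM ger0_norm// -mulrA ler_wpM2l//; exact: (hK _ _ k).1.
Qed.

Lemma sqi_gfun {d'} {S : measurableType d'} (mu : {finite_measure set S -> \bar R})
    (x : S -> 'rV[R]_d) i k :
  (forall l, sqi mu (fun s => x s 0 l)) -> sqi mu (fun s => gfun i k (x s)).
Proof.
move=> x2; have [K' K'0 hK'] := bracket_grad_growth (A_G_C2 hA) (A_G_bounded hA).
apply: (sqi_growth (s2 x2) (K := K')) => // [|s]; last exact: hK' T_itv.
by apply: measurable_gfun => l; case: (x2 l).
Qed.

(** Strong convexity of [L^i] along [(x' - x, a' - a)] and monotonicity of the bracket of [D_i F]
    with the laws frozen. The constant is [n^-1 C], from the weight of [L^i] in the cost. *)
Lemma cfun_afun_mono : exists2 C, 0 < C & forall i t x a x' a',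
  C * sqnorm (a' - a) <= \sum_k ((cfun i k t x' a' - cfun i k t x a) * (x' - x) 0 k +
    (afun i k x' a' - afun i k x a) * (a' - a) 0 k).
Proof.
have [C [C0 hC]] := A_L_convex hA.
(* For [n = 0] there is no index [i], but [n^-1] is 0 and [n^-1 C] would not be positive. *)
have [n0|nn0] := eqVneq n 0%N.
  by exists 1 => // i; exfalso; have := leq_ltn_trans (leq0n i) (ltn_ord i); rewrite n0.
have np : (0 : R) < n%:R^-1 by rewrite invr_gt0 ltr0n lt0n.
exists (n%:R^-1 * C) => [|i t x a x' a']; first exact: mulr_gt0.
have [K hK] := X_norm.
have h1 := second_derivative_mono (x, a) (cL i) (fun z => hC i z (x' - x, a' - a)).
have eqz : (x, a) + (x' - x, a' - a) = (x', a') by congr pair; rewrite /= addrC subrK.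
have dL z : differentiable (L i) z by exact: C2_differentiable (cL i) z.
rewrite eqz (derive_grad_pair _ _ (dL _)) (derive_grad_pair _ _ (dL _)) /= in h1.
have h2 := bracket_grad_flow_mono i mXRO (sol_law hF) (fun t tI => (hK t tI).1) x x'
  (clip_itv T_ge0 t) (A_F_C2 hA) (A_F_bounded hA) (A_F_convex hA).
rewrite -mulrA; apply: (@le_trans _ _ (n%:R^-1 * (dotp (grad_fst (L i) x' a') (x' - x) +
    dotp (grad_snd (L i) x' a') (a' - a) - (dotp (grad_fst (L i) x a) (x' - x) +
    dotp (grad_snd (L i) x a) (a' - a))) +
  dotp (bracket_grad F i x' (m (clip T t)) - bracket_grad F i x (m (clip T t))) (x' - x))).
  by rewrite -[leLHS]addr0 lerD// ler_wpM2l// ltW.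
rewrite /dotp -!big_split/= -sumrB mulr_sumr -big_split/=; apply: ler_sum => k _.
have alg (q f1 f0 g1 g0 b1 b0 u v : R) :
    q * (f1 * u + g1 * v - (f0 * u + g0 * v)) + (b1 - b0) * u =
    (q * f1 + b1 - (q * f0 + b0)) * u + (q * g1 - q * g0) * v by ring.
have e := mxB (bracket_grad F i x' (m (clip T t))) (bracket_grad F i x (m (clip T t))) 0 k.
by rewrite e alg lexx.
Qed.

Lemma gfun_mono i x x' : 0 <= \sum_k (gfun i k x' - gfun i k x) * (x' - x) 0 k.
Proof.
have [K hK] := X_norm.
have := bracket_grad_flow_mono i mXRO (sol_law hF) (fun t tI => (hK t tI).1) x x'
  T_itv (A_G_C2 hA) (A_G_bounded hA) (A_G_convex hA).
rewrite /dotp => h; apply: le_trans h _; apply: ler_sum => k _.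
by rewrite /gfun (mxB (bracket_grad _ _ _ _)).
Qed.

Let n_neq0 (i : 'I_n) : n%:R != 0 :> R.
Proof. by rewrite pnatr_eq0 -lt0n; exact: leq_ltn_trans (leq0n i) (ltn_ord i). Qed.

Lemma afun_feedback i k t w : afun i k (row i (X t w)) (row i (alpha t w)) = - Y t w i k.
Proof.
have -> : row i (alpha t w) = - grad_snd (H i) (row i (X t w)) (n%:R *: row i (Y t w)).
  by apply/rowP => l; rewrite mxE feedbackE [RHS]mxE.
rewrite /afun (hamiltonian_foc (A_H_def hA i) (cL i) (cH i) (A_H_bounded hA i)).
by rewrite !mxE mulrN mulrA mulVf ?mul1r//; exact: n_neq0 i.
Qed.

Definition csol i k (p : RO) : R :=
  cfun i k p.1 (row i (X (clip T p.1) p.2)) (row i (alpha (clip T p.1) p.2)).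

Definition rsol i k (p : RO) : R :=
  afun i k (row i (X (clip T p.1) p.2)) (row i (alpha (clip T p.1) p.2)) +
  J (csol i k) p + gfun i k (row i (X T p.2)).

Lemma csol_sqi i k : sqi Q (csol i k).
Proof.
apply: sqi_cfun => [|l|l]; first exact: measurable_fst.
  by under eq_fun => p do rewrite mxE; exact: X_sqiQ.
by under eq_fun => p do rewrite mxE; exact: feedback_sqiQ.
Qed.

Lemma gfun_sqi i k : sqi P (fun w => gfun i k (row i (X T w))).
Proof. by apply: sqi_gfun => l; under eq_fun => w do rewrite mxE; exact: X_sqi T_itv. Qed.

Lemma rsol_sqi i k : sqi Q (rsol i k).
Proof.
apply: sqiD; last exact: sqi_fst (gfun_sqi i k).
apply: sqiD; last first.
  by apply: sqi_Kint; [exact: measurable_swapK measurable_kle|move=> p; exact: kle_le1|exact: csol_sqi].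
apply: sqi_afun => l; under eq_fun => p do rewrite mxE; [exact: X_sqiQ|exact: feedback_sqiQ].
Qed.

Lemma rsol_ito i : exists N : 'I_d -> 'I_d -> R -> Omega -> R,
  (forall k l, ito_integral P T full (fun t w => Z i t w k l)
                 (fun t w => component i W t w 0 l) (N k l)) /\
  {ae P, forall w, forall t, t \in `[0, T] -> forall k,
    rsol i k (t, w) = \sum_l (N k l T w - N k l t w)}.
Proof.
have [M [[N [hN MN]] hY]] := sol_backward hF i; exists N; split=> //.
apply: filterS hY => w hw t tI k.
have := congr1 (fun v : 'rV[R]_d => v 0 k) (hw t tI); rewrite [LHS]mxE.
rewrite [RHS]mxB [X in X - _]mxE mxB !MN -sumrB => E.
rewrite /rsol /= clipE// afun_feedback.
have -> : J (csol i k) (t, w) = (integral_rV `[t, T] (fun s =>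
    n%:R^-1 *: grad_fst (L i) (row i (X s w)) (row i (alpha s w)) +
    bracket_grad F i (row i (X s w)) (m s))) 0 k.
  rewrite [RHS]mxE Rintegral_future//; apply: eq_Rintegral => s _ /=.
  by congr (_ * _); rewrite [RHS]mxE [X in _ = X + _]mxE.
by rewrite E /gfun; ring.
Qed.

Lemma forward_equation i : {ae P, forall w, forall t, t \in `[0, T] -> forall k,
  X t w i k = xi w i k + Kint lam kle (fun p : RO => alpha (clip T p.1) p.2 i k) (t, w) + W t w i k}.
Proof.
apply: filterS (sol_forward hF) => w h t tI k.
have := congr1 (fun v : 'rV[R]_d => v 0 k) (h t tI i).
rewrite [LHS]mxE [RHS]mxE [X in X + _]mxE [X in X + _ + _]mxE [X in _ + X]mxE => ->.
congr (_ + _ + _); rewrite mxE (Rintegral_past _ tI).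
by apply: eq_Rintegral => s _; rewrite mxE.
Qed.

Lemma xi_sqi i k : sqi P (fun w => xi w i k).
Proof.
split.
  have sF := set_F0_sigma hS.
  have := measurable_fun_sub (set_F0_measurable hS) sF ((measurable_wrt_mxP sF _).1 (set_xi_measurable hS) i k).
  by [].
apply: le_lt_trans (set_xi_square hS); apply: (@le_integral_ae _ _ _ P set0) => // w _.
by rewrite lee_fin sq_le_sqnorm.
Qed.

(** By the forward equation [W^i_t] is almost surely [X^i_t - xi^i] minus the time integral of the
    control, so its square integrability is inherited from the solution. *)
Lemma W_sqi t i k : t \in `[0, T] -> sqi P (fun w => W t w i k).
Proof.
move=> tI; have /andP[t0 tT] : 0 <= t <= T by move: tI; rewrite in_itv.
have sm := sigma_algebra_measurable Omega.
apply: (sqi_ae _ (sqiB (sqiB (X_sqi i k tI) (xi_sqi i k))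
   (sqi_Kint_section mkle kle1 t (feedback_sqiQ i k)))).
  have := (measurable_wrt_mxP sm (W t)).1 (W_measurable hS t0 tT) i k.
  by apply: measurable_fun_sub.
by apply: filterS (forward_equation i) => w h; rewrite h//; ring.
Qed.

Lemma W_sq_bound i k : exists C : R, forall t : R, t \in `[0, T] ->
  (\int[P]_w ((W t w i k) ^+ 2)%:E <= C%:E)%E.
Proof.
have [C hC] := coord_moment.
have a2 := feedback_sqiQ i k.
pose a (p : RO) := alpha (clip T p.1) p.2 i k.
pose c := fine (lam setT) * \int[Q]_p (a p ^+ 2).
pose e := \int[P]_w (xi w i k ^+ 2).
(* The factor 3 comes from (x - y - z)^2 <= 3 (x^2 + y^2 + z^2). *)
exists (3 * (C + e + c)) => t tI.
have K2 := sqi_Kint_section mkle kle1 t a2.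
have x2 := X_sqi i k tI; have xi2 := xi_sqi i k; have w2 := W_sqi i k tI.
have hK : \int[P]_w (Kint lam kle a (t, w) ^+ 2) <= c.
  rewrite -lee_fin EFin_Rintegral; last exact: sqi_sq.
  apply: (le_trans (sq_Kint_le mkle kle1 t a2)).
  rewrite /c EFinM fineK ?fin_num_measure// EFin_Rintegral//; exact: sqi_sq.
have hX : \int[P]_w (X t w i k ^+ 2) <= C.
  rewrite -lee_fin EFin_Rintegral; last exact: sqi_sq.
  exact: (hC t i k tI).1.
rewrite -EFin_Rintegral; last exact: sqi_sq.
rewrite lee_fin.
have mW : measurable_fun setT (fun w => W t w i k) by case: w2.
have mV : measurable_fun setT (fun w => X t w i k - xi w i k - Kint lam kle a (t, w)).
  by case: (sqiB (sqiB x2 xi2) K2).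
rewrite (ae_eq_Rintegral (mu := P) (g := fun w => (X t w i k - xi w i k - Kint lam kle a (t, w)) ^+ 2)).
- apply: (@le_trans _ _ (\int[P]_w (3 * (X t w i k ^+ 2 + xi w i k ^+ 2 + Kint lam kle a (t, w) ^+ 2)))).
    apply: le_Rintegral => //.
    + exact: sqi_sq (sqiB (sqiB x2 xi2) K2).
    + by apply: intgZ; apply: intgD; [apply: intgD|]; exact: sqi_sq.
    + move=> w _; set x := X _ _ _ _; set y := xi _ _ _; set z := Kint _ _ _ _.
      by have := sqr_ge0 (x + y); have := sqr_ge0 (x + z); have := sqr_ge0 (y - z); nra.
  rewrite RintegralZl//; last by apply: intgD; [apply: intgD|]; exact: sqi_sq.
  rewrite RintegralD//; [|by apply: intgD; exact: sqi_sq|exact: sqi_sq].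
  rewrite RintegralD//; [|exact: sqi_sq|exact: sqi_sq].
  by rewrite ler_wpM2l// !lerD.
- exact: measurable_funX.
- exact: measurable_funX.
- by apply: filterS (forward_equation i) => w h; rewrite h// -/a; congr (_ ^+ 2); ring.
Qed.

(** The condition on [f] is isolated because it is met in two ways: through [ito_orth] for adapted
    [f], and through [ito_proj] for the projected control, which may anticipate. *)
Lemma rsol_orth i k (f : RO -> R) : sqi Q f ->
  (forall l K N, ito_integral P T full K (fun t w => component i W t w 0 l) N ->
    {ae lam, forall s : TR, \int[P]_w (f (s, w) * (N T w - N s w)) = 0}) ->
  \int[Q]_p (f p * rsol i k p) = 0.
Proof.
move=> f2 h; have r2 := rsol_sqi i k.
have [N [hN rN]] := rsol_ito i.
have dB l t : t \in `[0, T] -> sqi P (fun w => N k l T w - N k l t w).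
  by move=> tI; apply: sqiB; apply: (ito_sqi hS W_sqi (hN k l)) => //; exact: T_itv.
apply: Rintegral_fprodm_ae0; first exact: sqiM.
have hall : {ae lam, forall s : TR, forall l, \int[P]_w (f (s, w) * (N k l T w - N k l s w)) = 0}.
  by apply: filter_forall => l; exact: h (hN k l).
apply: (ae_time2 (filterI (filterI (ae_sqi1 f2) (ae_sqi1 r2)) hall)) => s sI [[fs rs] hs].
have mD : measurable_fun setT (fun w => \sum_l (N k l T w - N k l s w)).
  by apply: measurable_sum => l; case: (dB l s sI).
transitivity (\int[P]_w (f (s, w) * \sum_l (N k l T w - N k l s w))).
  apply: ae_eq_Rintegral.
  - by apply: measurable_funM; [case: fs|case: rs].
  - by apply: measurable_funM => //; case: fs.
  - by apply: filterS rN => w hw; rewrite hw.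
under eq_Rintegral => w _ do rewrite mulr_sumr.
rewrite Rintegral_sum; first by apply: big1 => l _.
by move=> l; apply: sqiM => //; exact: dB.
Qed.

Lemma rsol_orth_adapted i k (f : RO -> R) : sqi Q f ->
  (forall s : R, s \in `[0, T] ->
    measurable_fun setT ((fun w => f (s, w)) : g_sigma_algebraType (full s) -> R)) ->
  \int[Q]_p (f p * rsol i k p) = 0.
Proof.
move=> f2 mf; apply: rsol_orth => // l K N hN.
apply: (ae_time2 (ae_sqi1 f2)) => s sI fs.
by apply: (ito_orth hS W_sqi hN sI) => //; exact: mf.
Qed.

(** * The projected control *)

Section projected_control.
Variables (i : 'I_n) (at_ : 'I_d -> RO -> R).
Local Notation gO := (g_sigma_algebraType (own i T)).
Local Notation TO := (TR * gO)%type.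
Let a k (p : RO) : R := alpha (clip T p.1) p.2 i k.
Let x l (p : RO) : R := X (clip T p.1) p.2 i l.
Hypothesis mat : forall k, measurable_fun setT (at_ k : TO -> R).
Hypothesis at2 : forall k, sqi Q (at_ k).
Hypothesis proj : forall k (psi : RO -> R), measurable_fun setT (psi : TO -> R) ->
  intg Q (fun p : RO => psi p * (a k p - at_ k p)) ->
  \int[Q]_p (psi p * (a k p - at_ k p)) = 0.

Let a2 k : sqi Q (a k). Proof. exact: feedback_sqiQ. Qed.
Let mgO (f : TO -> R) : measurable_fun setT f -> measurable_fun setT (f : RO -> R).
Proof. exact: (measurable_gOfun hS). Qed.

(** With the regularised path in place of [W^i], this state is measurable for the history of
    [(xi^i, W^i)] jointly with time, and differs from the driven state on a null set of paths. *)
Definition xt l (p : RO) : R := xi p.2 i l + Kint lam kle (at_ l) p + regular_path T W i l p.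

Lemma measurable_xt l : measurable_fun setT (xt l : TO -> R).
Proof.
apply: measurable_funD; last exact: (measurable_regular_path hS).
apply: measurable_funD; last exact: (measurable_Kint lam mkle (mat l)).
have so : sigma_algebra setT (own i T) by exact: own_sigma.
have := (measurable_wrt_mxP so _).1 (@xi_own _ _ _ _ _ P W xi i T) 0 l => h.
apply: (measurableT_comp (f := (fun w => xi w i l) : gO -> R)); last exact: measurable_snd.
by apply: eq_measurable_fun h => w _; rewrite mxE.
Qed.

Let de k (p : RO) := at_ k p - a k p.
Let de2 k : sqi Q (de k). Proof. exact: sqiB. Qed.

(** Initial value and noise cancel, which leaves the time integral of the control difference. *)
Lemma xt_sub : {ae P, forall w, forall t, t \in `[0, T] -> forall l,
  xt l (t, w) - x l (t, w) = Kint lam kle (de l) (t, w)}.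
Proof.
have hB : {ae P, forall w, forall l, forall t,
    Kint lam kle (de l) (t, w) = Kint lam kle (at_ l) (t, w) - Kint lam kle (a l) (t, w)}.
  by apply: filter_forall => l; exact: (KintB mkle kle1).
have hbad : {ae P, forall w, ~ bad_paths T W i w}.
  by have := negligible_bad_paths hS i; apply: negligibleS => w /= /contrapT.
apply: filterS3 (forward_equation i) hB hbad => w hf hb nb t tI l.
rewrite /xt /x /= regular_pathE// clipE// hf// hb; ring.
Qed.

Lemma xt_sqi l : sqi Q (xt l).
Proof.
have mx := measurable_xt l; apply: (sqi_ae (mgO mx)
  (sqiD (X_sqiQ i l) (sqi_Kint mkle kle1 (de2 l)))).
have := @ae_fprodm_time _ _ _ P T (fun t w => forall l, xt l (t, w) = x l (t, w) + Kint lam kle (de l) (t, w)).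
move=> h; apply: filterS (h _) => [[t w]/= ->//|].
by apply: filterS xt_sub => w h' t tI l'; rewrite -h'//; ring.
Qed.

Let rv (f : 'I_d -> RO -> R) (p : RO) : 'rV[R]_d := \row_l f l p.

Let rvE f p l : rv f p 0 l = f l p. Proof. by rewrite mxE. Qed.

Let row_x p : row i (X (clip T p.1) p.2) = rv x p.
Proof. by apply/rowP => l; rewrite !mxE. Qed.

Let row_a p : row i (alpha (clip T p.1) p.2) = rv a p.
Proof. by apply/rowP => l; rewrite [LHS]mxE [RHS]mxE. Qed.

Definition ct k (p : RO) : R := cfun i k p.1 (rv xt p) (rv at_ p).

(** The expression [rsol] along the projected pair. It depends on time and the history of
    [(xi^i, W^i)] only, which is what [proj] asks of a test function. *)
Definition rt k (p : RO) : R :=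
  afun i k (rv xt p) (rv at_ p) + J (ct k) p + gfun i k (rv xt ((T : TR), p.2)).

Lemma measurable_ct k : measurable_fun setT (ct k : TO -> R).
Proof.
apply: (measurable_cfun (S := TO)) => [|l|l]; first exact: measurable_fst.
  by under eq_fun => p do rewrite rvE; exact: measurable_xt.
by under eq_fun => p do rewrite rvE; exact: mat.
Qed.

Let measurable_gt k : measurable_fun setT ((fun w => gfun i k (rv xt ((T : TR), w))) : gO -> R).
Proof.
apply: (measurable_gfun (S := gO)) => l.
under eq_fun => p do rewrite rvE; exact: (measurable_section1 (T : TR) (measurable_xt l)).
Qed.

Lemma measurable_rt k : measurable_fun setT (rt k : TO -> R).
Proof.
apply: measurable_funD; last first.
  by apply: (measurableT_comp (f := _ : gO -> R) (measurable_gt k)); exact: measurable_snd.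
apply: measurable_funD.
  apply: (measurable_afun (S := TO)) => l; under eq_fun => p do rewrite rvE;
    [exact: measurable_xt|exact: mat].
exact: (measurable_Kint lam (measurable_swapK mkle) (measurable_ct k)).
Qed.

Lemma ct_sqi k : sqi Q (ct k).
Proof.
apply: (sqi_cfun) => [|l|l]; first exact: measurable_fst.
  by under eq_fun => p do rewrite rvE; exact: xt_sqi.
by under eq_fun => p do rewrite rvE; exact: at2.
Qed.

Let xtT2 l : sqi P (fun w => xt l ((T : TR), w)).
Proof.
have mx : measurable_fun setT ((fun w => xt l ((T : TR), w)) : Omega -> R).
  exact: (measurable_section1 (T : TR) (mgO (measurable_xt l))).
apply: (sqi_ae mx (sqiD (X_sqi i l (T_itv)) (sqi_Kint_section mkle kle1 (T : TR) (de2 l)))).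
apply: filterS xt_sub => w h; rewrite -h ?(T_itv)// /x /= clipE ?(T_itv)//; ring.
Qed.

Let gt2 k : sqi P (fun w => gfun i k (rv xt ((T : TR), w))).
Proof. by apply: (sqi_gfun) => l; under eq_fun => p do rewrite rvE; exact: xtT2. Qed.

Let Jct_sqi k : sqi Q (J (ct k)).
Proof. exact: (sqi_Kint (measurable_swapK mkle) sK1 (ct_sqi k)). Qed.

Let aft2 k : sqi Q (fun p => afun i k (rv xt p) (rv at_ p)).
Proof.
apply: (sqi_afun) => l; under eq_fun => p do rewrite rvE; [exact: xt_sqi|exact: at2].
Qed.

Lemma rt_sqi k : sqi Q (rt k).
Proof. by apply: sqiD; [apply: sqiD|exact: (sqi_fst lam (gt2 k))]. Qed.

Lemma de_rt k : \int[Q]_p (de k p * rt k p) = 0.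
Proof.
have e p : de k p * rt k p = - (rt k p * (a k p - at_ k p)) by rewrite /de; ring.
under eq_Rintegral => p _ do rewrite e -mulN1r.
rewrite RintegralZl//; last exact: sqiM (rt_sqi k) (sqiB (a2 k) (at2 k)).
by rewrite proj ?mulr0//; [exact: measurable_rt|exact: sqiM (rt_sqi k) (sqiB (a2 k) (at2 k))].
Qed.

Lemma de_rsol k : \int[Q]_p (de k p * rsol i k p) = 0.
Proof.
have r2 := rsol_sqi i k.
have a_full (s : R) : s \in `[0, T] ->
    measurable_fun setT ((fun w => a k (s, w)) : g_sigma_algebraType (full s) -> R).
  move=> sI; apply: eq_measurable_fun (feedback_full i k sI) => w _.
  by rewrite /a /= clipE.
have e p : de k p * rsol i k p = at_ k p * rsol i k p - a k p * rsol i k p by rewrite /de mulrBl.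
under eq_Rintegral => p _ do rewrite e.
rewrite RintegralB//; [|exact: sqiM..].
rewrite rsol_orth//; last first.
  by move=> l K N hN; exact: (ito_proj hS W_sqi W_sq_bound (a2 k) (at2 k) (mat k) a_full (@proj k) hN).
by rewrite rsol_orth_adapted ?subr0.
Qed.

Let rsolE k p : rsol i k p = afun i k (rv x p) (rv a p) + J (csol i k) p +
  gfun i k (row i (X T p.2)).
Proof. by rewrite -row_x -row_a. Qed.

Let csolE k p : csol i k p = cfun i k p.1 (rv x p) (rv a p).
Proof. by rewrite -row_x -row_a. Qed.

Let c2 k : sqi Q (csol i k). Proof. exact: csol_sqi. Qed.
Let g2 k : sqi P (fun w => gfun i k (row i (X T w))). Proof. exact: gfun_sqi. Qed.
Let af2 k : sqi Q (fun p => afun i k (rv x p) (rv a p)).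
Proof.
by apply: (sqi_afun) => l; under eq_fun => p do rewrite rvE; [exact: X_sqiQ|exact: a2].
Qed.

(** Transposition moves the time integral from the drift onto [de], where [xt_sub] recognises the
    state difference. *)
Lemma de_cross k : \int[Q]_p (de k p * J (fun q => ct k q - csol i k q) p) =
  \int[Q]_p ((ct k p - csol i k p) * (xt k p - x k p)).
Proof.
rewrite -(Kint_transpose mkle kle1 (de2 k) (sqiB (ct_sqi k) (c2 k))).
apply: ae_eq_Rintegral.
- apply: measurable_funM; first by case: (sqiB (ct_sqi k) (c2 k)).
  by case: (sqi_Kint mkle kle1 (de2 k)).
- apply: measurable_funM; first by case: (sqiB (ct_sqi k) (c2 k)).
  by case: (sqiB (xt_sqi k) (X_sqiQ i k)).
- have := @ae_fprodm_time _ _ _ P T (fun t w => forall l, xt l (t, w) - x l (t, w) = Kint lam kle (de l) (t, w)).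
  move=> h; apply: filterS (h _) => [[t w]/= ->//|].
  exact: xt_sub.
Qed.

Lemma de_terminal k :
  \int[Q]_p (de k p * (gfun i k (rv xt ((T : TR), p.2)) - gfun i k (row i (X T p.2)))) =
  \int[P]_w ((gfun i k (rv xt ((T : TR), w)) - gfun i k (row i (X T w))) *
    (xt k ((T : TR), w) - X T w i k)).
Proof.
have dg2 : sqi P (fun w => gfun i k (rv xt ((T : TR), w)) - gfun i k (row i (X T w))) by exact: sqiB.
rewrite (Kint_terminal (de2 k) dg2); apply: ae_eq_Rintegral.
- apply: measurable_funM; first by case: dg2.
  by case: (sqi_Kint_section mkle kle1 (T : TR) (de2 k)).
- apply: measurable_funM; first by case: dg2.
  by case: (sqiB (xtT2 k) (X_sqi i k (T_itv))).
- apply: filterS xt_sub => w h; congr (_ * _).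
  by rewrite -(h T (T_itv) k) /x /= clipE ?(T_itv).
Qed.

(** The integrals of [de (rt - rsol)] vanish. Summed over the coordinates and expanded with
    [de_cross] and [de_terminal], they give the integral of [q], the expression of [cfun_afun_mono],
    plus a terminal term that is nonnegative by [gfun_mono]. As [q] dominates [C] times the squared
    control difference, this difference is null. *)
Lemma projected_control_eq k : {ae Q, forall p, at_ k p = a k p}.
Proof.
have [C C0 hC] := cfun_afun_mono.
pose D k p := afun i k (rv xt p) (rv at_ p) - afun i k (rv x p) (rv a p).
pose g w k := gfun i k (rv xt ((T : TR), w)) - gfun i k (row i (X T w)).
pose q p := \sum_k ((ct k p - csol i k p) * (xt k p - x k p) + D k p * de k p).
have D2 l : sqi Q (D l) by exact: sqiB.
have cc2 l : sqi Q (fun p => ct l p - csol i l p) by exact: sqiB (ct_sqi l) (c2 l).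
have xx2 l : sqi Q (fun p => xt l p - x l p) by exact: sqiB (xt_sqi l) (X_sqiQ i l).
have ql l : intg Q (fun p => (ct l p - csol i l p) * (xt l p - x l p) + D l p * de l p).
  exact: intgD (sqiM (cc2 l) (xx2 l)) (sqiM (D2 l) (de2 l)).
have q1 : intg Q q by exact: intg_sum.
have tot : \sum_l \int[Q]_p (de l p * (rt l p - rsol i l p)) = 0.
  apply: big1 => l _; under eq_Rintegral => p _ do rewrite mulrBr.
  rewrite RintegralB//; [|exact: sqiM (de2 l) (rt_sqi l)|exact: sqiM (de2 l) (rsol_sqi i l)].
  transitivity (0 - 0 : R); last by rewrite subrr.
  by congr (_ - _); [exact: de_rt|exact: de_rsol].
have dJ l : {ae Q, forall p, J (fun r => ct l r - csol i l r) p = J (ct l) p - J (csol i l) p}.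
  have h0 := KintB (measurable_swapK mkle) sK1 (ct_sqi l) (c2 l).
  have := @ae_fprodm_time _ _ _ P T (fun t w => J (fun r => ct l r - csol i l r) (t, w) =
    J (ct l) (t, w) - J (csol i l) (t, w)).
  move=> h; apply: filterS (h _) => [[t w]//|].
  by apply: filterS h0 => w hw t _.
have Jd2 l : sqi Q (J (fun r => ct l r - csol i l r)).
  exact: (sqi_Kint (measurable_swapK mkle) sK1 (sqiB (ct_sqi l) (c2 l))).
have dg2 l : sqi P (fun w => g w l) by exact: sqiB.
have dg2Q l : sqi Q (fun p : RO => g p.2 l) by exact: sqi_fst (dg2 l).
have each l : \int[Q]_p (de l p * (rt l p - rsol i l p)) =
    \int[Q]_p ((ct l p - csol i l p) * (xt l p - x l p) + D l p * de l p) +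
    \int[P]_w (g w l * (xt l ((T : TR), w) - X T w i l)).
  rewrite -de_terminal (RintegralD _ (sqiM (cc2 l) (xx2 l)) (sqiM (D2 l) (de2 l)))//.
  rewrite -de_cross -(RintegralD _ (sqiM (de2 l) (Jd2 l)) (sqiM (D2 l) (de2 l)))//.
  rewrite -(RintegralD _ (intgD (sqiM (de2 l) (Jd2 l)) (sqiM (D2 l) (de2 l))) (sqiM (de2 l) (dg2Q l)))//.
  apply: ae_eq_Rintegral.
  - apply: measurable_funM; first by case: (de2 l).
    by case: (sqiB (rt_sqi l) (rsol_sqi i l)).
  - exact: intg_measurable (intgD (intgD (sqiM (de2 l) (Jd2 l)) (sqiM (D2 l) (de2 l))) (sqiM (de2 l) (dg2Q l))).
  - have alg (e a1 a0 j1 j0 g1 g0 dj : R) : dj = j1 - j0 ->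
      e * ((a1 + j1 + g1) - (a0 + j0 + g0)) = e * dj + (a1 - a0) * e + e * (g1 - g0).
      by move=> ->; ring.
    by apply: filterS (dJ l) => p hp; rewrite rsolE; exact: (alg _ _ _ _ _ _ _ _ hp).
have gpos : 0 <= \sum_l \int[P]_w (g w l * (xt l ((T : TR), w) - X T w i l)).
  rewrite -Rintegral_sum; last first.
    by move=> l; exact: sqiM (dg2 l) (sqiB (xtT2 l) (X_sqi i l (T_itv))).
  apply: Rintegral_ge0 => w _.
  have := gfun_mono i (row i (X T w)) (rv xt ((T : TR), w)).
  by congr (_ <= _); apply: eq_bigr => l _; rewrite mxB !mxE.
have qle : \int[Q]_p q p <= 0.
  rewrite Rintegral_sum; last exact: ql.
  by move: tot; under eq_bigr => l _ do rewrite each; rewrite big_split/= => tot; lra.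
pose N p := \sum_l de l p ^+ 2.
have N1 : intg Q N by apply: intg_sum => l; exact: sqi_sq.
have N0 p : 0 <= N p by apply: sumr_ge0 => l _; exact: sqr_ge0.
have Nq p : C * N p <= q p.
  have := hC i p.1 (rv x p) (rv a p) (rv xt p) (rv at_ p).
  have -> : sqnorm (rv at_ p - rv a p) = N p.
    by rewrite /sqnorm big_ord1; apply: eq_bigr => l _; rewrite mxB !mxE.
  move=> h; apply: (le_trans h); rewrite le_eqVlt; apply/orP; left; apply/eqP.
  by apply: eq_bigr => l _; rewrite !mxB !rvE csolE.
have Nint : \int[Q]_p N p = 0.
  apply/le_anti/andP; split; last by apply: Rintegral_ge0.
  rewrite -(pmulr_rle0 _ C0) -RintegralZl//; apply: le_trans qle.
  by apply: le_Rintegral => //; exact: intgZ.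
apply: filterS (Rintegral_cvg0_ge0 N1 N0 Nint) => p Np.
have : de k p ^+ 2 <= 0.
  by rewrite -Np /N (bigD1 k)//= lerDl; apply: sumr_ge0 => l _; exact: sqr_ge0.
by move=> h; apply/eqP; rewrite -subr_eq0 -sqrf_eq0 eq_le h sqr_ge0.
Qed.

Let de0 k : {ae Q, forall p, de k p = 0}.
Proof. by apply: filterS (projected_control_eq k) => p h; rewrite /de h subrr. Qed.

Let so t : sigma_algebra setT (own i t). Proof. exact: own_sigma. Qed.
Let neg_own : P.-negligible `<=` own i T. Proof. exact: negligible_own. Qed.

(** [Kint_ae0] at a fixed [t] turns equality of the controls almost everywhere into almost sure
    equality of the states at that time. *)
Lemma state_own_T l t : t \in `[0, T] -> measurable_fun setT ((fun w => X t w i l) : gO -> R).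
Proof.
move=> tI; apply: (ae_measurableG (so T) neg_own (measurable_section1 (t : TR) (measurable_xt l))).
apply: filterS2 xt_sub (Kint_ae0 mkle kle1 (t : TR) (de2 l) (de0 l)) => w h h0.
have := h t tI l; rewrite h0 /x /= clipE// => /eqP; rewrite subr_eq0 => /eqP.
by move=> ->.
Qed.

(** [own_descent] with the state itself as [eta]: it is known both for [full t] and for
    [own i T]. *)
Lemma state_own l t : t \in `[0, T] ->
  measurable_fun setT ((fun w => X t w i l) : g_sigma_algebraType (own i t) -> R).
Proof.
move=> tI; have /andP[t0 tT] : 0 <= t <= T by move: tI; rewrite in_itv.
have x2 := X_sqi i l tI.
apply: (own_descent hS t0 tT x2 x2).
- exact: (progressive_adapted i l (sol_X_progressive hF) tI).
- exact: state_own_T.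
- move=> phi _ _; under eq_Rintegral => w _ do rewrite subrr mulr0.
  by rewrite /Rintegral integral0.
Qed.

Let ct_csol k : {ae Q, forall p, ct k p = csol i k p}.
Proof.
have hK l : {ae Q, forall p, Kint lam kle (de l) p = 0}.
  have K2 := sqi_Kint mkle kle1 (de2 l).
  have : \int[Q]_p (Kint lam kle (de l) p ^+ 2) = 0.
    apply: Rintegral_fprodm_ae0; first exact: sqi_sq.
    apply: aeW => t; rewrite (ae_eq_Rintegral (mu := P) (g := fun=> 0)).
    - by rewrite /Rintegral integral0.
    - by apply: measurable_funX; case: (sqi_Kint_section mkle kle1 t (de2 l)).
    - exact: measurable_cst.
    - apply: filterS (Kint_ae0 mkle kle1 t (de2 l) (de0 l)) => w ->.
      by rewrite expr0n.
  move/(Rintegral_cvg0_ge0 (sqi_sq K2) (fun=> sqr_ge0 _)).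
  by apply: filterS => p /eqP; rewrite sqrf_eq0 => /eqP.
have hx := @ae_fprodm_time _ _ _ P T (fun t w => forall l, xt l (t, w) - x l (t, w) = Kint lam kle (de l) (t, w)) xt_sub.
have hKa : {ae Q, forall p, forall l, Kint lam kle (de l) p = 0} by exact: filter_forall.
have hda : {ae Q, forall p, forall l, de l p = 0} by exact: filter_forall.
apply: filterS3 hx hKa hda => -[t w] /= hx0 hK0 hd0.
have e1 : rv xt (t, w) = rv x (t, w).
  by apply/rowP => l; rewrite 2!rvE; apply/eqP; rewrite -subr_eq0 hx0 hK0.
have e2 : rv at_ (t, w) = rv a (t, w).
  by apply/rowP => l; rewrite 2!rvE; apply/eqP; rewrite -subr_eq0; apply/eqP; exact: hd0.
by rewrite /ct e1 e2 csolE.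
Qed.

(** By the backward equation [Y^i_t - eta] is minus the future increment of a stochastic integral,
    orthogonal to [full t]. The remaining drift in [eta] is written with [ct] instead of [csol], so
    that [eta] is measurable for [own i T]. *)
Lemma costate_own k t : t \in `[0, T] ->
  measurable_fun setT ((fun w => Y t w i k) : g_sigma_algebraType (own i t) -> R).
Proof.
move=> tI; have /andP[t0 tT] : 0 <= t <= T by move: tI; rewrite in_itv.
pose eta w := J (ct k) ((t : TR), w) + gfun i k (row i (X T w)).
have Jt2 := sqi_Kint_section (measurable_swapK mkle) sK1 (t : TR) (ct_sqi k).
have eta2 : sqi P eta by exact: sqiD Jt2 (g2 k).
have y2 := Y_sqi i k tI.
have [N [hN rN]] := rsol_ito i.
have N2 l s : s \in `[0, T] -> sqi P (N k l s) by move=> sI; exact: (ito_sqi hS W_sqi (hN k l)).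
apply: (own_descent hS t0 tT y2 eta2).
- exact: (progressive_adapted i k (sol_Y_progressive hF) tI).
- apply: measurable_funD.
    exact: (measurable_section1 (t : TR) (measurable_Kint lam (measurable_swapK mkle) (measurable_ct k))).
  apply: (measurable_gfun (S := gO)) => l; under eq_fun => w do rewrite mxE.
  exact: state_own_T.
- move=> phi mphi [c hc].
  have fm : full t `<=` measurable by exact: (full_measurable hS tT).
  have mphiO := measurable_fun_sub fm (full_sigma _ _ _ _) mphi.
  have phi2 := sqi_bounded P mphiO hc.
  have J0 : {ae P, forall w, J (fun q => ct k q - csol i k q) ((t : TR), w) = 0}.
    apply: (Kint_ae0 (measurable_swapK mkle) sK1 _ (sqiB (ct_sqi k) (c2 k))).
    by apply: filterS (ct_csol k) => p ->; rewrite subrr.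
  have JB := KintB (measurable_swapK mkle) sK1 (ct_sqi k) (c2 k).
  transitivity (\int[P]_w (\sum_l - (phi w * (N k l T w - N k l t w)))).
    apply: ae_eq_Rintegral.
    + by apply: measurable_funM => //; case: (sqiB y2 eta2).
    + apply: measurable_sum => l; apply: measurable_funN; apply: measurable_funM => //.
      by case: (sqiB (N2 l T TI) (N2 l t tI)).
    + apply: filterS3 rN J0 JB => w hr h0 hB.
      have := hr t tI k; have -> : rsol i k (t, w) = - Y t w i k + J (csol i k) (t, w) + gfun i k (row i (X T w)).
        by rewrite /rsol /= clipE// (afun_feedback).
      have := hB (t : TR); rewrite h0 => /esym/eqP; rewrite subr_eq0 => /eqP hJ.
      have alg (e y j g s : R) : - y + j + g = s -> e * (y - (j + g)) = - (e * s).
        by move=> <-; ring.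
      by rewrite sumrN -mulr_sumr => e; rewrite /eta hJ; exact: alg e.
  rewrite Rintegral_sum; last first.
    by move=> l; have := intgZ (-1) (sqiM phi2 (sqiB (N2 l T TI) (N2 l t tI)));
      apply: eq_integrable => // w _; rewrite /comp mulN1r.
  apply: big1 => l _; under eq_Rintegral => w _ do rewrite -mulN1r.
  rewrite RintegralZl//; last exact: sqiM phi2 (sqiB (N2 l T TI) (N2 l t tI)).
  by rewrite (ito_orth hS W_sqi (hN k l) tI mphi phi2) mulr0.
Qed.

End projected_control.

(** * Adaptedness of the feedback and conditional means of the coupling terms *)

Local Notation gO i := (g_sigma_algebraType (own i T)).

(** Conditional expectation, under the product of time and probability, along the identity into the
    coarser space [TR * gO i]. One application yields a version jointly measurable in time and
    history. *)
Lemma projection_exists i : exists at_ : 'I_d -> RO -> R,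
  [/\ forall k, measurable_fun setT (at_ k : TR * gO i -> R),
      forall k, sqi Q (at_ k) &
      forall k (psi : RO -> R), measurable_fun setT (psi : TR * gO i -> R) ->
        intg Q (fun p : RO => psi p * (alpha (clip T p.1) p.2 i k - at_ k p)) ->
        \int[Q]_p (psi p * (alpha (clip T p.1) p.2 i k - at_ k p)) = 0].
Proof.
have mid : measurable_fun setT (id : Omega -> gO i).
  by apply: measurable_id_sub; [exact: (own_measurable hS)|exact: own_sigma].
have mph : measurable_fun setT ((fun p => (p.1, p.2)) : RO -> (TR * gO i)%type).
  exact: (measurable_fun_pair measurable_fst (measurableT_comp mid measurable_snd)).
have h k := cond_exp_sqi mph (feedback_sqiQ i k).
have /choice[f hf] : forall k, exists f : RO -> R,
    [/\ measurable_fun setT (f : TR * gO i -> R), sqi Q f &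
      forall (psi : RO -> R), measurable_fun setT (psi : TR * gO i -> R) ->
        intg Q (fun p : RO => psi p * (alpha (clip T p.1) p.2 i k - f p)) ->
        \int[Q]_p (psi p * (alpha (clip T p.1) p.2 i k - f p)) = 0].
  move=> k; have [f [mf f2 hf]] := h k; exists f.
  have E (g : RO -> R) : (fun p : RO => g (p.1, p.2)) = g by apply/funext => -[].
  split=> //; first by move: f2; rewrite (E f).
  move=> psi mpsi; have := hf psi mpsi; rewrite /=.
  have -> : (fun p : RO => psi (p.1, p.2) * (alpha (clip T p.1) p.2 i k - f (p.1, p.2))) =
    (fun p : RO => psi p * (alpha (clip T p.1) p.2 i k - f p)) by apply/funext => -[].
  by [].
by exists f; split=> k; case: (hf k).
Qed.

Lemma feedback_own i k t : t \in `[0, T] ->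
  measurable_fun setT ((fun w => alpha t w i k) : g_sigma_algebraType (own i t) -> R).
Proof.
move=> tI; have [at_ [mat at2 proj]] := projection_exists i.
under eq_fun => w do rewrite feedbackE.
have h (x y : g_sigma_algebraType (own i t) -> 'rV[R]_d) := measurable_feedback_of i k (x := x) (y := y).
apply: (h (fun w => row i (X t w)) (fun w => row i (Y t w))) => l.
  have := state_own mat at2 proj l tI.
  by apply: eq_measurable_fun => w _; rewrite mxE.
have := costate_own mat at2 proj l tI.
by apply: eq_measurable_fun => w _; rewrite mxE.
Qed.

Lemma feedback_distributed : distributed_control P T W xi alpha.
Proof.
have ma := measurable_feedback; split.
- exact: clip_jointly_measurable ma.
- move=> i t tI; have so : sigma_algebra setT (own i t) by exact: own_sigma.
  apply/(measurable_wrt_mxP so) => j l.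
  by rewrite (ord1 j); have := @feedback_own i l t tI; apply: eq_measurable_fun => w _; rewrite /component [RHS]mxE.
- by apply/(square_control P ma) => i k; exact: feedback_sqiQ.
Qed.

(** The other states are independent of the history of [(xi^i, W^i)], so the bracket is the
    conditional expectation of [D_i f (X_t)] given that history. As [phi] may use it up to [T], the
    times of [phi] and of [X] need not be ordered. *)
Lemma own_law_orth (f : 'M[R]_(n, d) -> R) i k t (phi : Omega -> R) :
  C2 f -> bounded_second_derivatives f -> t \in `[0, T] ->
  measurable_fun setT (phi : g_sigma_algebraType (own i T) -> R) -> sqi P phi ->
  \int[P]_w (phi w * (grad_i f i (X t w) 0 k - bracket_grad f i (row i (X t w)) (m t) 0 k)) = 0.
Proof.
move=> cf bf tI mphi phi2.
have [K K0 hK] := grad_i_cont_growth cf bf; have [c1 c2] := hK i k.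
have [K' K'0 hK'] := bracket_grad_growth cf bf.
have x2 j l := X_sqi j l tI.
have [C hC] := X_norm.
have r2 : forall (j : 'I_1) l, sqi P (fun w => row i (X t w) j l).
  by move=> j l; under eq_fun => w do rewrite mxE; exact: x2.
have g2 : sqi P (fun w => grad_i f i (X t w) 0 k).
  apply: (sqi_growth x2 _ K0) => [|w]; last exact: c2.
  by apply: (measurable_cont_mx c1) => j l; case: (x2 j l).
have b2 : sqi P (fun w => bracket_grad f i (row i (X t w)) (m t) 0 k).
  apply: (sqi_growth r2 _ K'0) => [|w]; last exact: hK'.
  have := measurable_bracket_grad i k cf bf (measurable_cst (t : R))
    (fun l => let: conj h _ := r2 0 l in h).
  by apply: eq_measurable_fun => w _; rewrite /= clipE.
have oX j l : measurable_fun setT ((fun w => row j (X t w) 0 l) : g_sigma_algebraType (own j T) -> R).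
  have [at_ [mat at2 proj]] := projection_exists j.
  by apply: eq_measurable_fun (state_own_T mat at2 proj l tI) => w _; rewrite mxE.
have mE j (A : set (borelRn R d)) : measurable A ->
    m t j A = pushforward P ((fun w => row j (X t w)) : Omega -> borelRn R d) A.
  by move=> mA; rewrite (sol_law hF).
have gi x := intg_insert_at_flow i mXRO (sol_law hF) (fun t tI => (hC t tI).1) c1 K0 c2 x tI.
have E w : \matrix_j row j (X t w) = X t w by apply/matrixP => j l; rewrite !mxE.
have e1 : (fun w => phi w * grad_i f i (\matrix_j row j (X t w)) 0 k) =
    (fun w => phi w * grad_i f i (X t w) 0 k) by apply/funext => w; rewrite E.
have e2 : (fun w => phi w * bracket (m t) i (fun z => grad_i f i z 0 k) (row i (X t w))) =
    (fun w => phi w * bracket_grad f i (row i (X t w)) (m t) 0 k).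
  by apply/funext => w; rewrite [bracket_grad _ _ _ _ _ _]mxE.
have i1 := sqiM phi2 g2; have i2 := sqiM phi2 b2.
have := own_bracket hS oX mE mphi c1 gi.
rewrite e1 e2 => h; under eq_Rintegral => w _ do rewrite mulrBr.
by rewrite RintegralB// h// subrr.
Qed.

Let x2 i l : sqi Q (fun p : RO => X (clip T p.1) p.2 i l). Proof. exact: X_sqiQ. Qed.
Let a2 i l : sqi Q (fun p : RO => alpha (clip T p.1) p.2 i l). Proof. exact: feedback_sqiQ. Qed.

(** Error made when [D_i F] is replaced by its bracket along the solution; [tsol] is its terminal
    counterpart. *)
Definition fsol i k (p : RO) : R := grad_i F i (X (clip T p.1) p.2) 0 k -
  bracket_grad F i (row i (X (clip T p.1) p.2)) (m (clip T p.1)) 0 k.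

Definition tsol i k w : R := grad_i G i (X T w) 0 k - bracket_grad G i (row i (X T w)) (m T) 0 k.

Let sqi_grad {d'} {S : measurableType d'} (mu : {finite_measure set S -> \bar R})
  (f : 'M[R]_(n, d) -> R) i k (x : S -> 'M[R]_(n, d)) : C2 f -> bounded_second_derivatives f ->
  (forall j l, sqi mu (fun s => x s j l)) -> sqi mu (fun s => grad_i f i (x s) 0 k).
Proof.
move=> cf bf hx; have [K K0 hK] := grad_i_cont_growth cf bf; have [c1 c2] := hK i k.
apply: (sqi_growth hx _ K0) => [|s]; last exact: c2.
by apply: (measurable_cont_mx c1) => j l; case: (hx j l).
Qed.

Lemma fsol_sqi i k : sqi Q (fsol i k).
Proof.
have [K' K'0 hK'] := bracket_grad_growth (A_F_C2 hA) (A_F_bounded hA).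
have r2 : forall (j : 'I_1) l, sqi Q (fun p : RO => row i (X (clip T p.1) p.2) j l).
  by move=> j l; under eq_fun => w do rewrite mxE; exact: x2.
apply: sqiB; first by apply: (sqi_grad _ _ (A_F_C2 hA) (A_F_bounded hA)); exact: x2.
apply: (sqi_growth r2 _ K'0) => [|p]; last by apply: hK'; exact: (clip_itv (T_ge0)).
apply: (measurable_bracket_grad i k (A_F_C2 hA) (A_F_bounded hA) (measurable_fst : measurable_fun setT (fst : RO -> R))).
by move=> l; case: (r2 0 l).
Qed.

Lemma tsol_sqi i k : sqi P (tsol i k).
Proof.
apply: sqiB; last exact: gfun_sqi.
by apply: (sqi_grad _ _ (A_G_C2 hA) (A_G_bounded hA)) => j l; exact: (X_sqi j l TI).
Qed.

Section deviation.
Variables (i : 'I_n) (k : 'I_d) (de : RO -> R).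
Hypothesis de2 : sqi Q de.
Hypothesis de_own : forall s : R, s \in `[0, T] ->
  measurable_fun setT ((fun w => de (s, w)) : g_sigma_algebraType (own i T) -> R).

(** After transposition and Fubini, the time [s] of the deviation and the time [t] of the error can
    both be fixed. The kernel is then a constant and [own_law_orth] applies. *)
Lemma deviation_fsol : \int[Q]_p (fsol i k p * Kint lam kle de p) = 0.
Proof.
have f2 := fsol_sqi i k.
rewrite (Kint_transpose mkle kle1 de2 f2).
have Jf2 := sqi_Kint (measurable_swapK mkle) sK1 f2.
apply: Rintegral_fprodm_ae0; first exact: sqiM.
apply: (ae_time2 (ae_sqi1 de2)) => s sI ds2.
pose h (p : RO) := de (s, p.2) * (swapK kle ((s : TR), p.1) * fsol i k p).
have mKs : measurable_fun setT (fun p : RO => swapK (@kle R) ((s : TR), p.1)).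
  exact: (measurableT_comp (measurable_section1 (s : TR) (measurable_swapK mkle)) measurable_fst).
have Kf2 : sqi Q (fun p : RO => swapK kle ((s : TR), p.1) * fsol i k p).
  by apply: (sqi_bnd f2 mKs) => p; exact: sK1.
have hQ : intg Q h by exact: sqiM (sqi_fst lam ds2) Kf2.
transitivity (\int[Q]_p h p).
  rewrite Rintegral_fprodm2//; apply: ae_eq_Rintegral.
  - apply: measurable_funM; first by case: ds2.
    exact: (measurable_section1 (s : TR) (intg_measurable (sqi_intg Jf2))).
  - exact: (measurable_Rintegral2 lam (intg_measurable hQ)).
  - apply: filterS (ae_sqi2 Kf2) => w Kw; rewrite /h /= RintegralZl//; exact: sqi_intg Kw.
apply: Rintegral_fprodm_ae0 => //; apply: (ae_time2 (ae_sqi1 f2)) => t tI ft2.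
rewrite /h /=; under eq_Rintegral => w _ do rewrite mulrCA.
rewrite RintegralZl//; last exact: sqiM ds2 ft2.
rewrite /fsol /= clipE// own_law_orth ?mulr0//; [exact: (A_F_C2 hA)|exact: (A_F_bounded hA)|exact: de_own].
Qed.

Lemma deviation_tsol : \int[P]_w (tsol i k w * Kint lam kle de ((T : TR), w)) = 0.
Proof.
have t2 := tsol_sqi i k.
rewrite -(Kint_terminal de2 t2); apply: Rintegral_fprodm_ae0; first exact: sqiM de2 (sqi_fst lam t2).
apply: (ae_time2 (ae_sqi1 de2)) => s sI ds2 /=.
apply: own_law_orth; [exact: (A_G_C2 hA)|exact: (A_G_bounded hA)|exact: TI|exact: de_own|exact: ds2].
Qed.

End deviation.

(** * First variation of the cost *)

Definition running_cost (x u : 'M[R]_(n, d)) : R :=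
  n%:R^-1 * (\sum_i L i (row i x, row i u)) + F x.

Lemma grad_i_convex (f : 'M[R]_(n, d) -> R) x x' : C2 f -> convex_function setT f ->
  f x + \sum_i \sum_k grad_i f i x 0 k * (x' - x) i k <= f x'.
Proof.
move=> cf conv; have df := C2_differentiable cf x.
have xx : x + (x' - x) = x' by rewrite addrC subrK.
have := convex_gradient (x' - x) df conv; rewrite xx lerBrDl derive_grad_i//.
by congr (_ + _ <= _); apply: eq_bigr => i _; apply: eq_bigr => k _; rewrite [row _ _ _ _]mxE.
Qed.

(** The Hessian bound of [A_L_convex] has a nonnegative lower side, so it contains the joint
    convexity of [L^i] in state and control. *)
Lemma running_cost_convex x u x' u' :
  running_cost x u + \sum_i \sum_k
    ((n%:R^-1 * grad_fst (L i) (row i x) (row i u) 0 k + grad_i F i x 0 k) * (x' - x) i k +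
     afun i k (row i x) (row i u) * (u' - u) i k) <= running_cost x' u'.
Proof.
have [C [C0 hC]] := A_L_convex hA.
have rowB (A A' : 'M[R]_(n, d)) i k : (row i A' - row i A) 0 k = (A' - A) i k by rewrite !mxE.
have hF' := grad_i_convex x x' (A_F_C2 hA) (A_F_convex hA).
have hL i : L i (row i x, row i u) + \sum_k (grad_fst (L i) (row i x) (row i u) 0 k * (x' - x) i k +
    grad_snd (L i) (row i x) (row i u) 0 k * (u' - u) i k) <= L i (row i x', row i u').
  have := second_derivative_convex (row i x, row i u) (cL i) (v := (row i x' - row i x, row i u' - row i u)).
  move=> /(_ _)/wrap[z|].
    by apply: le_trans (hC i z _); rewrite mulr_ge0 ?(ltW C0)// sqnorm_ge0.
  have -> : (row i x, row i u) + (row i x' - row i x, row i u' - row i u) = (row i x', row i u').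
    by congr pair; rewrite /= addrC subrK.
  rewrite (derive_grad_pair _ _ (C2_differentiable (cL i) _)) lerBrDl.
  congr (_ + _ <= _); rewrite /dotp -big_split/=; apply: eq_bigr => k _.
  by rewrite !rowB.
rewrite /running_cost; have n0 : (0 : R) <= n%:R^-1 by rewrite invr_ge0.
apply: le_trans (lerD (ler_wpM2l n0 (ler_sum _ (fun i _ => hL i))) hF').
rewrite big_split/= mulrDr le_eqVlt; apply/orP; left; apply/eqP.
set A := \sum_i L i _; have alg (p q r s t : R) : r = s + t -> p + q + r = p + s + (q + t).
  by move=> ->; ring.
apply: alg; rewrite mulr_sumr -big_split/=; apply: eq_bigr => i _.
rewrite mulr_sumr -big_split/=; apply: eq_bigr => k _.
have alg (v p q r y z : R) : (v * p + r) * y + v * q * z = v * (p * y + q * z) + r * y.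
  by ring.
exact: alg.
Qed.

Lemma running_cost_intg : intg Q (fun p : RO => running_cost (X (clip T p.1) p.2) (alpha (clip T p.1) p.2)).
Proof.
have mr (V : R -> Omega -> 'M[R]_(n, d)) i l :
    measurable_fun setT (fun p : RO => V (clip T p.1) p.2 i l) ->
    measurable_fun setT (fun p : RO => row i (V (clip T p.1) p.2) 0 l).
  by move=> h; apply: eq_measurable_fun h => p _; rewrite mxE.
have sq (V : RO -> 'M[R]_(n, d)) : (forall i l, sqi Q (fun p => V p i l)) ->
    intg Q (fun p => `|V p| ^+ 2) by move=> h; exact: sqi_sq (sqi_mx_norm h).
apply: intgD.
  apply: intgZ; apply: intg_sum => i.
  have [K K0 hK] := quadratic_growth (cL i) (A_L_bounded hA i).
  have hb := intgZ K (intgD (intg_cst Q 1) (intgD (sq _ x2) (sq _ a2))).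
  apply: (intg_le _ hb) => [|p].
    apply: (measurable_cont_pair (h := L i)); first exact: C2_continuous.
      by move=> l; apply: mr; case: (x2 i l).
    by move=> l; apply: mr; case: (a2 i l).
  apply: (le_trans (hK _)); rewrite ler_wpM2l// lerD2l prod_normE/=.
  set X' := X _ _; set A' := alpha _ _.
  have h1 : `|row i X'| ^+ 2 <= `|X'| ^+ 2 by rewrite ler_sqr ?nnegrE// row_norm_le.
  have h2 : `|row i A'| ^+ 2 <= `|A'| ^+ 2 by rewrite ler_sqr ?nnegrE// row_norm_le.
  case: (leP `|row i X'| `|row i A'|) => _.
    by apply: (le_trans h2); rewrite lerDr sqr_ge0.
  by apply: (le_trans h1); rewrite lerDl sqr_ge0.
have [K K0 hK] := quadratic_growth (A_F_C2 hA) (A_F_bounded hA).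
apply: (intg_le _ (intgZ K (intgD (intg_cst Q 1) (sq _ x2)))) => [|p]; last exact: hK.
by apply: (measurable_cont_mx (C2_continuous (A_F_C2 hA))) => i l; case: (x2 i l).
Qed.

Lemma terminal_cost_intg : intg P (fun w => G (X T w)).
Proof.
have [K K0 hK] := quadratic_growth (A_G_C2 hA) (A_G_bounded hA).
have xT i l := X_sqi i l TI.
apply: (intg_le _ (intgZ K (intgD (intg_cst P 1) (sqi_sq (sqi_mx_norm xT))))) => [|w]; last exact: hK.
by apply: (measurable_cont_mx (C2_continuous (A_G_C2 hA))) => i l; case: (xT i l).
Qed.

Lemma controlled_stateE (b : R -> Omega -> 'M[R]_(n, d)) :
  (forall i k, sqi Q (fun p : RO => b (clip T p.1) p.2 i k)) ->
  {ae P, forall w, forall t, t \in `[0, T] -> forall i k,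
    controlled_state W xi b t w i k = X t w i k +
      Kint lam kle (fun p : RO => b (clip T p.1) p.2 i k - alpha (clip T p.1) p.2 i k) (t, w)}.
Proof.
move=> b2.
have hB : {ae P, forall w, forall i k t,
    Kint lam kle (fun p : RO => b (clip T p.1) p.2 i k - alpha (clip T p.1) p.2 i k) (t, w) =
    Kint lam kle (fun p : RO => b (clip T p.1) p.2 i k) (t, w) -
    Kint lam kle (fun p : RO => alpha (clip T p.1) p.2 i k) (t, w)}.
  by do 2 apply: filter_forall => ?; exact: (KintB mkle kle1).
have hf : {ae P, forall w, forall i t, t \in `[0, T] -> forall k,
    X t w i k = xi w i k + Kint lam kle (fun p : RO => alpha (clip T p.1) p.2 i k) (t, w) + W t w i k}.
  by apply: filter_forall => i; exact: (forward_equation i).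
apply: filterS2 hf hB => w hw hb t tI i k.
rewrite hb hw// mxE [LHS]mxE [X in X + _]mxE [X in X + _ + _]mxE [X in _ + X = _]mxE.
have -> : integral_rV `[0, t] (fun s => row i (b s w)) 0 k =
    Kint lam kle (fun p : RO => b (clip T p.1) p.2 i k) (t, w).
  rewrite mxE (Rintegral_past _ tI); apply: eq_Rintegral => s _; by rewrite mxE.
ring.
Qed.

(** * Comparison with an arbitrary control *)

Section duality.
Variable b : R -> Omega -> 'M[R]_(n, d).
Hypothesis hb : distributed_control P T W xi b.
Let T0 : 0 <= T. Proof. exact: T_ge0. Qed.

Lemma control_sqiQ i k : sqi Q (fun p : RO => b (clip T p.1) p.2 i k).
Proof.
have mb j l : measurable_fun setT (fun p : RO => b (clip T p.1) p.2 j l); last first.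
  exact: ((square_control P mb).1 (ctrl_square hb)).
apply: measurable_timeE.
have h := jointly_measurable_clip T0 (sigma_algebra_measurable Omega) (ctrl_measurable hb) j l.
have mid : measurable_fun setT (id : Omega -> g_sigma_algebraType (@measurable _ Omega)).
  by apply: measurable_id_sub => //; exact: sigma_algebra_measurable.
exact: (measurable_pair_comp h measurable_fst (measurableT_comp mid measurable_snd)).
Qed.

Let b2 := control_sqiQ.
Let de i k (p : RO) := b (clip T p.1) p.2 i k - alpha (clip T p.1) p.2 i k.
Let de2 i k : sqi Q (de i k). Proof. exact: sqiB. Qed.

Let de_own i k (s : R) : s \in `[0, T] ->
  measurable_fun setT ((fun w => de i k (s, w)) : g_sigma_algebraType (own i s) -> R).
Proof.
move=> sI; have so : sigma_algebra setT (own i s) by exact: own_sigma.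
apply: measurable_funB => /=; last by rewrite clipE//; exact: feedback_own.
have ad : measurable_wrt (own i s) (component i b s) by exact: (ctrl_adapted hb).
have := (measurable_wrt_mxP so (component i b s)).1 ad 0 k.
by apply: eq_measurable_fun => w _; rewrite /component clipE// mxE.
Qed.

Let de_own_T i k (s : R) : s \in `[0, T] ->
  measurable_fun setT ((fun w => de i k (s, w)) : g_sigma_algebraType (own i T) -> R).
Proof.
move=> sI; have sT : s <= T by move: sI; rewrite in_itv => /andP[].
by apply: (measurable_fun_subG _ _ _ (de_own k sI)); [exact: own_sigma|exact: own_sigma|exact: own_mono].
Qed.

Let de_full i k (s : R) : s \in `[0, T] ->
  measurable_fun setT ((fun w => de i k (s, w)) : g_sigma_algebraType (full s) -> R).
Proof.
move=> sI; apply: (measurable_fun_subG _ _ _ (de_own k sI));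
  [exact: own_sigma|exact: full_sigma|exact: (own_full hS)].
Qed.

(** First-order change of the running cost along the deviation, with [D_i F] split into its bracket,
    contained in [csol], and the error [fsol]. *)
Definition running_variation (p : RO) : R := \sum_i \sum_k
  ((csol i k p + fsol i k p) * Kint lam kle (de i k) p +
   afun i k (row i (X (clip T p.1) p.2)) (row i (alpha (clip T p.1) p.2)) * de i k p).

Definition terminal_variation (w : Omega) : R := \sum_i \sum_k
  (gfun i k (row i (X T w)) + tsol i k w) * Kint lam kle (de i k) ((T : TR), w).

Let af2 i k : sqi Q (fun p : RO =>
  afun i k (row i (X (clip T p.1) p.2)) (row i (alpha (clip T p.1) p.2))).
Proof.
by apply: (sqi_afun) => l; under eq_fun => p do rewrite mxE.
Qed.
Let c2 i k := csol_sqi i k.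
Let g2 i k := gfun_sqi i k.
Let f2 i k := fsol_sqi i k.
Let t2 i k := tsol_sqi i k.
Let D2 i k : sqi Q (Kint lam kle (de i k)). Proof. exact: (sqi_Kint mkle kle1). Qed.
Let DT2 i k : sqi P (fun w => Kint lam kle (de i k) ((T : TR), w)).
Proof. exact: (sqi_Kint_section mkle kle1). Qed.

Lemma running_variation_intg : intg Q running_variation.
Proof.
apply: intg_sum => i; apply: intg_sum => k; apply: intgD; last exact: sqiM (af2 i k) (de2 i k).
exact: sqiM (sqiD (c2 i k) (f2 i k)) (D2 i k).
Qed.

Lemma terminal_variation_intg : intg P terminal_variation.
Proof.
apply: intg_sum => i; apply: intg_sum => k; exact: sqiM (sqiD (g2 i k) (t2 i k)) (DT2 i k).
Qed.

(** The errors drop out by [deviation_fsol] and [deviation_tsol]. Transposition collects the rest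
    into the integral of [de] times [rsol], which vanishes because the deviation is adapted to
    [full]. *)
Lemma variation_eq0 :
  \int[Q]_p running_variation p + \int[P]_w terminal_variation w = 0.
Proof.
rewrite /running_variation /terminal_variation.
have i1 i k := sqiM (sqiD (c2 i k) (f2 i k)) (D2 i k).
have i2 i k := sqiM (af2 i k) (de2 i k).
have i3 i k := sqiM (sqiD (g2 i k) (t2 i k)) (DT2 i k).
rewrite Rintegral_sum; last by move=> i; apply: intg_sum => k; exact: intgD.
rewrite Rintegral_sum; last by move=> i; exact: intg_sum.
rewrite -big_split big1//= => i _.
rewrite Rintegral_sum; last by move=> k; exact: intgD.
rewrite Rintegral_sum; last by [].
rewrite -big_split big1//= => k _.
rewrite RintegralD//.
have -> : \int[Q]_p ((csol i k p + fsol i k p) * Kint lam kle (de i k) p) =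
    \int[Q]_p (de i k p * J (csol i k) p).
  rewrite -(Kint_transpose mkle kle1 (de2 i k) (c2 i k)).
  have -> : \int[Q]_p ((csol i k p + fsol i k p) * Kint lam kle (de i k) p) =
      \int[Q]_p (csol i k p * Kint lam kle (de i k) p + fsol i k p * Kint lam kle (de i k) p).
    by apply: eq_Rintegral => p _; rewrite mulrDl.
  rewrite RintegralD//; try exact: sqiM (c2 i k) (D2 i k); try exact: sqiM (f2 i k) (D2 i k).
  by rewrite (deviation_fsol k (de2 i k) (@de_own_T i k)) addr0.
have -> : \int[P]_w ((gfun i k (row i (X T w)) + tsol i k w) * Kint lam kle (de i k) ((T : TR), w)) =
    \int[Q]_p (de i k p * gfun i k (row i (X T p.2))).
  rewrite (Kint_terminal (de2 i k) (g2 i k)).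
  have -> : \int[P]_w ((gfun i k (row i (X T w)) + tsol i k w) * Kint lam kle (de i k) ((T : TR), w)) =
      \int[P]_w (gfun i k (row i (X T w)) * Kint lam kle (de i k) ((T : TR), w) +
        tsol i k w * Kint lam kle (de i k) ((T : TR), w)).
    by apply: eq_Rintegral => w _; rewrite mulrDl.
  rewrite RintegralD//; try exact: sqiM (g2 i k) (DT2 i k); try exact: sqiM (t2 i k) (DT2 i k).
  by rewrite (deviation_tsol k (de2 i k) (@de_own_T i k)) addr0.
have gQ : sqi Q (fun p : RO => gfun i k (row i (X T p.2))) by exact: sqi_fst (g2 i k).
have JQ : sqi Q (J (csol i k)) by exact: (sqi_Kint (measurable_swapK mkle) sK1).
have j1 := sqiM (de2 i k) JQ.
have j2 := sqiM (de2 i k) gQ.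
rewrite -RintegralD// -RintegralD//; last exact: intgD.
rewrite -[RHS](rsol_orth_adapted i k (de2 i k) (@de_full i k)).
apply: eq_Rintegral => p _; rewrite /rsol.
have alg (x y z v : R) : x * y + z * x + x * v = x * (z + y + v) by ring.
exact: alg.
Qed.

Let cost0 (p : RO) : R := running_cost (X (clip T p.1) p.2) (alpha (clip T p.1) p.2).

Let var_running w (t : R) : t \in `[0, T] ->
  (forall i k, controlled_state W xi b t w i k = X t w i k + Kint lam kle (de i k) ((t : TR), w)) ->
  cost0 (t, w) + running_variation (t, w) <= running_cost (controlled_state W xi b t w) (b t w).
Proof.
move=> tI E; apply: le_trans (running_cost_convex (X t w) (alpha t w) _ _).
rewrite /cost0/= clipE// lerD2l le_eqVlt; apply/orP; left; apply/eqP.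
apply: eq_bigr => i _; apply: eq_bigr => k _; rewrite !mxB E /csol /fsol /cfun /de/= clipE//.
have alg (p q r u v y z : R) : (p + q + (r - q)) * y + u * z = (p + r) * (v + y - v) + u * z by ring.
exact: alg.
Qed.

Let var_terminal w :
  (forall i k, controlled_state W xi b T w i k = X T w i k + Kint lam kle (de i k) ((T : TR), w)) ->
  G (X T w) + terminal_variation w <= G (controlled_state W xi b T w).
Proof.
move=> E; apply: le_trans (grad_i_convex (X T w) _ (A_G_C2 hA) (A_G_convex hA)).
rewrite lerD2l le_eqVlt; apply/orP; left; apply/eqP.
apply: eq_bigr => i _; apply: eq_bigr => k _; rewrite mxB E /tsol /gfun.
have alg (q r v y : R) : (q + (r - q)) * y = r * (v + y - v) by ring.
exact: alg.
Qed.

Let cost0_intg : intg Q cost0. Proof. exact: running_cost_intg. Qed.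

Lemma feedback_cost_le :
  (J_OL P T W xi L F G alpha <= \int[P]_w (\int[lam]_t cost0 (t, w) + G (X T w))%:E)%E.
Proof.
apply: le_integral_of_ae.
apply: filterS2 (controlled_stateE a2) (ae_intg2 cost0_intg) => w E ic.
have E0 (t : R) : t \in `[0, T] -> controlled_state W xi alpha t w = X t w.
  move=> tI; apply/matrixP => i k; rewrite E// /Kint.
  by under eq_Rintegral => s _ do rewrite subrr mulr0; rewrite /Rintegral integral0 addr0.
rewrite E0// EFinD leeD2r// EFin_Rintegral// integral_time_measure le_eqVlt; apply/orP; left; apply/eqP.
by apply: eq_integral => t; rewrite inE/= => tI; rewrite /cost0/= clipE// E0.
Qed.

(** The comparison is made on almost every path, between an integrable left-hand side and a cost of
    [b] that may be infinite. *)
Lemma control_cost_ge :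
  (\int[P]_w ((\int[lam]_t cost0 (t, w) + G (X T w)) +
     (\int[lam]_t running_variation (t, w) + terminal_variation w))%:E <= J_OL P T W xi L F G b)%E.
Proof.
apply: le_integral_of_ae.
apply: filterS3 (controlled_stateE b2) (ae_intg2 cost0_intg) (ae_intg2 running_variation_intg)
  => w E ic iv.
rewrite addrACA -RintegralD//= EFinD; apply: leeD; last by rewrite lee_fin; apply: var_terminal => i k; exact: E.
rewrite EFin_Rintegral; last exact: intgD.
rewrite -(integral_time_measure T (fun t => (running_cost (controlled_state W xi b t w) (b t w))%:E)).
apply: le_integral_of_ae; apply: ae_time => t tI; rewrite lee_fin.
by apply: var_running => // i k; exact: E.
Qed.

Lemma feedback_optimal : (J_OL P T W xi L F G alpha <= J_OL P T W xi L F G b)%E.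
Proof.
apply: (le_trans feedback_cost_le); apply: le_trans control_cost_ge.
have iA := intgD (intg_Rintegral2 cost0_intg) terminal_cost_intg.
have iV1 := intg_Rintegral2 running_variation_intg.
have iV := intgD iV1 terminal_variation_intg.
rewrite -EFin_Rintegral// -EFin_Rintegral; last exact: intgD.
rewrite lee_fin [leRHS]RintegralD// [X in _ <= _ + X]RintegralD//; last exact: terminal_variation_intg.
by rewrite -(Rintegral_fprodm2 running_variation_intg) variation_eq0 addr0.
Qed.

End duality.

End solution.

Theorem proposition3p6 (R : realType) (n d : nat) (T : R)
    (dd : measure_display) (Omega : measurableType dd)
    (P : probability Omega R) (F0 : set (set Omega))
    (W : R -> Omega -> 'M[R]_(n, d)) (xi : Omega -> 'M[R]_(n, d))
    (L H : 'I_n -> 'rV[R]_d * 'rV[R]_d -> R) (F G : 'M[R]_(n, d) -> R)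
    (X Y : R -> Omega -> 'M[R]_(n, d)) (Z : 'I_n -> R -> Omega -> 'M[R]_d)
    (m : R -> 'I_n -> probability (borelRn R d) R) :
  setting P T F0 W xi ->
  assumptions_A L H F G ->
  fbsde_solution P T F0 W xi L H F G X Y Z m ->
  OL_optimizer P T W xi L F G (feedback H X Y).
Proof.
move=> hS hA hF; split; first exact: feedback_distributed hS hA hF.
by move=> b hb; exact: (feedback_optimal hS hA hF hb).
Qed.
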